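(* Let $\alpha\vdash\sigma(\alpha)$ be an inductively constructed type in which $\alpha$ occurs only positively. Let $\mu\alpha.\sigma(\alpha)=\Pi\alpha.(\sigma(\alpha)\multimap\alpha)\to\alpha$, $\mathit{fold}=\Lambda\alpha.\lambda f{:}\sigma(\alpha)\multimap\alpha.\lambda^\circ u{:}\mu\alpha.\sigma(\alpha).\ u\,\alpha\,(!f)$, and $\mathit{in}:\sigma(\mu\alpha.\sigma(\alpha))\multimap\mu\alpha.\sigma(\alpha)$, $\mathit{in}\,z=\Lambda\alpha.\lambda f{:}\sigma(\alpha)\multimap\alpha.\ f(\sigma(\mathit{fold}\,\alpha\,(!f))\,z)$. Let $\Xi\mid-;-\vdash f:\sigma(\tau)\multimap\tau$ be an algebra and $\Xi\mid-;-\vdash h:\mu\alpha.\sigma(\alpha)\multimap\tau$ a map of algebras from $\mathit{in}$ to $f$, i.e. $h\circ\mathit{in}$ is internally equal to $f\circ\sigma(h)$. Then in LAPL extended with the extensionality schemes and the identity extension schema it is provable that $h=_{\mu\alpha.\sigma(\alpha)\multimap\tau}\mathit{fold}\,\tau\,(!f)$. (Hence $\mathit{in}$ is an initial algebra for the endofunctor of ${\rm LinType}_\Xi$ induced by $\sigma$.)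
   Context: PILL$_Y$ is the polymorphic intuitionistic/linear lambda calculus with fixed points. Types in a context $\Xi$ of type variables are given by $\sigma ::= \alpha \mid I \mid \sigma\otimes\sigma \mid \sigma\multimap\sigma \mid\ !\sigma \mid \Pi\alpha.\sigma$. Terms are typed in judgements $\Xi\mid\Gamma;\Delta\vdash t:\tau$ with an intuitionistic variable context $\Gamma$ and a linear variable context $\Delta$; the constructs are variables, $\star:I$, linear abstraction $\lambda^\circ x{:}\sigma.t$ and application $t\,u$, $t\otimes s$, $!t$ (allowed only when the linear context is empty), type abstraction $\Lambda\alpha.t$ and type application $t\,\sigma$, the eliminations $\mathrm{let}\ x\otimes y = s\ \mathrm{in}\ t$, $\mathrm{let}\ !x = s\ \mathrm{in}\ t$, $\mathrm{let}\ \star = s\ \mathrm{in}\ t$, and a constant $Y:\Pi\alpha.(\alpha\to\alpha)\to\alpha$. Here $\sigma\to\tau$ abbreviates $!\sigma\multimap\tau$ and $\lambda x{:}\sigma.t$ abbreviates $\lambda^\circ y{:}!\sigma.\ \mathrm{let}\ !x=y\ \mathrm{in}\ t$. External equality of terms is generated by the $\beta$- and $\eta$-rules of all constructs, commuting conversions of the let-constructs with linear contexts, congruence, and $f\,(!(Y\,\sigma\,(!f))) = Y\,\sigma\,(!f)$. $g\circ f=\lambda^\circ x.g(f\,x)$. LAPL is an intuitionistic higher-order predicate logic over PILL$_Y$ with contexts $\Xi\mid\Gamma\mid\Theta$, where $\Theta$ declares relation variables and admissible relation variables $R:\mathrm{AdmRel}(\sigma,\tau)$; propositions include internal equality $t=_\sigma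 u$ (externally equal terms are internally equal), $\rho(t,u)$ for definable relations, connectives and quantifiers over types, terms, relations and admissible relations. Admissible relations are a designated class of definable relations containing equality relations and graphs $\langle f\rangle=(x,y).f\,x=y$ of linear terms. Each type $\sigma(\vec\alpha)$ has a relational interpretation $\sigma[\vec\rho]$ at admissible relations $\vec\rho$, with $\alpha_i[\vec\rho]\equiv\rho_i$, $(\sigma\multimap\sigma')[\vec\rho](f,g)\Leftrightarrow\forall x,y.\ \sigma[\vec\rho](x,y)\supset\sigma'[\vec\rho](f\,x,g\,y)$, $(!\sigma)[\vec\rho](!x,!y)$ whenever $\sigma[\vec\rho](x,y)$, and $(\Pi\beta.\sigma)[\vec\rho](t,u)\Leftrightarrow\forall\beta,\beta'.\forall R:\mathrm{AdmRel}(\beta,\beta').\ \sigma[\vec\rho,R](t\,\beta,u\,\beta')$ (and analogous clauses for $\otimes,I$). The extensionality schemes are $(\forall x.\ t\,x=u\,x)\supset t=_{\sigma\multimap\tau}u$ and $(\forall\alpha.\ t\,\alpha=u\,\alpha)\supset t=_{\Pi\alpha.\tau}u$; the identity extension schema is $\forall\vec\alpha.\ \sigma[eq_{\vec\alpha}]\equiv eq_{\sigma(\vec\alpha)}$ for every type $\sigma(\vec\alpha)$, $eq$ denoting internal equality. ${\rm LinType}_\Xi$ is the category with objects types in context $\Xi$ and morphisms terms $\Xi\mid-;-\vdash f:\sigma\multimap\tau$ modulo internal equality provable in LAPL plus extensionality and identity extension. A type is inductively constructed if it is built from type variables and closed types using $\multimap,\otimes,I,!,\Pi$; positive/negative occurrences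 are as usual ($\multimap$ reverses polarity in its argument). For such $\sigma(\alpha)$ with $\alpha$ only positive, the functorial action $\sigma(f):\sigma(\tau)\multimap\sigma(\tau')$ of $f:\tau\multimap\tau'$ is the term defined by structural induction: $\alpha(f)=f$; closed types act by identity; $(\sigma_1\multimap\sigma_2)(f)=\lambda^\circ h.\ \sigma_2(f)\circ h\circ\sigma_1(f)$ (with $\sigma_1(f)$ going backwards since $\alpha$ is negative in $\sigma_1$); $\otimes$ componentwise; $(!\sigma_1)(f)=\lambda^\circ x.\mathrm{let}\ !y=x\ \mathrm{in}\ !(\sigma_1(f)\,y)$; $(\Pi\omega.\sigma_1)(f)=\lambda^\circ z.\Lambda\omega.\sigma_1(f)(z\,\omega)$. *)

(* Defs.v *)
(* MathComp (ssreflect); pure syntax, no algebra or analysis. *)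
From mathcomp Require Import all_boot.

Set Implicit Arguments.
Unset Strict Implicit.
Unset Printing Implicit Defensive.

(* A deep embedding, in de Bruijn style, of PILL_Y and of the logic LAPL.
   Type variables, term variables and relation variables are three separate
   families of indices; index 0 is always the innermost binder.  A type context
   Xi is its length. *)

(** * Types of PILL_Y *)

Inductive ty : Type :=
| tyVar of nat
| tyI
| tyTensor of ty & ty
| tyLolli of ty & ty
| tyBang of ty
| tyPi of ty.

Notation "s --o t" := (tyLolli s t) (at level 55, right associativity).
Notation tyArr s t := (tyLolli (tyBang s) t).

Definition scons {T : Type} (x : T) (s : nat -> T) (i : nat) : T :=
  if i is j.+1 then s j else x.

Definition upren (r : nat -> nat) : nat -> nat := scons 0 (fun i => (r i).+1).

Fixpoint ren_ty (r : nat -> nat) (s : ty) : ty :=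
  match s with
  | tyVar i => tyVar (r i)
  | tyI => tyI
  | tyTensor a b => tyTensor (ren_ty r a) (ren_ty r b)
  | tyLolli a b => tyLolli (ren_ty r a) (ren_ty r b)
  | tyBang a => tyBang (ren_ty r a)
  | tyPi a => tyPi (ren_ty (upren r) a)
  end.

Definition up_ty (f : nat -> ty) : nat -> ty :=
  scons (tyVar 0) (fun i => ren_ty S (f i)).

Fixpoint subst_ty (f : nat -> ty) (s : ty) : ty :=
  match s with
  | tyVar i => f i
  | tyI => tyI
  | tyTensor a b => tyTensor (subst_ty f a) (subst_ty f b)
  | tyLolli a b => tyLolli (subst_ty f a) (subst_ty f b)
  | tyBang a => tyBang (subst_ty f a)
  | tyPi a => tyPi (subst_ty (up_ty f) a)
  end.

Definition inst_ty (t : ty) (s : ty) : ty := subst_ty (scons t tyVar) s.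

Fixpoint wf_ty (n : nat) (s : ty) : bool :=
  match s with
  | tyVar i => i < n
  | tyI => true
  | tyTensor a b => wf_ty n a && wf_ty n b
  | tyLolli a b => wf_ty n a && wf_ty n b
  | tyBang a => wf_ty n a
  | tyPi a => wf_ty n.+1 a
  end.

Definition closed_ty (s : ty) : bool := wf_ty 0 s.

(** * Terms of PILL_Y *)

(* Intuitionistic and linear variables share one family of indices; the typing
   context says which is which.  [tmLetT s t] is "let x (x) y = s in t", with
   y = index 0 and x = index 1 in t. *)
Inductive tm : Type :=
| tmVar of nat
| tmStar
| tmY
| tmLam of ty & tm
| tmApp of tm & tm
| tmTensor of tm & tm
| tmBang of tm
| tmTLam of tm
| tmTApp of tm & ty
| tmLetT of tm & tm
| tmLetB of tm & tm
| tmLetS of tm & tm.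

Fixpoint ren_tm (rt r : nat -> nat) (t : tm) : tm :=
  match t with
  | tmVar i => tmVar (r i)
  | tmStar => tmStar
  | tmY => tmY
  | tmLam s t => tmLam (ren_ty rt s) (ren_tm rt (upren r) t)
  | tmApp t u => tmApp (ren_tm rt r t) (ren_tm rt r u)
  | tmTensor t u => tmTensor (ren_tm rt r t) (ren_tm rt r u)
  | tmBang t => tmBang (ren_tm rt r t)
  | tmTLam t => tmTLam (ren_tm (upren rt) r t)
  | tmTApp t s => tmTApp (ren_tm rt r t) (ren_ty rt s)
  | tmLetT s t => tmLetT (ren_tm rt r s) (ren_tm rt (upren (upren r)) t)
  | tmLetB s t => tmLetB (ren_tm rt r s) (ren_tm rt (upren r) t)
  | tmLetS s t => tmLetS (ren_tm rt r s) (ren_tm rt r t)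
  end.

Definition shift_tm (k : nat) : tm -> tm := ren_tm id (addn k).
Definition tshift_tm (k : nat) : tm -> tm := ren_tm (addn k) id.

Definition up_tm (f : nat -> tm) : nat -> tm :=
  scons (tmVar 0) (fun i => shift_tm 1 (f i)).

Fixpoint subst_tm (ft : nat -> ty) (f : nat -> tm) (t : tm) : tm :=
  match t with
  | tmVar i => f i
  | tmStar => tmStar
  | tmY => tmY
  | tmLam s t => tmLam (subst_ty ft s) (subst_tm ft (up_tm f) t)
  | tmApp t u => tmApp (subst_tm ft f t) (subst_tm ft f u)
  | tmTensor t u => tmTensor (subst_tm ft f t) (subst_tm ft f u)
  | tmBang t => tmBang (subst_tm ft f t)
  | tmTLam t => tmTLam (subst_tm (up_ty ft) (fun i => tshift_tm 1 (f i)) t)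
  | tmTApp t s => tmTApp (subst_tm ft f t) (subst_ty ft s)
  | tmLetT s t => tmLetT (subst_tm ft f s) (subst_tm ft (up_tm (up_tm f)) t)
  | tmLetB s t => tmLetB (subst_tm ft f s) (subst_tm ft (up_tm f) t)
  | tmLetS s t => tmLetS (subst_tm ft f s) (subst_tm ft f t)
  end.

Definition inst_tm (u : tm) (t : tm) : tm := subst_tm tyVar (scons u tmVar) t.

(* [inst2_tm u v t] substitutes u for index 1 and v for index 0. *)
Definition inst2_tm (u v : tm) (t : tm) : tm :=
  subst_tm tyVar (scons v (scons u tmVar)) t.

Definition tinst_tm (s : ty) (t : tm) : tm := subst_tm (scons s tyVar) tmVar t.

(* "lambda x : s. t", i.e. lambda^o y : !s. let !x = y in t; index 0 of t is x,
   and the renaming makes room for y. *)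
Definition tmLamI (s : ty) (t : tm) : tm :=
  tmLam (tyBang s) (tmLetB (tmVar 0) (ren_tm id (upren S) t)).

Definition tmId (s : ty) : tm := tmLam s (tmVar 0).

(* g o f, for f with domain s. *)
Definition tmComp (s : ty) (g f : tm) : tm :=
  tmLam s (tmApp (shift_tm 1 g) (tmApp (shift_tm 1 f) (tmVar 0))).

(** * Typing *)

(* The dual context Gamma; Delta is one list of entries: [Int] entries form
   Gamma and [Lin] entries form Delta.  [Used] keeps the place of a linear
   variable that is in scope but has gone to another part of the term, so that
   splitting Delta does not renumber variables. *)
Inductive entry : Type := Int of ty | Lin of ty | Used of ty.

Definition is_lin (e : entry) : bool := if e is Lin _ then true else false.

Definition map_entry (f : ty -> ty) (e : entry) : entry :=
  match e with
  | Int s => Int (f s)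
  | Lin s => Lin (f s)
  | Used s => Used (f s)
  end.

Definition lin_free (G : seq entry) : bool := count is_lin G == 0.

(* Gamma; Delta splits into Gamma; Delta1 and Gamma; Delta2. *)
Inductive csplit : seq entry -> seq entry -> seq entry -> Prop :=
| cs_nil : csplit [::] [::] [::]
| cs_int s G G1 G2 :
    csplit G G1 G2 -> csplit (Int s :: G) (Int s :: G1) (Int s :: G2)
| cs_left s G G1 G2 :
    csplit G G1 G2 -> csplit (Lin s :: G) (Lin s :: G1) (Used s :: G2)
| cs_right s G G1 G2 :
    csplit G G1 G2 -> csplit (Lin s :: G) (Used s :: G1) (Lin s :: G2)
| cs_used s G G1 G2 :
    csplit G G1 G2 -> csplit (Used s :: G) (Used s :: G1) (Used s :: G2).

Definition tyY : ty := tyPi (tyArr (tyArr (tyVar 0) (tyVar 0)) (tyVar 0)).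

Inductive typing : nat -> seq entry -> tm -> ty -> Prop :=
| ty_int n G i s :
    onth G i = Some (Int s) -> lin_free G -> typing n G (tmVar i) s
| ty_lin n G i s :
    onth G i = Some (Lin s) -> count is_lin G = 1 -> typing n G (tmVar i) s
| ty_star n G : lin_free G -> typing n G tmStar tyI
| ty_Y n G : lin_free G -> typing n G tmY tyY
| ty_lam n G s t r :
    wf_ty n s -> typing n (Lin s :: G) t r -> typing n G (tmLam s t) (s --o r)
| ty_app n G G1 G2 t u s r :
    csplit G G1 G2 -> typing n G1 t (s --o r) -> typing n G2 u s ->
    typing n G (tmApp t u) r
| ty_tensor n G G1 G2 t u s r :
    csplit G G1 G2 -> typing n G1 t s -> typing n G2 u r ->
    typing n G (tmTensor t u) (tyTensor s r)
| ty_bang n G t s :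
    lin_free G -> typing n G t s -> typing n G (tmBang t) (tyBang s)
| ty_tlam n G t s :
    typing n.+1 (map (map_entry (ren_ty S)) G) t s ->
    typing n G (tmTLam t) (tyPi s)
| ty_tapp n G t s r :
    typing n G t (tyPi s) -> wf_ty n r -> typing n G (tmTApp t r) (inst_ty r s)
| ty_letT n G G1 G2 s t a b r :
    csplit G G1 G2 -> typing n G1 s (tyTensor a b) ->
    typing n (Lin b :: Lin a :: G2) t r -> typing n G (tmLetT s t) r
| ty_letB n G G1 G2 s t a r :
    csplit G G1 G2 -> typing n G1 s (tyBang a) ->
    typing n (Int a :: G2) t r -> typing n G (tmLetB s t) r
| ty_letS n G G1 G2 s t r :
    csplit G G1 G2 -> typing n G1 s tyI -> typing n G2 t r ->
    typing n G (tmLetS s t) r.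

(** * External equality *)

(* Linear contexts C[-]: terms with one hole, not under a "!". *)
Inductive lctx : Type :=
| cHole
| cLam of ty & lctx
| cAppL of lctx & tm
| cAppR of tm & lctx
| cTensorL of lctx & tm
| cTensorR of tm & lctx
| cTLam of lctx
| cTApp of lctx & ty
| cLetTL of lctx & tm
| cLetTR of tm & lctx
| cLetBL of lctx & tm
| cLetBR of tm & lctx
| cLetSL of lctx & tm
| cLetSR of tm & lctx.

Fixpoint plug (C : lctx) (u : tm) : tm :=
  match C with
  | cHole => u
  | cLam s C => tmLam s (plug C u)
  | cAppL C t => tmApp (plug C u) t
  | cAppR t C => tmApp t (plug C u)
  | cTensorL C t => tmTensor (plug C u) t
  | cTensorR t C => tmTensor t (plug C u)
  | cTLam C => tmTLam (plug C u)
  | cTApp C s => tmTApp (plug C u) s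
  | cLetTL C t => tmLetT (plug C u) t
  | cLetTR t C => tmLetT t (plug C u)
  | cLetBL C t => tmLetB (plug C u) t
  | cLetBR t C => tmLetB t (plug C u)
  | cLetSL C t => tmLetS (plug C u) t
  | cLetSR t C => tmLetS t (plug C u)
  end.

(* Number of term variables, resp. type variables, bound by C at its hole. *)
Fixpoint vdepth (C : lctx) : nat :=
  match C with
  | cHole => 0
  | cLam _ C | cLetBR _ C => (vdepth C).+1
  | cLetTR _ C => (vdepth C).+2
  | cAppL C _ | cAppR _ C | cTensorL C _ | cTensorR _ C | cTLam C | cTApp C _
  | cLetTL C _ | cLetBL C _ | cLetSL C _ | cLetSR _ C => vdepth C
  end.

Fixpoint tdepth (C : lctx) : nat :=
  match C with
  | cHole => 0
  | cTLam C => (tdepth C).+1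
  | cLam _ C | cAppL C _ | cAppR _ C | cTensorL C _ | cTensorR _ C | cTApp C _
  | cLetTL C _ | cLetTR _ C | cLetBL C _ | cLetBR _ C
  | cLetSL C _ | cLetSR _ C => tdepth C
  end.

Fixpoint ren_lctx (r : nat -> nat) (C : lctx) : lctx :=
  match C with
  | cHole => cHole
  | cLam s C => cLam s (ren_lctx (upren r) C)
  | cAppL C t => cAppL (ren_lctx r C) (ren_tm id r t)
  | cAppR t C => cAppR (ren_tm id r t) (ren_lctx r C)
  | cTensorL C t => cTensorL (ren_lctx r C) (ren_tm id r t)
  | cTensorR t C => cTensorR (ren_tm id r t) (ren_lctx r C)
  | cTLam C => cTLam (ren_lctx r C)
  | cTApp C s => cTApp (ren_lctx r C) s
  | cLetTL C t => cLetTL (ren_lctx r C) (ren_tm id (upren (upren r)) t)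
  | cLetTR t C => cLetTR (ren_tm id r t) (ren_lctx (upren (upren r)) C)
  | cLetBL C t => cLetBL (ren_lctx r C) (ren_tm id (upren r) t)
  | cLetBR t C => cLetBR (ren_tm id r t) (ren_lctx (upren r) C)
  | cLetSL C t => cLetSL (ren_lctx r C) (ren_tm id r t)
  | cLetSR t C => cLetSR (ren_tm id r t) (ren_lctx r C)
  end.

(* A term moved to the hole of C, avoiding capture by C. *)
Definition under_lctx (C : lctx) (t : tm) : tm :=
  ren_tm (addn (tdepth C)) (addn (vdepth C)) t.

(* Exchange of the k innermost variables (bound by C) with the next m ones
   (bound by a let), used when the let is moved inside C. *)
Definition exch (k m i : nat) : nat :=
  if i < k then i + m else if i < k + m then i - k else i.

(* [eqt n G t u s] is external equality Xi | Gamma; Delta |- t = u : s.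
   In the commuting conversions the let-bound variables may occur in u but not
   in C, whence the renaming of C on the left-hand side. *)
Inductive eqt : nat -> seq entry -> tm -> tm -> ty -> Prop :=
| eqt_refl n G t s : typing n G t s -> eqt n G t t s
| eqt_sym n G t u s : eqt n G t u s -> eqt n G u t s
| eqt_trans n G t u v s : eqt n G t u s -> eqt n G u v s -> eqt n G t v s
(* congruence *)
| eqt_lam n G s t t' r :
    wf_ty n s -> eqt n (Lin s :: G) t t' r ->
    eqt n G (tmLam s t) (tmLam s t') (s --o r)
| eqt_app n G G1 G2 t t' u u' s r :
    csplit G G1 G2 -> eqt n G1 t t' (s --o r) -> eqt n G2 u u' s ->
    eqt n G (tmApp t u) (tmApp t' u') r
| eqt_tensor n G G1 G2 t t' u u' s r :
    csplit G G1 G2 -> eqt n G1 t t' s -> eqt n G2 u u' r ->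
    eqt n G (tmTensor t u) (tmTensor t' u') (tyTensor s r)
| eqt_bang n G t t' s :
    lin_free G -> eqt n G t t' s -> eqt n G (tmBang t) (tmBang t') (tyBang s)
| eqt_tlam n G t t' s :
    eqt n.+1 (map (map_entry (ren_ty S)) G) t t' s ->
    eqt n G (tmTLam t) (tmTLam t') (tyPi s)
| eqt_tapp n G t t' s r :
    eqt n G t t' (tyPi s) -> wf_ty n r ->
    eqt n G (tmTApp t r) (tmTApp t' r) (inst_ty r s)
| eqt_letT n G G1 G2 s s' t t' a b r :
    csplit G G1 G2 -> eqt n G1 s s' (tyTensor a b) ->
    eqt n (Lin b :: Lin a :: G2) t t' r ->
    eqt n G (tmLetT s t) (tmLetT s' t') r
| eqt_letB n G G1 G2 s s' t t' a r :
    csplit G G1 G2 -> eqt n G1 s s' (tyBang a) ->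
    eqt n (Int a :: G2) t t' r -> eqt n G (tmLetB s t) (tmLetB s' t') r
| eqt_letS n G G1 G2 s s' t t' r :
    csplit G G1 G2 -> eqt n G1 s s' tyI -> eqt n G2 t t' r ->
    eqt n G (tmLetS s t) (tmLetS s' t') r
(* beta *)
| eqt_beta_lam n G s t u r :
    typing n G (tmApp (tmLam s t) u) r ->
    eqt n G (tmApp (tmLam s t) u) (inst_tm u t) r
| eqt_beta_tlam n G t s r :
    typing n G (tmTApp (tmTLam t) s) r ->
    eqt n G (tmTApp (tmTLam t) s) (tinst_tm s t) r
| eqt_beta_tensor n G u v t r :
    typing n G (tmLetT (tmTensor u v) t) r ->
    eqt n G (tmLetT (tmTensor u v) t) (inst2_tm u v t) r
| eqt_beta_bang n G u t r :
    typing n G (tmLetB (tmBang u) t) r ->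
    eqt n G (tmLetB (tmBang u) t) (inst_tm u t) r
| eqt_beta_star n G t r :
    typing n G (tmLetS tmStar t) r -> eqt n G (tmLetS tmStar t) t r
(* eta *)
| eqt_eta_lam n G t s r :
    typing n G t (s --o r) ->
    eqt n G (tmLam s (tmApp (shift_tm 1 t) (tmVar 0))) t (s --o r)
| eqt_eta_tlam n G t s :
    typing n G t (tyPi s) ->
    eqt n G (tmTLam (tmTApp (tshift_tm 1 t) (tyVar 0))) t (tyPi s)
| eqt_eta_tensor n G t a b :
    typing n G t (tyTensor a b) ->
    eqt n G (tmLetT t (tmTensor (tmVar 1) (tmVar 0))) t (tyTensor a b)
| eqt_eta_bang n G t a :
    typing n G t (tyBang a) ->
    eqt n G (tmLetB t (tmBang (tmVar 0))) t (tyBang a)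
| eqt_eta_star n G t : typing n G t tyI -> eqt n G (tmLetS t tmStar) t tyI
(* commuting conversions *)
| eqt_comm_tensor n G C t u r :
    typing n G (tmLetT t (plug (ren_lctx (addn 2) C) u)) r ->
    eqt n G (tmLetT t (plug (ren_lctx (addn 2) C) u))
            (plug C (tmLetT (under_lctx C t) (ren_tm id (exch (vdepth C) 2) u))) r
| eqt_comm_bang n G C t u r :
    typing n G (tmLetB t (plug (ren_lctx (addn 1) C) u)) r ->
    eqt n G (tmLetB t (plug (ren_lctx (addn 1) C) u))
            (plug C (tmLetB (under_lctx C t) (ren_tm id (exch (vdepth C) 1) u))) r
| eqt_comm_star n G C t u r :
    typing n G (tmLetS t (plug C u)) r ->
    eqt n G (tmLetS t (plug C u)) (plug C (tmLetS (under_lctx C t) u)) r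
(* fixed points *)
| eqt_Y n G f s :
    wf_ty n s -> lin_free G -> typing n G f (tyArr s s) ->
    eqt n G (tmApp f (tmBang (tmApp (tmTApp tmY s) (tmBang f))))
            (tmApp (tmTApp tmY s) (tmBang f)) s.

(** * Propositions and definable relations of LAPL *)

Inductive rkind : Type := Any | Adm.

(* [pAllR Any s t] quantifies over R : Rel(s,t), [pAllR Adm s t] over
   R : AdmRel(s,t).  [rCompr s t phi] is (x : s, y : t). phi, with x = index 1
   and y = index 0. *)
Inductive prop : Type :=
| pEq of ty & tm & tm
| pRel of rel & tm & tm
| pTop
| pBot
| pImp of prop & prop
| pAnd of prop & prop
| pOr of prop & prop
| pAllT of prop
| pExT of prop
| pAll of ty & prop
| pEx of ty & prop
| pAllR of rkind & ty & ty & prop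
| pExR of rkind & ty & ty & prop
with rel : Type :=
| rVar of nat
| rCompr of ty & ty & prop.

Fixpoint ren_prop (rt r rr : nat -> nat) (p : prop) : prop :=
  match p with
  | pEq s t u => pEq (ren_ty rt s) (ren_tm rt r t) (ren_tm rt r u)
  | pRel R t u => pRel (ren_rel rt r rr R) (ren_tm rt r t) (ren_tm rt r u)
  | pTop => pTop
  | pBot => pBot
  | pImp p q => pImp (ren_prop rt r rr p) (ren_prop rt r rr q)
  | pAnd p q => pAnd (ren_prop rt r rr p) (ren_prop rt r rr q)
  | pOr p q => pOr (ren_prop rt r rr p) (ren_prop rt r rr q)
  | pAllT p => pAllT (ren_prop (upren rt) r rr p)
  | pExT p => pExT (ren_prop (upren rt) r rr p)
  | pAll s p => pAll (ren_ty rt s) (ren_prop rt (upren r) rr p)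
  | pEx s p => pEx (ren_ty rt s) (ren_prop rt (upren r) rr p)
  | pAllR k s t p =>
      pAllR k (ren_ty rt s) (ren_ty rt t) (ren_prop rt r (upren rr) p)
  | pExR k s t p =>
      pExR k (ren_ty rt s) (ren_ty rt t) (ren_prop rt r (upren rr) p)
  end
with ren_rel (rt r rr : nat -> nat) (R : rel) : rel :=
  match R with
  | rVar i => rVar (rr i)
  | rCompr s t p =>
      rCompr (ren_ty rt s) (ren_ty rt t) (ren_prop rt (upren (upren r)) rr p)
  end.

(* Weakening by type, term and relation variables. *)
Definition tshift_prop (k : nat) := ren_prop (addn k) id id.
Definition shift_prop (k : nat) := ren_prop id (addn k) id.
Definition rshift_prop (k : nat) := ren_prop id id (addn k).
Definition tshift_rel (k : nat) := ren_rel (addn k) id id.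
Definition shift_rel (k : nat) := ren_rel id (addn k) id.
Definition rshift_rel (k : nat) := ren_rel id id (addn k).

Definition up_rel (f : nat -> rel) : nat -> rel :=
  scons (rVar 0) (fun i => rshift_rel 1 (f i)).

Fixpoint subst_prop (ft : nat -> ty) (f : nat -> tm) (fr : nat -> rel)
    (p : prop) : prop :=
  match p with
  | pEq s t u => pEq (subst_ty ft s) (subst_tm ft f t) (subst_tm ft f u)
  | pRel R t u =>
      pRel (subst_rel ft f fr R) (subst_tm ft f t) (subst_tm ft f u)
  | pTop => pTop
  | pBot => pBot
  | pImp p q => pImp (subst_prop ft f fr p) (subst_prop ft f fr q)
  | pAnd p q => pAnd (subst_prop ft f fr p) (subst_prop ft f fr q)
  | pOr p q => pOr (subst_prop ft f fr p) (subst_prop ft f fr q)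
  | pAllT p =>
      pAllT (subst_prop (up_ty ft) (fun i => tshift_tm 1 (f i))
                        (fun i => tshift_rel 1 (fr i)) p)
  | pExT p =>
      pExT (subst_prop (up_ty ft) (fun i => tshift_tm 1 (f i))
                       (fun i => tshift_rel 1 (fr i)) p)
  | pAll s p =>
      pAll (subst_ty ft s)
           (subst_prop ft (up_tm f) (fun i => shift_rel 1 (fr i)) p)
  | pEx s p =>
      pEx (subst_ty ft s)
          (subst_prop ft (up_tm f) (fun i => shift_rel 1 (fr i)) p)
  | pAllR k s t p =>
      pAllR k (subst_ty ft s) (subst_ty ft t) (subst_prop ft f (up_rel fr) p)
  | pExR k s t p =>
      pExR k (subst_ty ft s) (subst_ty ft t) (subst_prop ft f (up_rel fr) p)
  end
with subst_rel (ft : nat -> ty) (f : nat -> tm) (fr : nat -> rel)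
    (R : rel) : rel :=
  match R with
  | rVar i => fr i
  | rCompr s t p =>
      rCompr (subst_ty ft s) (subst_ty ft t)
        (subst_prop ft (up_tm (up_tm f)) (fun i => shift_rel 2 (fr i)) p)
  end.

Definition tinst_prop (s : ty) (p : prop) : prop :=
  subst_prop (scons s tyVar) tmVar rVar p.
Definition inst_prop (t : tm) (p : prop) : prop :=
  subst_prop tyVar (scons t tmVar) rVar p.
Definition inst2_prop (t u : tm) (p : prop) : prop :=
  subst_prop tyVar (scons u (scons t tmVar)) rVar p.
Definition rinst_prop (R : rel) (p : prop) : prop :=
  subst_prop tyVar tmVar (scons R rVar) p.

(* Relation context Theta: kind and the two types of each variable. *)
Definition rdecl : Type := (rkind * ty * ty)%type.
Definition tshift_rdecl (d : rdecl) : rdecl :=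
  let: (k, s, t) := d in (k, ren_ty S s, ren_ty S t).

(* [wf_prop n Gam Th p] is Xi | Gamma | Theta |- p : Prop, and
   [wf_rel n Gam Th R s t] is Xi | Gamma | Theta |- R : Rel(s,t).  Terms of the
   logic are typed with an empty linear context. *)
Inductive wf_prop : nat -> seq ty -> seq rdecl -> prop -> Prop :=
| wf_eq n Gam Th s t u :
    typing n (map Int Gam) t s -> typing n (map Int Gam) u s ->
    wf_prop n Gam Th (pEq s t u)
| wf_app n Gam Th R s r t u :
    wf_rel n Gam Th R s r ->
    typing n (map Int Gam) t s -> typing n (map Int Gam) u r ->
    wf_prop n Gam Th (pRel R t u)
| wf_top n Gam Th : wf_prop n Gam Th pTop
| wf_bot n Gam Th : wf_prop n Gam Th pBot
| wf_imp n Gam Th p q :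
    wf_prop n Gam Th p -> wf_prop n Gam Th q -> wf_prop n Gam Th (pImp p q)
| wf_and n Gam Th p q :
    wf_prop n Gam Th p -> wf_prop n Gam Th q -> wf_prop n Gam Th (pAnd p q)
| wf_or n Gam Th p q :
    wf_prop n Gam Th p -> wf_prop n Gam Th q -> wf_prop n Gam Th (pOr p q)
| wf_allT n Gam Th p :
    wf_prop n.+1 (map (ren_ty S) Gam) (map tshift_rdecl Th) p ->
    wf_prop n Gam Th (pAllT p)
| wf_exT n Gam Th p :
    wf_prop n.+1 (map (ren_ty S) Gam) (map tshift_rdecl Th) p ->
    wf_prop n Gam Th (pExT p)
| wf_all n Gam Th s p :
    wf_ty n s -> wf_prop n (s :: Gam) Th p -> wf_prop n Gam Th (pAll s p)
| wf_ex n Gam Th s p :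
    wf_ty n s -> wf_prop n (s :: Gam) Th p -> wf_prop n Gam Th (pEx s p)
| wf_allR n Gam Th k s t p :
    wf_ty n s -> wf_ty n t -> wf_prop n Gam ((k, s, t) :: Th) p ->
    wf_prop n Gam Th (pAllR k s t p)
| wf_exR n Gam Th k s t p :
    wf_ty n s -> wf_ty n t -> wf_prop n Gam ((k, s, t) :: Th) p ->
    wf_prop n Gam Th (pExR k s t p)
with wf_rel : nat -> seq ty -> seq rdecl -> rel -> ty -> ty -> Prop :=
| wf_rvar n Gam Th i k s t :
    onth Th i = Some (k, s, t) -> wf_rel n Gam Th (rVar i) s t
| wf_compr n Gam Th s t p :
    wf_ty n s -> wf_ty n t -> wf_prop n (t :: s :: Gam) Th p ->
    wf_rel n Gam Th (rCompr s t p) s t.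

(** * Constructions on relations *)

Definition rEq (s : ty) : rel := rCompr s s (pEq s (tmVar 1) (tmVar 0)).

(* The graph of f : s --o t. *)
Definition rGraph (s t : ty) (f : tm) : rel :=
  rCompr s t (pEq t (tmApp (shift_tm 2 f) (tmVar 1)) (tmVar 0)).

(* R == R', for R, R' : Rel(s,t). *)
Definition pEquiv (s t : ty) (R R' : rel) : prop :=
  let a := pRel (shift_rel 2 R) (tmVar 1) (tmVar 0) in
  let b := pRel (shift_rel 2 R') (tmVar 1) (tmVar 0) in
  pAll s (pAll t (pAnd (pImp a b) (pImp b a))).

(* R --o R' for R : Rel(s,t) and R' : Rel(s',t'):
   (f, g). forall x : s, y : t. R(x,y) => R'(f x, g y). *)
Definition rLolli (s t s' t' : ty) (R R' : rel) : rel :=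
  rCompr (s --o s') (t --o t')
    (pAll s (pAll t
      (pImp (pRel (shift_rel 4 R) (tmVar 1) (tmVar 0))
            (pRel (shift_rel 4 R') (tmApp (tmVar 3) (tmVar 1))
                                   (tmApp (tmVar 2) (tmVar 0)))))).

(* R -> R' for R : Rel(s,t) and R' : Rel(s',t'):
   (f, g). forall x : s, y : t. R(x,y) => R'(f !x, g !y). *)
Definition rArr (s t s' t' : ty) (R R' : rel) : rel :=
  rCompr (tyArr s s') (tyArr t t')
    (pAll s (pAll t
      (pImp (pRel (shift_rel 4 R) (tmVar 1) (tmVar 0))
            (pRel (shift_rel 4 R') (tmApp (tmVar 3) (tmBang (tmVar 1)))
                                   (tmApp (tmVar 2) (tmBang (tmVar 0))))))).

(* forall (a, b, S : AdmRel(a,b)). R, for R : Rel(s,t) over the extended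
   contexts, where a = index 1, b = index 0 and S = index 0; s and t are the
   bodies of the two Pi-types. *)
Definition rAll (s t : ty) (R : rel) : rel :=
  rCompr (tyPi s) (tyPi t)
    (pAllT (pAllT (pAllR Adm (tyVar 1) (tyVar 0)
      (pRel (shift_rel 2 R) (tmTApp (tmVar 1) (tyVar 1))
                            (tmTApp (tmVar 0) (tyVar 0)))))).

(* Weakening of a relation to the contexts of the body of rAll. *)
Definition rwk (R : rel) : rel := ren_rel (addn 2) id S R.

(* The relational interpretations of I, (x) and ! are obtained by pulling back
   those of the second-order encodings
     I      ~ Pi a. a --o a
     s (x) t ~ Pi a. (s --o t --o a) --o a
     !s     ~ Pi a. (s -> a) --o a
   along the canonical maps encI, encT, encB.  For "!", the arrow (s -> a) is
   interpreted by rArr, which avoids circularity. *)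
Definition encI : tm :=
  tmLam tyI (tmTLam (tmLam (tyVar 0) (tmLetS (tmVar 1) (tmVar 0)))).

Definition encT (s t : ty) : tm :=
  tmLam (tyTensor s t)
    (tmLetT (tmVar 0)
      (tmTLam (tmLam (ren_ty S s --o ren_ty S t --o tyVar 0)
        (tmApp (tmApp (tmVar 0) (tmVar 2)) (tmVar 1))))).

Definition encB (s : ty) : tm :=
  tmLam (tyBang s)
    (tmTLam (tmLam (tyArr (ren_ty S s) (tyVar 0))
      (tmApp (tmVar 0) (tmVar 1)))).

Definition rI : rel :=
  let a := tyVar 1 in let b := tyVar 0 in
  rCompr tyI tyI
    (pRel (rAll (tyVar 0 --o tyVar 0) (tyVar 0 --o tyVar 0)
                (rLolli a b a b (rVar 0) (rVar 0)))
          (tmApp encI (tmVar 1)) (tmApp encI (tmVar 0))).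

(* R (x) R' for R : Rel(s,t) and R' : Rel(s',t'). *)
Definition rTensor (s t s' t' : ty) (R R' : rel) : rel :=
  let a := tyVar 1 in let b := tyVar 0 in
  let w := ren_ty (addn 2) in
  let cod x y := (ren_ty S x --o ren_ty S y --o tyVar 0) --o tyVar 0 in
  rCompr (tyTensor s s') (tyTensor t t')
    (pRel (shift_rel 2
             (rAll (cod s s') (cod t t')
               (rLolli (w s --o w s' --o a) (w t --o w t' --o b) a b
                 (rLolli (w s) (w t) (w s' --o a) (w t' --o b) (rwk R)
                   (rLolli (w s') (w t') a b (rwk R') (rVar 0)))
                 (rVar 0))))
          (tmApp (encT s s') (tmVar 1)) (tmApp (encT t t') (tmVar 0))).

(* !R for R : Rel(s,t). *)
Definition rBang (s t : ty) (R : rel) : rel :=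
  let a := tyVar 1 in let b := tyVar 0 in
  let w := ren_ty (addn 2) in
  let cod x := tyArr (ren_ty S x) (tyVar 0) --o tyVar 0 in
  rCompr (tyBang s) (tyBang t)
    (pRel (shift_rel 2
             (rAll (cod s) (cod t)
               (rLolli (tyArr (w s) a) (tyArr (w t) b) a b
                 (rArr (w s) (w t) a b (rwk R) (rVar 0))
                 (rVar 0))))
          (tmApp (encB s) (tmVar 1)) (tmApp (encB t) (tmVar 0))).

(* An environment assigns to the i-th type variable two types and a relation
   between them; [rint s e] is the relational interpretation s[e], a relation
   between [src_ty e s] and [tgt_ty e s]. *)
Definition renv : Type := seq (ty * ty * rel).

Definition env_at (e : renv) (i : nat) : ty * ty * rel :=
  nth (tyI, tyI, rEq tyI) e i.

Definition src_ty (e : renv) (s : ty) : ty :=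
  subst_ty (fun i => (env_at e i).1.1) s.
Definition tgt_ty (e : renv) (s : ty) : ty :=
  subst_ty (fun i => (env_at e i).1.2) s.

Definition up_env (e : renv) : renv :=
  (tyVar 1, tyVar 0, rVar 0)
    :: map (fun x => (ren_ty (addn 2) x.1.1, ren_ty (addn 2) x.1.2, rwk x.2)) e.

Fixpoint rint (s : ty) (e : renv) : rel :=
  match s with
  | tyVar i => (env_at e i).2
  | tyI => rI
  | tyTensor a b =>
      rTensor (src_ty e a) (tgt_ty e a) (src_ty e b) (tgt_ty e b)
              (rint a e) (rint b e)
  | tyLolli a b =>
      rLolli (src_ty e a) (tgt_ty e a) (src_ty e b) (tgt_ty e b)
             (rint a e) (rint b e)
  | tyBang a => rBang (src_ty e a) (tgt_ty e a) (rint a e)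
  | tyPi a =>
      rAll (subst_ty (up_ty (fun i => (env_at e i).1.1)) a)
           (subst_ty (up_ty (fun i => (env_at e i).1.2)) a)
           (rint a (up_env e))
  end.

(* The environment sending each of k type variables to its equality. *)
Definition eq_env (k : nat) : renv :=
  mkseq (fun i => (tyVar i, tyVar i, rEq (tyVar i))) k.

(** * Admissible relations *)

(* LAPL is relative to a designated class of admissible relations among the
   definable ones; [A n Gam Th R s t] reads
   Xi | Gamma | Theta |- R : AdmRel(s,t).  Only the closure properties below
   are required, so every larger stock of formation rules is covered. *)
Definition adm_pred : Type :=
  nat -> seq ty -> seq rdecl -> rel -> ty -> ty -> Prop.

Record adm_class (A : adm_pred) : Prop := {
  adm_rel n Gam Th R s t : A n Gam Th R s t -> wf_rel n Gam Th R s t;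
  adm_var n Gam Th i s t :
    onth Th i = Some (Adm, s, t) -> A n Gam Th (rVar i) s t;
  adm_eq n Gam Th s : wf_ty n s -> A n Gam Th (rEq s) s s;
  adm_graph n Gam Th f s t :
    wf_ty n s -> wf_ty n t -> typing n (map Int Gam) f (s --o t) ->
    A n Gam Th (rGraph s t f) s t
}.

(* The judgement R : Rel(s,t) or R : AdmRel(s,t) according to the kind. *)
Definition has_kind (A : adm_pred) (k : rkind) : adm_pred :=
  if k is Adm then A else wf_rel.

(** * Provability in LAPL with extensionality and identity extension *)

(* [drv A n Gam Th Ph p] is Xi | Gamma | Theta | Phi |- p. *)
Inductive drv (A : adm_pred) :
    nat -> seq ty -> seq rdecl -> seq prop -> prop -> Prop :=
| d_ax n Gam Th Ph i p : onth Ph i = Some p -> drv A n Gam Th Ph p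
| d_topI n Gam Th Ph : drv A n Gam Th Ph pTop
| d_botE n Gam Th Ph p :
    wf_prop n Gam Th p -> drv A n Gam Th Ph pBot -> drv A n Gam Th Ph p
| d_impI n Gam Th Ph p q :
    wf_prop n Gam Th p -> drv A n Gam Th (p :: Ph) q ->
    drv A n Gam Th Ph (pImp p q)
| d_impE n Gam Th Ph p q :
    drv A n Gam Th Ph (pImp p q) -> drv A n Gam Th Ph p -> drv A n Gam Th Ph q
| d_andI n Gam Th Ph p q :
    drv A n Gam Th Ph p -> drv A n Gam Th Ph q -> drv A n Gam Th Ph (pAnd p q)
| d_andEl n Gam Th Ph p q : drv A n Gam Th Ph (pAnd p q) -> drv A n Gam Th Ph p
| d_andEr n Gam Th Ph p q : drv A n Gam Th Ph (pAnd p q) -> drv A n Gam Th Ph q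
| d_orIl n Gam Th Ph p q :
    wf_prop n Gam Th q -> drv A n Gam Th Ph p -> drv A n Gam Th Ph (pOr p q)
| d_orIr n Gam Th Ph p q :
    wf_prop n Gam Th p -> drv A n Gam Th Ph q -> drv A n Gam Th Ph (pOr p q)
| d_orE n Gam Th Ph p q c :
    drv A n Gam Th Ph (pOr p q) ->
    drv A n Gam Th (p :: Ph) c -> drv A n Gam Th (q :: Ph) c ->
    drv A n Gam Th Ph c
(* quantifiers over types *)
| d_allTI n Gam Th Ph p :
    drv A n.+1 (map (ren_ty S) Gam) (map tshift_rdecl Th)
        (map (tshift_prop 1) Ph) p ->
    drv A n Gam Th Ph (pAllT p)
| d_allTE n Gam Th Ph p s :
    wf_ty n s -> drv A n Gam Th Ph (pAllT p) -> drv A n Gam Th Ph (tinst_prop s p)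
| d_exTI n Gam Th Ph p s :
    wf_prop n Gam Th (pExT p) -> wf_ty n s ->
    drv A n Gam Th Ph (tinst_prop s p) -> drv A n Gam Th Ph (pExT p)
| d_exTE n Gam Th Ph p c :
    wf_prop n Gam Th c -> drv A n Gam Th Ph (pExT p) ->
    drv A n.+1 (map (ren_ty S) Gam) (map tshift_rdecl Th)
        (p :: map (tshift_prop 1) Ph) (tshift_prop 1 c) ->
    drv A n Gam Th Ph c
(* quantifiers over terms *)
| d_allI n Gam Th Ph s p :
    wf_ty n s -> drv A n (s :: Gam) Th (map (shift_prop 1) Ph) p ->
    drv A n Gam Th Ph (pAll s p)
| d_allE n Gam Th Ph s p t :
    typing n (map Int Gam) t s -> drv A n Gam Th Ph (pAll s p) ->
    drv A n Gam Th Ph (inst_prop t p)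
| d_exI n Gam Th Ph s p t :
    wf_prop n Gam Th (pEx s p) -> typing n (map Int Gam) t s ->
    drv A n Gam Th Ph (inst_prop t p) -> drv A n Gam Th Ph (pEx s p)
| d_exE n Gam Th Ph s p c :
    wf_prop n Gam Th c -> drv A n Gam Th Ph (pEx s p) ->
    drv A n (s :: Gam) Th (p :: map (shift_prop 1) Ph) (shift_prop 1 c) ->
    drv A n Gam Th Ph c
(* quantifiers over relations and over admissible relations *)
| d_allRI n Gam Th Ph k s t p :
    wf_ty n s -> wf_ty n t ->
    drv A n Gam ((k, s, t) :: Th) (map (rshift_prop 1) Ph) p ->
    drv A n Gam Th Ph (pAllR k s t p)
| d_allRE n Gam Th Ph k s t p R :
    has_kind A k n Gam Th R s t -> drv A n Gam Th Ph (pAllR k s t p) ->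
    drv A n Gam Th Ph (rinst_prop R p)
| d_exRI n Gam Th Ph k s t p R :
    wf_prop n Gam Th (pExR k s t p) -> has_kind A k n Gam Th R s t ->
    drv A n Gam Th Ph (rinst_prop R p) -> drv A n Gam Th Ph (pExR k s t p)
| d_exRE n Gam Th Ph k s t p c :
    wf_prop n Gam Th c -> drv A n Gam Th Ph (pExR k s t p) ->
    drv A n Gam ((k, s, t) :: Th) (p :: map (rshift_prop 1) Ph)
        (rshift_prop 1 c) ->
    drv A n Gam Th Ph c
(* definable relations *)
| d_comprI n Gam Th Ph s t p x y :
    wf_prop n Gam Th (pRel (rCompr s t p) x y) ->
    drv A n Gam Th Ph (inst2_prop x y p) ->
    drv A n Gam Th Ph (pRel (rCompr s t p) x y)
| d_comprE n Gam Th Ph s t p x y :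
    drv A n Gam Th Ph (pRel (rCompr s t p) x y) ->
    drv A n Gam Th Ph (inst2_prop x y p)
(* internal equality *)
| d_ext n Gam Th Ph s t u :
    eqt n (map Int Gam) t u s -> drv A n Gam Th Ph (pEq s t u)
| d_leibniz n Gam Th Ph s t u p :
    wf_prop n (s :: Gam) Th p -> drv A n Gam Th Ph (pEq s t u) ->
    drv A n Gam Th Ph (inst_prop t p) -> drv A n Gam Th Ph (inst_prop u p)
(* extensionality schemes *)
| d_extensionality n Gam Th Ph s r t u :
    typing n (map Int Gam) t (s --o r) -> typing n (map Int Gam) u (s --o r) ->
    drv A n Gam Th Ph
      (pImp (pAll s (pEq r (tmApp (shift_tm 1 t) (tmVar 0))
                           (tmApp (shift_tm 1 u) (tmVar 0))))
            (pEq (s --o r) t u))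
| d_extensionalityT n Gam Th Ph s t u :
    typing n (map Int Gam) t (tyPi s) -> typing n (map Int Gam) u (tyPi s) ->
    drv A n Gam Th Ph
      (pImp (pAllT (pEq s (tmTApp (tshift_tm 1 t) (tyVar 0))
                          (tmTApp (tshift_tm 1 u) (tyVar 0))))
            (pEq (tyPi s) t u))
(* identity extension schema, for a type s in k type variables *)
| d_identity_extension n Gam Th Ph k s :
    wf_ty k s ->
    drv A n Gam Th Ph
      (iter k pAllT (pEquiv s s (rint s (eq_env k)) (rEq s))).

Definition provable (A : adm_pred) (n : nat) (p : prop) : Prop :=
  drv A n [::] [::] [::] p.

(** * Inductively constructed types and their functorial action *)

(* In this grammar, which has no type constants, every type satisfies it. *)
Inductive ind_constructed : ty -> Prop :=
| ic_var i : ind_constructed (tyVar i)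
| ic_closed s : closed_ty s -> ind_constructed s
| ic_I : ind_constructed tyI
| ic_tensor a b :
    ind_constructed a -> ind_constructed b -> ind_constructed (tyTensor a b)
| ic_lolli a b :
    ind_constructed a -> ind_constructed b -> ind_constructed (a --o b)
| ic_bang a : ind_constructed a -> ind_constructed (tyBang a)
| ic_pi a : ind_constructed a -> ind_constructed (tyPi a).

(* The type variable k occurs in s only positively (p = true), resp. only
   negatively (p = false). *)
Fixpoint occurs_only (p : bool) (k : nat) (s : ty) : bool :=
  match s with
  | tyVar i => (i != k) || p
  | tyI => true
  | tyTensor a b => occurs_only p k a && occurs_only p k b
  | tyLolli a b => occurs_only (~~ p) k a && occurs_only p k b
  | tyBang a => occurs_only p k a
  | tyPi a => occurs_only p k.+1 a
  end.

(* s with t for the type variable k; t already lives under the k inner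
   binders. *)
Definition put_ty (k : nat) (t : ty) (s : ty) : ty :=
  subst_ty (fun i => if i < k then tyVar i
                     else if i == k then t else tyVar i.-1) s.

(* Action of s, in the type variable k, on f : t --o t'.  If k occurs only
   positively in s (p = true), it has type s(t) --o s(t'); if only negatively
   (p = false), type s(t') --o s(t).  The other type variables are parameters
   and are acted upon by the identity. *)
Fixpoint act (p : bool) (k : nat) (t t' : ty) (f : tm) (s : ty) : tm :=
  let src := put_ty k (if p then t else t') in
  let tgt := put_ty k (if p then t' else t) in
  if closed_ty s then tmId s else
  match s with
  | tyVar i => if i == k then f else tmId (src (tyVar i))
  | tyI => tmId tyI
  | tyTensor a b =>
      tmLam (src (tyTensor a b))
        (tmLetT (tmVar 0)
          (tmTensor (tmApp (shift_tm 3 (act p k t t' f a)) (tmVar 1))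
                    (tmApp (shift_tm 3 (act p k t t' f b)) (tmVar 0))))
  | tyLolli a b =>
      tmLam (src (a --o b))
        (tmComp (tgt a) (shift_tm 1 (act p k t t' f b))
          (tmComp (tgt a) (tmVar 0) (shift_tm 1 (act (~~ p) k t t' f a))))
  | tyBang a =>
      tmLam (src (tyBang a))
        (tmLetB (tmVar 0)
          (tmBang (tmApp (shift_tm 2 (act p k t t' f a)) (tmVar 0))))
  | tyPi a =>
      tmLam (src (tyPi a))
        (tmTLam
          (tmApp
            (shift_tm 1
              (act p k.+1 (ren_ty S t) (ren_ty S t') (tshift_tm 1 f) a))
            (tmTApp (tmVar 0) (tyVar 0))))
  end.

(** * The type mu a. s(a) and its algebra structure *)

(* Here s has the single type variable a = index 0; [tapp s t] is s(t) and
   [fmap s t t' f] is s(f) : s(t) --o s(t') for f : t --o t'. *)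
Definition tapp (s t : ty) : ty := inst_ty t s.
Definition fmap (s t t' : ty) (f : tm) : tm := act true 0 t t' f s.

Definition mu (s : ty) : ty := tyPi (tyArr (s --o tyVar 0) (tyVar 0)).

Definition fold (s : ty) : tm :=
  tmTLam (tmLamI (s --o tyVar 0)
    (tmLam (mu s) (tmApp (tmTApp (tmVar 0) (tyVar 0)) (tmBang (tmVar 1))))).

(* fold t (!f) *)
Definition fold_at (s t : ty) (f : tm) : tm :=
  tmApp (tmTApp (fold s) t) (tmBang f).

Definition in_ (s : ty) : tm :=
  tmLam (tapp s (mu s))
    (tmTLam (tmLamI (s --o tyVar 0)
      (tmApp (tmVar 0)
        (tmApp (fmap s (mu s) (tyVar 0) (fold_at s (tyVar 0) (tmVar 0)))
               (tmVar 1))))).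

(** * Algebras in LinType_Xi *)

(* Objects of LinType_Xi are the types in context Xi, morphisms the terms
   Xi | -; - |- f : s --o t up to provable internal equality. *)
Definition morphism (n : nat) (s t : ty) (f : tm) : Prop :=
  typing n [::] f (s --o t).

Definition eq_morphism (A : adm_pred) (n : nat) (s t : ty) (f g : tm) : Prop :=
  provable A n (pEq (s --o t) f g).

Definition is_algebra (n : nat) (s t : ty) (f : tm) : Prop :=
  wf_ty n t /\ morphism n (tapp s t) t f.

(* h is a map of algebras from (t, f) to (t', f'). *)
Definition algebra_map (A : adm_pred) (n : nat) (s t : ty) (f : tm) (t' : ty)
    (f' h : tm) : Prop :=
  morphism n t t' h /\
  eq_morphism A n (tapp s t) t' (tmComp (tapp s t) h f)
    (tmComp (tapp s t) f' (fmap s t t' h)).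

Definition initial_algebra (A : adm_pred) (n : nat) (s t : ty) (f : tm) : Prop :=
  is_algebra n s t f /\
  forall t' f', is_algebra n s t' f' ->
    (exists h, algebra_map A n s t f t' f' h) /\
    (forall h h', algebra_map A n s t f t' f' h ->
       algebra_map A n s t f t' f' h' -> eq_morphism A n t t' h h').

(* Main.v *)
(** Proof idea.  Identity extension for the closed type
    [Pi a b. (a -o b) -> (s(a) -o s(b))], applied to the polymorphic term acting
    by [s], shows that [s(h)] maps [s[<h>]]-related arguments to [s[eq]]-related
    ones, where [<h>] is the graph of [h], against [s(id)] on the other side.
    Since [s[eq]] is equality and [s(id) = id] by eta, [s[<h>](x,y)] implies
    [s(h) x = y].  Hence, for an algebra map [h] into [(t, f)], [in] and [f] are
    related by [s[<h>] -o <h>], and parametricity of [u : mu a. s] at [<h>] gives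
    [h (u mu !in) = u t !f].  Taking [h = fold a g] for all [a] and [g] yields
    [u mu !in = u] by extensionality, so [h u = u t !f = fold t !f u]. *)

From mathcomp Require Import all_boot.
From Stdlib Require Import FunctionalExtensionality.
Require Import Defs.

Set Implicit Arguments.
Unset Strict Implicit.
Unset Printing Implicit Defensive.

(** * Substitution *)

(** Derivations live in de Bruijn contexts that grow with every quantifier rule. A fact obtained in
    one context and wanted under further variables is therefore first made a hypothesis, by [d_impE]
    followed by [d_impI]; the quantifier rules then carry it along in shifted form. Typing is
    treated with similar economy: it is transported along renamings, and β-reducts are typed
    directly.

    The exponential is the delicate type former. Both the functor and [fold] take their function
    under [!], while the relation [!R] is defined only by pulling back along an encoding. Two facts
    have to be extracted from that encoding: related [x], [y] give related [!x], [!y] ([d_bangI]),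
    and functions out of [!s] that agree on all elements [!x] are equal ([d_bang_ext]), which the
    extensionality scheme, quantifying over all of [!s], does not give at once.

    What is computational, namely the identity law of the functor and the algebra law of [fold], is
    proved as external equality by β and η. Quantifiers over admissible relations are instantiated
    only at graphs and equalities, so the class [A] can be any class containing these. *)

Ltac fext := let i := fresh "i" in apply: functional_extensionality => i.

Lemma upren_id : upren id = id.
Proof. by fext; case: i. Qed.

Lemma upren_comp (r2 r1 : nat -> nat) :
  (fun i => upren r2 (upren r1 i)) = upren (fun i => r2 (r1 i)).
Proof. by fext; case: i. Qed.

(** The composition laws come in the same order for types, for terms, then for propositions:
    renaming after renaming, substitution after renaming, renaming after substitution, substitution
    after substitution. Under a binder the last two use the earlier ones, because a lifted
    substitution contains a renaming. *)
Lemma ren_ren_ty s r2 r1 : ren_ty r2 (ren_ty r1 s) = ren_ty (fun i => r2 (r1 i)) s.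
Proof.
elim: s r2 r1 => //= [a IHa b IHb|a IHa b IHb|a IHa|a IHa] r2 r1;
  by rewrite ?IHa ?IHb ?upren_comp.
Qed.

Lemma subst_ren_ty s f r : subst_ty f (ren_ty r s) = subst_ty (fun i => f (r i)) s.
Proof.
elim: s f r => //= [a IHa b IHb|a IHa b IHb|a IHa|a IHa] f r; rewrite ?IHa ?IHb //.
by congr (tyPi (subst_ty _ _)); fext; case: i.
Qed.

Lemma ren_subst_ty s r f :
  ren_ty r (subst_ty f s) = subst_ty (fun i => ren_ty r (f i)) s.
Proof.
elim: s f r => //= [a IHa b IHb|a IHa b IHb|a IHa|a IHa] f r; rewrite ?IHa ?IHb //.
by congr (tyPi (subst_ty _ _)); fext; case: i => //= i; rewrite !ren_ren_ty.
Qed.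

Lemma subst_subst_ty s g f :
  subst_ty g (subst_ty f s) = subst_ty (fun i => subst_ty g (f i)) s.
Proof.
elim: s f g => //= [a IHa b IHb|a IHa b IHb|a IHa|a IHa] f g; rewrite ?IHa ?IHb //.
congr (tyPi (subst_ty _ _)); fext; case: i => //= i.
by rewrite subst_ren_ty ren_subst_ty.
Qed.

Lemma up_ty_var : up_ty tyVar = tyVar.
Proof. by fext; case: i. Qed.

Lemma subst_id_ty s : subst_ty tyVar s = s.
Proof. by elim: s => //= [a -> b ->|a -> b ->|a ->|a IH] //; rewrite up_ty_var IH. Qed.

Lemma ren_as_subst_ty s r : ren_ty r s = subst_ty (fun i => tyVar (r i)) s.
Proof. by rewrite -[in LHS](subst_id_ty s) ren_subst_ty. Qed.

Lemma ren_id_ty s : ren_ty id s = s.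
Proof. by rewrite ren_as_subst_ty subst_id_ty. Qed.

Lemma ren_ren_tm t rt2 r2 rt1 r1 :
  ren_tm rt2 r2 (ren_tm rt1 r1 t)
    = ren_tm (fun i => rt2 (rt1 i)) (fun i => r2 (r1 i)) t.
Proof.
elim: t rt2 r2 rt1 r1 => //=;
  by intros; rewrite ?ren_ren_ty ?H ?H0 ?upren_comp.
Qed.

Lemma up_tm_upren f r : (fun i => up_tm f (upren r i)) = up_tm (fun i => f (r i)).
Proof. by fext; case: i. Qed.

Lemma up_ty_upren f r : (fun i => up_ty f (upren r i)) = up_ty (fun i => f (r i)).
Proof. by fext; case: i. Qed.

Lemma subst_ren_tm t ft f rt r :
  subst_tm ft f (ren_tm rt r t) = subst_tm (fun i => ft (rt i)) (fun i => f (r i)) t.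
Proof.
elim: t ft f rt r => //=; intros;
  by rewrite ?subst_ren_ty ?H ?H0 ?up_tm_upren ?up_ty_upren.
Qed.

Lemma ren_up_tm rt r f :
  (fun i => ren_tm rt (upren r) (up_tm f i)) = up_tm (fun i => ren_tm rt r (f i)).
Proof. by fext; case: i => //= i; rewrite /shift_tm !ren_ren_tm. Qed.

Lemma ren_up_ty rt f :
  (fun i => ren_ty (upren rt) (up_ty f i)) = up_ty (fun i => ren_ty rt (f i)).
Proof. by fext; case: i => //= i; rewrite !ren_ren_ty. Qed.

Lemma ren_tshift_tm rt r t :
  ren_tm (upren rt) r (tshift_tm 1 t) = tshift_tm 1 (ren_tm rt r t).
Proof. by rewrite /tshift_tm !ren_ren_tm. Qed.

Lemma ren_subst_tm t rt r ft f :
  ren_tm rt r (subst_tm ft f t)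
    = subst_tm (fun i => ren_ty rt (ft i)) (fun i => ren_tm rt r (f i)) t.
Proof.
elim: t ft f rt r => //=; intros;
  rewrite ?ren_subst_ty ?H ?H0 ?ren_up_tm ?ren_up_ty //.
by congr (tmTLam (subst_tm _ _ _)); fext; rewrite ren_tshift_tm.
Qed.

Lemma subst_up_tm gt g f :
  (fun i => subst_tm gt (up_tm g) (up_tm f i)) = up_tm (fun i => subst_tm gt g (f i)).
Proof.
fext; case: i => //= i; rewrite /shift_tm subst_ren_tm ren_subst_tm.
by f_equal; fext; rewrite ?ren_id_ty.
Qed.

Lemma subst_up_ty g f :
  (fun i => subst_ty (up_ty g) (up_ty f i)) = up_ty (fun i => subst_ty g (f i)).
Proof. by fext; case: i => //= i; rewrite subst_ren_ty ren_subst_ty. Qed.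

Lemma subst_tshift_tm gt g t :
  subst_tm (up_ty gt) (fun i => tshift_tm 1 (g i)) (tshift_tm 1 t)
    = tshift_tm 1 (subst_tm gt g t).
Proof. by rewrite /tshift_tm subst_ren_tm ren_subst_tm. Qed.

Lemma subst_subst_tm t gt g ft f :
  subst_tm gt g (subst_tm ft f t)
    = subst_tm (fun i => subst_ty gt (ft i)) (fun i => subst_tm gt g (f i)) t.
Proof.
elim: t ft f gt g => //=; intros;
  rewrite ?subst_subst_ty ?H ?H0 ?subst_up_tm ?subst_up_ty //.
by congr (tmTLam (subst_tm _ _ _)); fext; rewrite subst_tshift_tm.
Qed.

Lemma up_tm_var : up_tm tmVar = tmVar.
Proof. by fext; case: i. Qed.

Lemma subst_id_tm t : subst_tm tyVar tmVar t = t.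
Proof.
elim: t => //=; intros; rewrite ?subst_id_ty ?up_tm_var ?up_ty_var ?H ?H0 //.
Qed.

Lemma ren_as_subst_tm t rt r :
  ren_tm rt r t = subst_tm (fun i => tyVar (rt i)) (fun i => tmVar (r i)) t.
Proof. by rewrite -[in LHS](subst_id_tm t) ren_subst_tm. Qed.

Lemma ren_id_tm t : ren_tm id id t = t.
Proof. by rewrite ren_as_subst_tm subst_id_tm. Qed.

(* Substitution calculus of propositions and relations, mutually inductive through comprehension *)
Scheme prop_rel_ind := Induction for prop Sort Prop
  with rel_prop_ind := Induction for rel Sort Prop.
Combined Scheme prop_rel_mutind from prop_rel_ind, rel_prop_ind.

Lemma ren_ren_prop_rel :
  (forall p rt2 r2 rr2 rt1 r1 rr1,
     ren_prop rt2 r2 rr2 (ren_prop rt1 r1 rr1 p)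
       = ren_prop (fun i => rt2 (rt1 i)) (fun i => r2 (r1 i)) (fun i => rr2 (rr1 i)) p) /\
  (forall R rt2 r2 rr2 rt1 r1 rr1,
     ren_rel rt2 r2 rr2 (ren_rel rt1 r1 rr1 R)
       = ren_rel (fun i => rt2 (rt1 i)) (fun i => r2 (r1 i)) (fun i => rr2 (rr1 i)) R).
Proof.
apply: prop_rel_mutind => //=; intros;
  by rewrite ?ren_ren_ty ?ren_ren_tm ?H ?H0 ?upren_comp.
Qed.

Definition ren_ren_prop p := ren_ren_prop_rel.1 p.
Definition ren_ren_rel R := ren_ren_prop_rel.2 R.

Lemma up_rel_upren f r : (fun i => up_rel f (upren r i)) = up_rel (fun i => f (r i)).
Proof. by fext; case: i. Qed.

Lemma subst_ren_prop_rel :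
  (forall p ft f fr rt r rr,
     subst_prop ft f fr (ren_prop rt r rr p)
       = subst_prop (fun i => ft (rt i)) (fun i => f (r i)) (fun i => fr (rr i)) p) /\
  (forall R ft f fr rt r rr,
     subst_rel ft f fr (ren_rel rt r rr R)
       = subst_rel (fun i => ft (rt i)) (fun i => f (r i)) (fun i => fr (rr i)) R).
Proof.
apply: prop_rel_mutind => //=; intros;
  by rewrite ?subst_ren_ty ?subst_ren_tm ?H ?H0 ?up_tm_upren ?up_ty_upren ?up_rel_upren.
Qed.

Definition subst_ren_rel R := subst_ren_prop_rel.2 R.

Lemma ren_up_rel rt r rr f :
  (fun i => ren_rel rt r (upren rr) (up_rel f i)) = up_rel (fun i => ren_rel rt r rr (f i)).
Proof. by fext; case: i => //= i; rewrite /rshift_rel !ren_ren_rel. Qed.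

Lemma ren_tshift_rel rt r rr R :
  ren_rel (upren rt) r rr (tshift_rel 1 R) = tshift_rel 1 (ren_rel rt r rr R).
Proof. by rewrite /tshift_rel !ren_ren_rel. Qed.

Lemma ren_shift_rel rt r rr R :
  ren_rel rt (upren r) rr (shift_rel 1 R) = shift_rel 1 (ren_rel rt r rr R).
Proof. by rewrite /shift_rel !ren_ren_rel. Qed.

Lemma ren_shift2_rel rt r rr R :
  ren_rel rt (upren (upren r)) rr (shift_rel 2 R) = shift_rel 2 (ren_rel rt r rr R).
Proof. by rewrite /shift_rel !ren_ren_rel. Qed.

Lemma ren_subst_prop_rel :
  (forall p rt r rr ft f fr,
     ren_prop rt r rr (subst_prop ft f fr p)
       = subst_prop (fun i => ren_ty rt (ft i)) (fun i => ren_tm rt r (f i))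
           (fun i => ren_rel rt r rr (fr i)) p) /\
  (forall R rt r rr ft f fr,
     ren_rel rt r rr (subst_rel ft f fr R)
       = subst_rel (fun i => ren_ty rt (ft i)) (fun i => ren_tm rt r (f i))
           (fun i => ren_rel rt r rr (fr i)) R).
Proof.
apply: prop_rel_mutind => //=; intros;
  rewrite ?ren_subst_ty ?ren_subst_tm ?H ?H0 ?ren_up_tm ?ren_up_ty ?ren_up_rel //;
  do 2?f_equal; fext;
  by rewrite ?ren_tshift_tm ?ren_tshift_rel ?ren_shift_rel ?ren_shift2_rel.
Qed.

Definition ren_subst_rel R := ren_subst_prop_rel.2 R.

Lemma subst_up_rel gt g gr f :
  (fun i => subst_rel gt g (up_rel gr) (up_rel f i)) = up_rel (fun i => subst_rel gt g gr (f i)).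
Proof.
fext; case: i => //= i; rewrite /rshift_rel subst_ren_rel ren_subst_rel.
by f_equal; fext; rewrite ?ren_id_ty ?ren_id_tm.
Qed.

Lemma subst_tshift_rel gt g gr R :
  subst_rel (up_ty gt) (fun i => tshift_tm 1 (g i)) (fun i => tshift_rel 1 (gr i))
      (tshift_rel 1 R)
    = tshift_rel 1 (subst_rel gt g gr R).
Proof. by rewrite /tshift_rel subst_ren_rel ren_subst_rel. Qed.

Lemma subst_shift_rel gt g gr R :
  subst_rel gt (up_tm g) (fun i => shift_rel 1 (gr i)) (shift_rel 1 R)
    = shift_rel 1 (subst_rel gt g gr R).
Proof.
rewrite /shift_rel subst_ren_rel ren_subst_rel.
by f_equal; fext; rewrite ?ren_id_ty.
Qed.

Lemma subst_shift2_rel gt g gr R :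
  subst_rel gt (up_tm (up_tm g)) (fun i => shift_rel 2 (gr i)) (shift_rel 2 R)
    = shift_rel 2 (subst_rel gt g gr R).
Proof.
rewrite /shift_rel subst_ren_rel ren_subst_rel.
by f_equal; fext; rewrite ?ren_id_ty //= /shift_tm ren_ren_tm.
Qed.

Lemma subst_subst_prop_rel :
  (forall p gt g gr ft f fr,
     subst_prop gt g gr (subst_prop ft f fr p)
       = subst_prop (fun i => subst_ty gt (ft i)) (fun i => subst_tm gt g (f i))
           (fun i => subst_rel gt g gr (fr i)) p) /\
  (forall R gt g gr ft f fr,
     subst_rel gt g gr (subst_rel ft f fr R)
       = subst_rel (fun i => subst_ty gt (ft i)) (fun i => subst_tm gt g (f i))
           (fun i => subst_rel gt g gr (fr i)) R).
Proof.
apply: prop_rel_mutind => //=; intros;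
  rewrite ?subst_subst_ty ?subst_subst_tm ?H ?H0 ?subst_up_tm ?subst_up_ty ?subst_up_rel //;
  do 2?f_equal; fext;
  by rewrite ?subst_tshift_tm ?subst_tshift_rel ?subst_shift_rel ?subst_shift2_rel.
Qed.

Definition subst_subst_prop p := subst_subst_prop_rel.1 p.
Definition subst_subst_rel R := subst_subst_prop_rel.2 R.

Lemma up_rel_var : up_rel rVar = rVar.
Proof. by fext; case: i. Qed.

Lemma subst_id_prop_rel :
  (forall p, subst_prop tyVar tmVar rVar p = p) /\
  (forall R, subst_rel tyVar tmVar rVar R = R).
Proof.
apply: prop_rel_mutind => //=; intros;
  by rewrite ?subst_id_ty ?subst_id_tm ?up_tm_var ?up_ty_var ?up_rel_var ?up_tm_var ?H ?H0.
Qed.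

Definition subst_id_rel R := subst_id_prop_rel.2 R.

Lemma ren_as_subst_rel R rt r rr :
  ren_rel rt r rr R
    = subst_rel (fun i => tyVar (rt i)) (fun i => tmVar (r i)) (fun i => rVar (rr i)) R.
Proof. by rewrite -[in LHS](subst_id_rel R) ren_subst_rel. Qed.

(** * Well-formed and closed types under renaming and substitution *)

Lemma wf_ren_ty n m rt s :
  wf_ty n s -> (forall i, i < n -> rt i < m) -> wf_ty m (ren_ty rt s).
Proof.
elim: s n m rt => //= [i|a IHa b IHb|a IHa b IHb|a IHa] n m rt.
- by move=> ? /(_ _); apply.
- by case/andP=> /IHa H1 /IHb H2 h; rewrite H1 // H2.
- by case/andP=> /IHa H1 /IHb H2 h; rewrite H1 // H2.
- by move=> /IHa H h; apply: H; case=> //= i /h.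
Qed.

Lemma wf_subst_ty n m f s :
  wf_ty n s -> (forall i, i < n -> wf_ty m (f i)) -> wf_ty m (subst_ty f s).
Proof.
elim: s n m f => //= [i|a IHa b IHb|a IHa b IHb|a IHa] n m f.
- by move=> ? /(_ _); apply.
- by case/andP=> /IHa H1 /IHb H2 h; rewrite H1 // H2.
- by case/andP=> /IHa H1 /IHb H2 h; rewrite H1 // H2.
- by move=> /IHa H h; apply: H; case=> //= i /h /wf_ren_ty; apply.
Qed.

Lemma eq_subst_ty n f g s :
  wf_ty n s -> (forall i, i < n -> f i = g i) -> subst_ty f s = subst_ty g s.
Proof.
elim: s n f g => //= [i|a IHa b IHb|a IHa b IHb|a IHa|a IHa] n f g.
- by move=> ? /(_ _); apply.
- by case/andP=> h1 h2 h; rewrite (IHa _ _ _ h1 h) (IHb _ _ _ h2 h).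
- by case/andP=> h1 h2 h; rewrite (IHa _ _ _ h1 h) (IHb _ _ _ h2 h).
- by move=> h1 h; rewrite (IHa _ _ _ h1 h).
- by move=> h1 h; rewrite (IHa _ _ (up_ty g) h1) //; case=> //= i /h ->.
Qed.

Lemma subst_closed_ty f s : closed_ty s -> subst_ty f s = s.
Proof. by move=> h; rewrite (eq_subst_ty (g := tyVar) h) ?subst_id_ty. Qed.

Lemma ren_closed_ty r s : closed_ty s -> ren_ty r s = s.
Proof. by rewrite ren_as_subst_ty; apply: subst_closed_ty. Qed.

Lemma wf_ty_le n m s : wf_ty n s -> n <= m -> wf_ty m s.
Proof.
by move=> h hm; rewrite -(ren_id_ty s); apply: wf_ren_ty h _ => i hi; apply: leq_trans hm.
Qed.

Lemma wf_shift_ty n s : wf_ty n s -> wf_ty n.+1 (ren_ty S s).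
Proof. by move=> h; apply: wf_ren_ty h _. Qed.

Lemma subst_inst_ty f r s :
  subst_ty f (inst_ty r s) = inst_ty (subst_ty f r) (subst_ty (up_ty f) s).
Proof.
rewrite /inst_ty !subst_subst_ty; f_equal; fext; case: i => //= i.
by rewrite subst_ren_ty /= subst_id_ty.
Qed.

Lemma ren_inst_ty f r s :
  ren_ty f (inst_ty r s) = inst_ty (ren_ty f r) (ren_ty (upren f) s).
Proof.
rewrite !ren_as_subst_ty subst_inst_ty; congr (inst_ty _ (subst_ty _ _)).
by fext; case: i.
Qed.

(** * Typing *)

Lemma lin_free_cons e G : lin_free (e :: G) = ~~ is_lin e && lin_free G.
Proof. by rewrite /lin_free /= addn_eq0 eqb0. Qed.

Lemma lin_free_map g G : lin_free (map (map_entry g) G) = lin_free G.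
Proof. by rewrite /lin_free count_map; congr (_ == _); apply: eq_count; case. Qed.

Lemma count_lin_map g G : count is_lin (map (map_entry g) G) = count is_lin G.
Proof. by rewrite count_map; apply: eq_count; case. Qed.

Lemma lin_free_Int Gam : lin_free (map Int Gam).
Proof. by elim: Gam. Qed.

(** Nothing has to be divided when no entry is linear, so both halves can be the whole context. In
    the purely intuitionistic contexts of the logic this removes all splitting conditions from
    application. *)
Lemma csplit_free G : lin_free G -> csplit G G G.
Proof.
elim: G => [|[]s G IH]; rewrite ?lin_free_cons //=; try constructor; exact: IH.
Qed.

(* [weak rt r G G']: G' is G with its types renamed by rt and non-linear entries
   inserted, and r maps the positions of G to those of G'. *)
Inductive weak (rt : nat -> nat) : (nat -> nat) -> seq entry -> seq entry -> Prop :=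
| weak_nil r G' : lin_free G' -> weak rt r [::] G'
| weak_keep r e G G' :
    weak rt r G G' -> weak rt (upren r) (e :: G) (map_entry (ren_ty rt) e :: G')
| weak_skip r e G G' :
    ~~ is_lin e -> weak rt r G G' -> weak rt (fun i => (r i).+1) G (e :: G').

Lemma weak_onth rt r G G' i e :
  weak rt r G G' -> onth G i = Some e ->
  onth G' (r i) = Some (map_entry (ren_ty rt) e).
Proof.
move=> w; elim: w i => {r G G'} [r G' _|r e' G G' _ IH|r e' G G' _ _ IH] i.
- by case: i.
- by case: i => /= [[->]|i /IH].
- exact: IH.
Qed.

Lemma weak_count rt r G G' : weak rt r G G' -> count is_lin G' = count is_lin G.
Proof.
elim=> {r G G'} [r G' /eqP|r e G G' _|r e G G' /negbTE he _] //= ->.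
- by case: e.
- by rewrite he.
Qed.

Lemma weak_free rt r G G' : weak rt r G G' -> lin_free G -> lin_free G'.
Proof. by rewrite /lin_free => /weak_count ->. Qed.

(** A kept entry goes to the same side as before, and an inserted non-linear entry is copied to both
    sides. In the base case the target has no linear entry and splits into two copies of itself. *)
Lemma weak_csplit rt r G G' G1 G2 :
  weak rt r G G' -> csplit G G1 G2 ->
  exists G1' G2', [/\ csplit G' G1' G2', weak rt r G1 G1' & weak rt r G2 G2'].
Proof.
move=> w; elim: w G1 G2 => {r G G'} [r G' h|r e G G' _ IH|r e G G' he _ IH] G1 G2 sp.
- inversion sp; subst; exists G', G'.
  by split; [apply: csplit_free| constructor| constructor].
- inversion sp as [|s ? ? ? sp'|s ? ? ? sp'|s ? ? ? sp'|s ? ? ? sp']; subst;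
  case/IH: sp' => G1' [G2' [h1 h2 h3]].
  + by exists (Int (ren_ty rt s) :: G1'), (Int (ren_ty rt s) :: G2');
    split; [constructor|apply: (weak_keep (Int s))|apply: (weak_keep (Int s))].
  + by exists (Lin (ren_ty rt s) :: G1'), (Used (ren_ty rt s) :: G2');
    split; [constructor|apply: (weak_keep (Lin s))|apply: (weak_keep (Used s))].
  + by exists (Used (ren_ty rt s) :: G1'), (Lin (ren_ty rt s) :: G2');
    split; [constructor|apply: (weak_keep (Used s))|apply: (weak_keep (Lin s))].
  + by exists (Used (ren_ty rt s) :: G1'), (Used (ren_ty rt s) :: G2');
    split; [constructor|apply: (weak_keep (Used s))|apply: (weak_keep (Used s))].
- case/IH: sp => G1' [G2' [h1 h2 h3]].
  exists (e :: G1'), (e :: G2'); split; try exact: weak_skip.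
  by case: e he => //= s _; constructor.
Qed.

Lemma weak_tshift rt r G G' :
  weak rt r G G' ->
  weak (upren rt) r (map (map_entry (ren_ty S)) G) (map (map_entry (ren_ty S)) G').
Proof.
elim=> {r G G'} [r G' h|r e G G' _ IH|r e G G' he _ IH] /=.
- by constructor; rewrite lin_free_map.
- suff -> : map_entry (ren_ty S) (map_entry (ren_ty rt) e) =
            map_entry (ren_ty (upren rt)) (map_entry (ren_ty S) e) by constructor.
  by case: e => s /=; rewrite !ren_ren_ty.
- by constructor => //; case: e he.
Qed.

(** The splitting rules are served by [weak_csplit], type abstraction by [weak_tshift]. Renaming
    types and terms together makes weakening by type variables and by term variables instances of
    one statement. *)
Lemma typing_ren n G t s m rt r G' :
  typing n G t s -> (forall i, i < n -> rt i < m) -> weak rt r G G' ->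
  typing m G' (ren_tm rt r t) (ren_ty rt s).
Proof.
move=> h; elim: h m rt r G' => {n G t s} /=.
- move=> n G i s hi hG m rt r G' _ w; apply: ty_int; last exact: weak_free w hG.
  exact: weak_onth w hi.
- move=> n G i s hi hG m rt r G' _ w; apply: ty_lin; last by rewrite (weak_count w).
  exact: weak_onth w hi.
- by move=> n G hG m rt r G' _ w; apply: ty_star; apply: weak_free w hG.
- by move=> n G hG m rt r G' _ w; apply: ty_Y; apply: weak_free w hG.
- move=> n G s t r0 hs _ IH m rt r G' h w; apply: ty_lam; first exact: wf_ren_ty h.
  by apply: IH => //; apply: (weak_keep (Lin s)).
- move=> n G G1 G2 t u s r0 sp _ IH1 _ IH2 m rt r G' h w.
  case: (weak_csplit w sp) => G1' [G2' [sp' w1 w2]].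
  by apply: ty_app sp' _ _; [apply: IH1|apply: IH2].
- move=> n G G1 G2 t u s r0 sp _ IH1 _ IH2 m rt r G' h w.
  case: (weak_csplit w sp) => G1' [G2' [sp' w1 w2]].
  by apply: ty_tensor sp' _ _; [apply: IH1|apply: IH2].
- by move=> n G t s hG _ IH m rt r G' h w; apply: ty_bang; [apply: weak_free w hG|apply: IH].
- move=> n G t s _ IH m rt r G' h w; apply: ty_tlam; apply: IH; last exact: weak_tshift.
  by case=> //= i; apply: h.
- move=> n G t s r0 _ IH hr m rt r G' h w; rewrite ren_inst_ty; apply: ty_tapp.
    exact: IH.
  exact: wf_ren_ty h.
- move=> n G G1 G2 s t a b r0 sp _ IH1 _ IH2 m rt r G' h w.
  case: (weak_csplit w sp) => G1' [G2' [sp' w1 w2]].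
  apply: ty_letT sp' _ _; first exact: IH1.
  by apply: IH2 => //; apply: (weak_keep (Lin b)); apply: (weak_keep (Lin a)).
- move=> n G G1 G2 s t a r0 sp _ IH1 _ IH2 m rt r G' h w.
  case: (weak_csplit w sp) => G1' [G2' [sp' w1 w2]].
  apply: ty_letB sp' _ _; first exact: IH1.
  by apply: IH2 => //; apply: (weak_keep (Int a)).
- move=> n G G1 G2 s t r0 sp _ IH1 _ IH2 m rt r G' h w.
  case: (weak_csplit w sp) => G1' [G2' [sp' w1 w2]].
  by apply: ty_letS sp' _ _; [apply: IH1|apply: IH2].
Qed.

Lemma weak_keep_id r e G G' : weak id r G G' -> weak id (upren r) (e :: G) (e :: G').
Proof.
have {2}-> : e = map_entry (ren_ty id) e by case: e => s /=; rewrite ren_id_ty.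
exact: weak_keep.
Qed.

Lemma weak_id G : weak id id G G.
Proof.
elim: G => [|e G IH]; first by constructor.
by rewrite -[X in weak _ X]upren_id; apply: weak_keep_id.
Qed.

Lemma weak_tshift1 G : weak S id G (map (map_entry (ren_ty S)) G).
Proof.
elim: G => [|e G IH] /=; first by constructor.
by rewrite -[X in weak _ X]upren_id; apply: weak_keep.
Qed.

Lemma typing_ren_id n G t s r G' :
  typing n G t s -> weak id r G G' -> typing n G' (ren_tm id r t) s.
Proof. by move=> h w; rewrite -(ren_id_ty s); apply: typing_ren h _ w. Qed.

Lemma typing_shift1 n e G t s :
  ~~ is_lin e -> typing n G t s -> typing n (e :: G) (shift_tm 1 t) s.
Proof.
move=> he h; apply: typing_ren_id h _.
by apply: (weak_skip he); apply: weak_id.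
Qed.

Lemma typing_shift2 n e e' G t s :
  ~~ is_lin e -> ~~ is_lin e' -> typing n G t s ->
  typing n (e :: e' :: G) (shift_tm 2 t) s.
Proof.
move=> he he' h; apply: typing_ren_id h _.
by apply: (weak_skip he); apply: (weak_skip he'); apply: weak_id.
Qed.

Lemma typing_shift3 n e e' e'' G t s :
  ~~ is_lin e -> ~~ is_lin e' -> ~~ is_lin e'' -> typing n G t s ->
  typing n (e :: e' :: e'' :: G) (shift_tm 3 t) s.
Proof.
move=> he he' he'' h; apply: typing_ren_id h _.
by apply: (weak_skip he); apply: (weak_skip he'); apply: (weak_skip he''); apply: weak_id.
Qed.

Lemma typing_tshift1 n G t s :
  typing n G t s ->
  typing n.+1 (map (map_entry (ren_ty S)) G) (tshift_tm 1 t) (ren_ty S s).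
Proof.
by move=> h; apply: typing_ren h _ _; [move=> i; rewrite ltnS | apply: weak_tshift1].
Qed.

(** A typing bounds the free indices of a term by the two context lengths, so a substitution that is
    the identity below these bounds changes nothing. This makes [fold] and [in_] invariant under
    every substitution without unfolding them. *)
Lemma subst_typed n G t s ft f :
  typing n G t s -> (forall i, i < n -> ft i = tyVar i) ->
  (forall i, i < size G -> f i = tmVar i) -> subst_tm ft f t = t.
Proof.
have wfE k g a : wf_ty k a -> (forall i, i < k -> g i = tyVar i) -> subst_ty g a = a.
  by move=> wa hg; rewrite (eq_subst_ty (g := tyVar) wa hg) subst_id_ty.
(* Spent linear variables keep their place as [Used], so a split preserves length. *)
have szE H H1 H2 : csplit H H1 H2 -> (size H1 = size H) * (size H2 = size H).
  by elim => //= ? ? ? ? _ [-> ->].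
have upE H g : (forall i, i < H -> g i = tmVar i) -> forall i, i < H.+1 -> up_tm g i = tmVar i.
  by move=> h [|i] //= /h ->.
have onE (T : Type) (H : seq T) i e : onth H i = Some e -> i < size H.
  by elim: H i => [|x H IH] [|i] //= /IH.
move=> h; elim: h ft f => {n G t s} //=.
- by move=> n G i s hi _ ft f _; apply; apply: onE hi.
- by move=> n G i s hi _ ft f _; apply; apply: onE hi.
- by move=> n G s t r hs _ IH ft f hft hf; rewrite (wfE n) // IH //; apply: upE.
- by move=> n G G1 G2 t u s r /szE hsz _ IH1 _ IH2 ft f hft hf;
    rewrite IH1 ?IH2 //; rewrite !hsz.
- by move=> n G G1 G2 t u s r /szE hsz _ IH1 _ IH2 ft f hft hf;
    rewrite IH1 ?IH2 //; rewrite !hsz.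
- by move=> n G t s _ _ IH ft f hft hf; rewrite IH.
- move=> n G t s _ IH ft f hft hf; rewrite IH //; first by case=> //= i /hft ->.
  by move=> i; rewrite size_map => /hf ->.
- by move=> n G t s r _ IH hr ft f hft hf; rewrite IH // (wfE n).
- move=> n G G1 G2 s t a b r /szE hsz _ IH1 _ IH2 ft f hft hf.
  by rewrite IH1 ?IH2 //= !hsz //; move: (upE _ _ (upE _ _ hf)).
- move=> n G G1 G2 s t a r /szE hsz _ IH1 _ IH2 ft f hft hf.
  by rewrite IH1 ?IH2 //= !hsz //; apply: upE.
- by move=> n G G1 G2 s t r /szE hsz _ IH1 _ IH2 ft f hft hf;
    rewrite IH1 ?IH2 //; rewrite !hsz.
Qed.

Lemma subst_closed_tm t s ft f : typing 0 [::] t s -> subst_tm ft f t = t.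
Proof. by move=> h; apply: subst_typed h _ _. Qed.

Lemma ren_closed_tm t s rt r : typing 0 [::] t s -> ren_tm rt r t = t.
Proof. by rewrite ren_as_subst_tm; apply: subst_closed_tm. Qed.

Lemma typing_closed n G t s :
  closed_ty s -> typing 0 [::] t s -> lin_free G -> typing n G t s.
Proof.
move=> hs h hG; rewrite -(ren_closed_ty id hs) -(ren_closed_tm id id h).
by apply: typing_ren h _ _ => //; constructor.
Qed.

Lemma free_app n G t u s r :
  lin_free G -> typing n G t (s --o r) -> typing n G u s -> typing n G (tmApp t u) r.
Proof. by move=> hG; apply: ty_app; apply: csplit_free. Qed.

(** The half of a split that receives no linear variable; the other half is then the context itself
    ([csplit_unlin]). *)
Definition unlin (e : entry) : entry := if e is Lin s then Used s else e.

Lemma csplit_unlin G : csplit G (map unlin G) G.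
Proof. by elim: G => [|[]s G IH] /=; constructor. Qed.

Lemma lin_free_unlin G : count is_lin (map unlin G) = 0.
Proof. by elim: G => [|[]s G IH]. Qed.

Lemma typing_lamI n G s t r :
  wf_ty n s -> typing n (Int s :: G) t r -> typing n G (tmLamI s t) (tyArr s r).
Proof.
move=> hs ht; apply: ty_lam => //; apply: ty_letB.
- by apply: cs_left; apply: csplit_unlin.
- by apply: ty_lin => //=; rewrite lin_free_unlin.
- apply: typing_ren_id ht _; apply: weak_keep_id.
  by apply: (@weak_skip _ id) => //; apply: weak_id.
Qed.

Lemma inst_shift_tm u t : inst_tm u (shift_tm 1 t) = t.
Proof. by rewrite /inst_tm /shift_tm subst_ren_tm subst_id_tm. Qed.

(** Two β-steps: the linear one puts [tmBang u] for the hidden variable [y], and the one for [!]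
    then substitutes [u]. *)
Lemma eqt_beta_lamI n G s t r u :
  lin_free G -> wf_ty n s -> typing n (Int s :: G) t r -> typing n G u s ->
  eqt n G (tmApp (tmLamI s t) (tmBang u)) (inst_tm u t) r.
Proof.
move=> hG hs ht hu.
have hbu : typing n G (tmBang u) (tyBang s) by apply: ty_bang.
apply: eqt_trans.
  by apply: eqt_beta_lam; apply: free_app (hbu) => //; apply: typing_lamI ht.
rewrite /inst_tm /= subst_ren_tm.
(* [t] was renamed to make room for [y]; substituting for [y] undoes that renaming. *)
set t' := subst_tm _ _ t.
have -> : t' = t.
  by rewrite /t' -[RHS]subst_id_tm; f_equal; fext; case: i => //= i.
by apply: eqt_beta_bang; apply: ty_letB (csplit_free hG) hbu ht.
Qed.

Lemma free_eqt_app n G t t' u u' s r :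
  lin_free G -> eqt n G t t' (s --o r) -> eqt n G u u' s ->
  eqt n G (tmApp t u) (tmApp t' u') r.
Proof. by move=> hG; apply: eqt_app; apply: csplit_free. Qed.

Lemma free_eqt_appl n G t t' u s r :
  lin_free G -> eqt n G t t' (s --o r) -> typing n G u s ->
  eqt n G (tmApp t u) (tmApp t' u) r.
Proof. by move=> hG ht hu; apply: free_eqt_app ht _ => //; apply: eqt_refl. Qed.

Lemma typing_id n G s : lin_free G -> wf_ty n s -> typing n G (tmId s) (s --o s).
Proof.
by move=> hG hs; apply: ty_lam => //; apply: ty_lin => //=; rewrite (eqP hG).
Qed.

Lemma subst_id_fun ft f s : subst_tm ft f (tmId s) = tmId (subst_ty ft s).
Proof. by []. Qed.

(** * The functorial action *)

Lemma put_closed k t s : closed_ty s -> put_ty k t s = s.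
Proof. exact: subst_closed_ty. Qed.

Lemma put_pi k t a : put_ty k t (tyPi a) = tyPi (put_ty k.+1 (ren_ty S t) a).
Proof.
rewrite /put_ty /=; congr (tyPi (subst_ty _ _)); fext; case: i => //= i.
(* For [i] above [k] the truncated predecessor commutes with the successor, since then [i] is not
   0. *)
rewrite ltnS eqSS; case: ltnP => //=; case: eqP => //= h1 h2.
by case: i h1 h2 => // h1 h2; rewrite leqn0 in h2; case: h1; rewrite (eqP h2).
Qed.

Lemma put_var k t : put_ty k t (tyVar k) = t.
Proof. by rewrite /put_ty /= ltnn eqxx. Qed.

Lemma put0 t s : put_ty 0 t s = inst_ty t s.
Proof. by rewrite /put_ty /inst_ty; f_equal; fext; case: i. Qed.

Lemma wf_put n k t s : wf_ty k.+1 s -> k <= n -> wf_ty n t -> wf_ty n (put_ty k t s).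
Proof.
move=> hs hk ht; apply: wf_subst_ty hs _ => i; rewrite ltnS leq_eqVlt => /orP [/eqP ->|hi].
  by rewrite ltnn eqxx.
by rewrite hi /=; apply: leq_trans hk.
Qed.

Lemma subst_put ft k t s :
  wf_ty k.+1 s -> (forall i, i < k -> ft i = tyVar i) ->
  subst_ty ft (put_ty k t s) = put_ty k (subst_ty ft t) s.
Proof.
move=> hs hft; rewrite /put_ty subst_subst_ty; apply: eq_subst_ty hs _ => i.
rewrite ltnS leq_eqVlt => /orP [/eqP ->|hi]; first by rewrite ltnn eqxx.
by rewrite hi /= hft.
Qed.

(** [f] is copied to every occurrence of the variable, possibly none and possibly under [!], hence
    the context without linear entries. The index, polarity and context are general because Π raises
    [k] and moves [f] under a type variable, and the argument of a linear arrow flips [p]. *)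
Lemma act_typing n G k p t t' f s :
  occurs_only p k s -> wf_ty k.+1 s -> k <= n -> wf_ty n t -> wf_ty n t' ->
  lin_free G -> typing n G f (t --o t') ->
  typing n G (act p k t t' f s)
    (put_ty k (if p then t else t') s --o put_ty k (if p then t' else t) s).
Proof.
have selwf q m (u u' : ty) : wf_ty m u -> wf_ty m u' -> wf_ty m (if q then u else u').
  by case: q.
elim: s p k n G t t' f => [i||a IHa b IHb|a IHa b IHb|a IHa|a IHa]
  p k n G t t' f occ ws hk wt wt' hG hf.
- move: occ ws => /=; case: eqP => [-> /= -> _|ne _].
    by rewrite !put_var.
  rewrite ltnS leq_eqVlt => /orP [/eqP //|hi].
  rewrite /put_ty /= hi; apply: typing_id => //=; exact: leq_trans hk.
- exact: typing_id.
- rewrite [act _ _ _ _ _ _]/=; case: ifP => [cl|_].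
    rewrite !put_closed //; apply: typing_id => //; exact: wf_ty_le cl _.
  case/andP: (occ) => oa ob; case/andP: (ws) => wa wb.
  have IA := IHa _ _ _ _ _ _ _ oa wa hk wt wt' hG hf.
  have IB := IHb _ _ _ _ _ _ _ ob wb hk wt wt' hG hf.
  apply: ty_lam; first by apply: wf_put => //; apply: selwf.
  apply: ty_letT; first by apply: cs_left; apply: csplit_free.
    by apply: ty_lin => //=; rewrite (eqP hG).
  apply: ty_tensor; first by apply: cs_right; apply: cs_left; apply: cs_used; apply: csplit_free.
    apply: ty_app; first by apply: cs_used; apply: cs_right; apply: cs_used; apply: csplit_free.
      by apply: typing_shift3 IA.
    by apply: ty_lin => //=; rewrite (eqP hG).
  apply: ty_app; first by apply: cs_right; apply: cs_used; apply: cs_used; apply: csplit_free.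
    by apply: typing_shift3 IB.
  by apply: ty_lin => //=; rewrite (eqP hG).
- rewrite [act _ _ _ _ _ _]/=; case: ifP => [cl|_].
    rewrite !put_closed //; apply: typing_id => //; exact: wf_ty_le cl _.
  case/andP: (occ) => oa ob; case/andP: (ws) => wa wb.
  have IA := IHa _ _ _ _ _ _ _ oa wa hk wt wt' hG hf.
  have IB := IHb _ _ _ _ _ _ _ ob wb hk wt wt' hG hf.
  (* With the polarity flipped, the action on [a] runs from the target instance back to the source
     one. *)
  have {}IA : typing n G (act (~~ p) k t t' f a)
      (put_ty k (if p then t' else t) a --o put_ty k (if p then t else t') a).
    by case: (p) IA.
  apply: ty_lam; first by apply: wf_put => //; apply: selwf.
  apply: ty_lam; first by apply: wf_put => //; apply: selwf.
  apply: ty_app; first by apply: cs_right; apply: cs_right; apply: csplit_free.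
    by do 2 (apply: typing_shift1 => //); apply: IB.
  apply: ty_app; first by apply: cs_right; apply: cs_left; apply: csplit_free.
    (* Written out, the inner composite binds index 0 and the outer one index 1, so the function
       being transported is index 2. *)
    have -> : shift_tm 1 (tmComp (put_ty k (if p then t' else t) a) (tmVar 0)
        (shift_tm 1 (act (~~ p) k t t' f a))) =
      tmLam (put_ty k (if p then t' else t) a)
        (tmApp (tmVar 2) (tmApp (shift_tm 3 (act (~~ p) k t t' f a)) (tmVar 0))).
      by rewrite /tmComp /shift_tm /= ren_id_ty !ren_ren_tm.
    apply: ty_lam; first by apply: wf_put => //; apply: selwf.
    apply: ty_app; first by apply: cs_right; apply: cs_used; apply: cs_left; apply: csplit_free.
      by apply: ty_lin => //=; rewrite (eqP hG).
    apply: ty_app; first by apply: cs_right; apply: cs_used; apply: cs_used; apply: csplit_free.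
      by apply: typing_shift3 IA.
    by apply: ty_lin => //=; rewrite (eqP hG).
  by apply: ty_lin => //=; rewrite (eqP hG).
- rewrite [act _ _ _ _ _ _]/=; case: ifP => [cl|_].
    rewrite !put_closed //; apply: typing_id => //; exact: wf_ty_le cl _.
  have IA := IHa _ _ _ _ _ _ _ occ ws hk wt wt' hG hf.
  apply: ty_lam; first by apply: wf_put => //; apply: selwf.
  apply: ty_letB; first by apply: cs_left; apply: csplit_free.
    by apply: ty_lin => //=; rewrite (eqP hG).
  apply: ty_bang => //; apply: free_app => //.
    by apply: typing_shift2 IA.
  by apply: ty_int.
- rewrite [act _ _ _ _ _ _]/=; case: ifP => [cl|_].
    rewrite !put_closed //; apply: typing_id => //; exact: wf_ty_le cl _.
  have IA := IHa p k.+1 n.+1 (map (map_entry (ren_ty S)) G) (ren_ty S t) (ren_ty S t')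
    (tshift_tm 1 f) occ ws hk (wf_shift_ty wt) (wf_shift_ty wt').
  rewrite lin_free_map in IA; have {}IA := IA hG (typing_tshift1 hf).
  apply: ty_lam; first by apply: wf_put => //; apply: selwf.
  rewrite !put_pi; apply: ty_tlam => /=.
  have ifS (q : bool) u u' : ren_ty S (if q then u else u') = if q then ren_ty S u else ren_ty S u'.
    by case: q.
  rewrite -!ifS in IA.
  apply: ty_app; first by apply: cs_right; apply: csplit_free; rewrite lin_free_map.
    by apply: typing_shift1 IA.
  (* The type application rule yields an instance of a Π-body; a weakened body instantiated at the
     fresh variable is the original body. *)
  set c := put_ty _ _ _; have {2}-> : c = inst_ty (tyVar 0) (ren_ty (upren S) c).
    by rewrite /inst_ty subst_ren_ty -[LHS]subst_id_ty; f_equal; fext; case: i.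
  apply: ty_tapp => //; apply: ty_lin => //=.
  by rewrite count_lin_map (eqP hG).
Qed.

Arguments put_ty : simpl never.
Arguments tmComp : simpl never.

Lemma subst_shift1_tm ft fm t :
  subst_tm ft (up_tm fm) (shift_tm 1 t) = shift_tm 1 (subst_tm ft fm t).
Proof.
rewrite /shift_tm subst_ren_tm ren_subst_tm.
by f_equal; fext; rewrite ?ren_id_ty.
Qed.

Lemma subst_lam ft fm s t :
  subst_tm ft fm (tmLam s t) = tmLam (subst_ty ft s) (subst_tm ft (up_tm fm) t).
Proof. by []. Qed.

Lemma subst_comp ft fm s g f :
  subst_tm ft fm (tmComp s g f)
    = tmComp (subst_ty ft s) (subst_tm ft fm g) (subst_tm ft fm f).
Proof. by rewrite /tmComp /= !subst_shift1_tm. Qed.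

(** The free variables of [s] are the binders already crossed, numbered below [k], and the
    distinguished [k]. The former are fixed by [ft], the latter is replaced by [t] or [t'], so the
    substitution reaches only the three parameters. *)
Lemma act_subst ft fm k p t t' f s :
  wf_ty k.+1 s -> (forall i, i < k -> ft i = tyVar i) ->
  subst_tm ft fm (act p k t t' f s)
    = act p k (subst_ty ft t) (subst_ty ft t') (subst_tm ft fm f) s.
Proof.
have sif' (q : bool) g k' u u' a :
    put_ty k' (if q then subst_ty g u else subst_ty g u') a
      = put_ty k' (subst_ty g (if q then u else u')) a by case: q.
have shE j m u g gm : (forall i, gm (j + i) = shift_tm j (m i)) ->
  subst_tm g gm (shift_tm j u) = shift_tm j (subst_tm g m u).
  move=> hm; rewrite /shift_tm subst_ren_tm ren_subst_tm.
  by f_equal; fext; rewrite ?ren_id_ty.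
have sh2 g m u : subst_tm g (up_tm (up_tm m)) (shift_tm 2 u) = shift_tm 2 (subst_tm g m u).
  by apply: shE => i; rewrite /= /shift_tm !ren_ren_tm.
have sh3 g m u : subst_tm g (up_tm (up_tm (up_tm m))) (shift_tm 3 u) = shift_tm 3 (subst_tm g m u).
  by apply: shE => i; rewrite /= /shift_tm !ren_ren_tm.
elim: s p k ft fm t t' f => [i||a IHa b IHb|a IHa b IHb|a IHa|a IHa]
  p k ft fm t t' f ws hft //.
- move: ws => /=; case: eqP => // ne.
  rewrite ltnS leq_eqVlt => /orP [/eqP //|hi].
  by rewrite /put_ty /= hi /= hft.
- have wp := ws; case/andP: ws => wa wb /=; case: ifP => [cl|_].
    by rewrite subst_id_fun subst_closed_ty.
  rewrite /= !sh3 (IHa _ _ _ _ _ _ _ wa) // (IHb _ _ _ _ _ _ _ wb) //.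
  by rewrite !sif' -!subst_put.
- have wp := ws; case/andP: ws => wa wb /=; case: ifP => [cl|_].
    by rewrite subst_id_fun subst_closed_ty.
  rewrite subst_lam !subst_comp [subst_tm _ _ (tmVar 0)]/= !subst_shift1_tm (IHa _ _ _ _ _ _ _ wa) // (IHb _ _ _ _ _ _ _ wb) //.
  by rewrite !sif' -!subst_put //.
- have wp := ws => /=; case: ifP => [cl|_].
    by rewrite subst_id_fun subst_closed_ty.
  rewrite /= !sh2 (IHa _ _ _ _ _ _ _ ws) //.
  by rewrite !sif' -!subst_put.
- have wp := ws => /=; case: ifP => [cl|_].
    by rewrite subst_id_fun subst_closed_ty.
  rewrite /= !sif' -!subst_put //; do 4 f_equal.
  (* Lifting a substitution past a term binder commutes with lifting it past a type binder. *)
  have -> : (fun i => tshift_tm 1 (up_tm fm i)) = up_tm (fun i => tshift_tm 1 (fm i)).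
    by fext; case: i => //= i; rewrite /tshift_tm /shift_tm !ren_ren_tm.
  rewrite subst_shift1_tm (IHa _ _ _ _ _ _ _ ws); last by case=> //= i /hft ->.
  rewrite subst_tshift_tm; congr (shift_tm 1 (act _ _ _ _ _ _)).
    by rewrite subst_ren_ty ren_subst_ty.
  by rewrite subst_ren_ty ren_subst_ty.
Qed.

Lemma act_ren rt r k p t t' f s :
  wf_ty k.+1 s -> (forall i, i < k -> rt i = i) ->
  ren_tm rt r (act p k t t' f s)
    = act p k (ren_ty rt t) (ren_ty rt t') (ren_tm rt r f) s.
Proof.
move=> ws h; rewrite !ren_as_subst_tm !ren_as_subst_ty act_subst //.
by move=> i /h ->.
Qed.

Lemma act_shift j k p t t' f s :
  wf_ty k.+1 s -> shift_tm j (act p k t t' f s) = act p k t t' (shift_tm j f) s.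
Proof. by move=> ws; rewrite /shift_tm act_ren // !ren_id_ty. Qed.

Lemma shift_id j t : shift_tm j (tmId t) = tmId t.
Proof. by rewrite /shift_tm /= ren_id_ty. Qed.

Lemma free_beta_id n G s t u :
  lin_free G -> wf_ty n s -> eqt n G t (tmId s) (s --o s) -> typing n G u s ->
  eqt n G (tmApp t u) u s.
Proof.
move=> hG hs ht hu; apply: eqt_trans; first exact: free_eqt_appl ht hu.
by apply: eqt_beta_lam; apply: free_app hu => //; apply: typing_id.
Qed.

(** The induction hypotheses turn the components into identities, β removes these, and the η-rule of
    the type constructor finishes each case. The equality is thus external, valid in every context
    without linear entries. *)
Lemma act_id n G k p t s :
  occurs_only p k s -> wf_ty k.+1 s -> k <= n -> wf_ty n t -> lin_free G ->
  eqt n G (act p k t t (tmId t) s) (tmId (put_ty k t s))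
    (put_ty k t s --o put_ty k t s).
Proof.
have ifE (T : Type) (q : bool) (u : T) : (if q then u else u) = u by case: q.
elim: s p k n G t => [i||a IHa b IHb|a IHa b IHb|a IHa|a IHa]
  p k n G t occ ws hk wt hG;
  have hw := wf_put ws hk wt; have hT := typing_id hG hw.
- move: occ ws; rewrite /=; case: eqP => [-> _ _|ne _ _].
    by rewrite put_var; apply: eqt_refl; apply: typing_id.
  by rewrite ifE; apply: eqt_refl.
- exact: eqt_refl.
all: rewrite [act _ _ _ _ _ _]/= ?ifE; case: ifP => [cl|_];
  first by rewrite !put_closed // in hT *; apply: eqt_refl.
- case/andP: (occ) => oa ob; case/andP: (ws) => wa wb.
  have pE : put_ty k t (tyTensor a b) = tyTensor (put_ty k t a) (put_ty k t b) by [].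
  have wpa := wf_put wa hk wt; have wpb := wf_put wb hk wt.
  apply: eqt_lam => //; rewrite pE.
  apply: eqt_trans; last first.
    apply: eqt_eta_tensor; apply: ty_lin => //=; by rewrite (eqP hG).
  apply: eqt_letT; first by apply: cs_left; apply: csplit_free.
    by apply: eqt_refl; apply: ty_lin => //=; rewrite (eqP hG).
  apply: eqt_tensor; first by apply: cs_right; apply: cs_left; apply: cs_used; apply: csplit_free.
    rewrite act_shift // shift_id.
    apply: eqt_trans.
      apply: eqt_app; first by apply: cs_used; apply: cs_right; apply: cs_used; apply: csplit_free.
        by apply: IHa.
      by apply: eqt_refl; apply: ty_lin => //=; rewrite (eqP hG).
    apply: eqt_beta_lam.
    apply: ty_app; first by apply: cs_used; apply: cs_right; apply: cs_used; apply: csplit_free.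
      by apply: typing_id.
    by apply: ty_lin => //=; rewrite (eqP hG).
  rewrite act_shift // shift_id.
  apply: eqt_trans.
    apply: eqt_app; first by apply: cs_right; apply: cs_used; apply: cs_used; apply: csplit_free.
      by apply: IHb.
    by apply: eqt_refl; apply: ty_lin => //=; rewrite (eqP hG).
  apply: eqt_beta_lam.
  apply: ty_app; first by apply: cs_right; apply: cs_used; apply: cs_used; apply: csplit_free.
    by apply: typing_id.
  by apply: ty_lin => //=; rewrite (eqP hG).
- case/andP: (occ) => oa ob; case/andP: (ws) => wa wb.
  have pE : put_ty k t (a --o b) = put_ty k t a --o put_ty k t b by [].
  have wpa := wf_put wa hk wt; have wpb := wf_put wb hk wt.
  set A := act _ _ _ _ _ a; set B := act _ _ _ _ _ b.
  (* [A] and [B] act on identities and contain no free term variable, so the shifts in the two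
     composites disappear. *)
  have -> : tmComp (put_ty k t a) (shift_tm 1 B) (tmComp (put_ty k t a) (tmVar 0) (shift_tm 1 A))
     = tmLam (put_ty k t a) (tmApp B
         (tmApp (tmLam (put_ty k t a) (tmApp (tmVar 2) (tmApp A (tmVar 0)))) (tmVar 0))).
    rewrite /tmComp /A /B !act_shift // !shift_id /shift_tm /= ren_id_ty.
    by rewrite !act_ren // ?ren_id_ty //= ?ren_id_ty.
  have hx e : ~~ is_lin e -> typing n (e :: Lin (put_ty k t (a --o b)) :: G)
      (tmVar 1) (put_ty k t a --o put_ty k t b).
    by move=> he; apply: ty_lin => //=; rewrite (negbTE he) (eqP hG).
  have hI G' : lin_free G' -> eqt n (Lin (put_ty k t a) :: G') (tmApp A (tmVar 0)) (tmVar 0) (put_ty k t a).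
    move=> hG'; apply: eqt_trans.
      apply: eqt_app; first by apply: cs_right; apply: csplit_free.
        by apply: IHa => //.
      by apply: eqt_refl; apply: ty_lin => //=; rewrite (eqP hG').
    apply: eqt_beta_lam; apply: ty_app; first by apply: cs_right; apply: csplit_free.
      by apply: typing_id.
    by apply: ty_lin => //=; rewrite (eqP hG').
  have hA G' : lin_free G' -> typing n G' A (put_ty k t a --o put_ty k t a).
    move=> hG'; have := act_typing oa wa hk wt wt hG' (typing_id hG' wt).
    by rewrite !ifE.
  apply: eqt_lam => //; rewrite pE; apply: eqt_trans; last first.
    by apply: eqt_eta_lam; apply: ty_lin => //=; rewrite (eqP hG).
  rewrite /shift_tm /= -pE; apply: eqt_lam => //.
  have hB G' : lin_free G' -> typing n G' B (put_ty k t b --o put_ty k t b).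
    move=> hG'; have := act_typing ob wb hk wt wt hG' (typing_id hG' wt).
    by rewrite !ifE.
  have sp : csplit [:: Lin (put_ty k t a), Lin (put_ty k t (a --o b)) & G]
      [:: Used (put_ty k t a), Used (put_ty k t (a --o b)) & G]
      [:: Lin (put_ty k t a), Lin (put_ty k t (a --o b)) & G].
    by do 2 apply: cs_right; apply: csplit_free.
  have sp' : csplit [:: Lin (put_ty k t a), Lin (put_ty k t (a --o b)) & G]
      [:: Used (put_ty k t a), Lin (put_ty k t (a --o b)) & G]
      [:: Lin (put_ty k t a), Used (put_ty k t (a --o b)) & G].
    by apply: cs_right; apply: cs_left; apply: csplit_free.
  have h0 : typing n [:: Lin (put_ty k t a), Used (put_ty k t (a --o b)) & G]
      (tmVar 0) (put_ty k t a) by apply: ty_lin => //=; rewrite (eqP hG).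
  have h10 := ty_app sp' (hx _ (isT : ~~ is_lin (Used (put_ty k t a)))) h0.
  (* After β of the inner composite the term is [B] applied to the function at [A x]; [A] is removed
     here by [hI], [B] afterwards by its induction hypothesis. *)
  apply: (eqt_trans (u := tmApp B (tmApp (tmVar 1) (tmVar 0)))).
    apply: eqt_app sp _ _; first by apply: eqt_refl; apply: hB.
    apply: eqt_trans.
      apply: eqt_beta_lam; apply: ty_app sp' _ h0.
      apply: ty_lam => //.
      apply: ty_app; first by apply: cs_right; apply: cs_used; apply: cs_left; apply: csplit_free.
        by apply: ty_lin => //=; rewrite (eqP hG).
      apply: ty_app; first by apply: cs_right; apply: cs_used; apply: cs_used; apply: csplit_free.
        exact: hA.
      by apply: ty_lin => //=; rewrite (eqP hG).
    rewrite /inst_tm /= /A act_subst // subst_id_ty subst_id_fun subst_id_ty -/A.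
    by apply: eqt_app sp' _ _; [apply: eqt_refl; apply: hx | apply: hI].
  apply: eqt_trans.
    apply: eqt_app sp _ (eqt_refl h10).
    by apply: IHb.
  by apply: eqt_beta_lam; apply: ty_app sp _ h10; apply: typing_id.
- have pE : put_ty k t (tyBang a) = tyBang (put_ty k t a) by [].
  have wpa := wf_put (s := a) ws hk wt.
  apply: eqt_lam => //; rewrite pE.
  apply: eqt_trans; last first.
    by apply: eqt_eta_bang; apply: ty_lin => //=; rewrite (eqP hG).
  apply: eqt_letB; first by apply: cs_left; apply: csplit_free.
    by apply: eqt_refl; apply: ty_lin => //=; rewrite (eqP hG).
  apply: eqt_bang => //; rewrite act_shift // shift_id.
  by apply: free_beta_id => //; [apply: IHa | apply: ty_int].
- rewrite put_pi in hw hT *; set c := put_ty k.+1 _ a in hw hT *.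
  apply: eqt_lam => //; apply: eqt_trans; last first.
    by apply: eqt_eta_tlam; apply: ty_lin => //=; rewrite (eqP hG).
  apply: eqt_tlam.
  have -> : tshift_tm 1 (tmId t) = tmId (ren_ty S t) by [].
  rewrite act_shift // shift_id /=.
  have hz : typing n.+1 (Lin (tyPi (ren_ty (upren S) c)) :: map (map_entry (ren_ty S)) G)
      (tmTApp (tmVar 0) (tyVar 0)) c.
    have {2}-> : c = inst_ty (tyVar 0) (ren_ty (upren S) c).
      by rewrite /inst_ty subst_ren_ty -[LHS]subst_id_ty; f_equal; fext; case: i.
    by apply: ty_tapp => //; apply: ty_lin => //=; rewrite count_lin_map (eqP hG).
  have sp : csplit (Lin (tyPi (ren_ty (upren S) c)) :: map (map_entry (ren_ty S)) G)
      (Used (tyPi (ren_ty (upren S) c)) :: map (map_entry (ren_ty S)) G)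
      (Lin (tyPi (ren_ty (upren S) c)) :: map (map_entry (ren_ty S)) G).
    by apply: cs_right; apply: csplit_free; rewrite lin_free_map.
  apply: eqt_trans.
    apply: eqt_app sp _ (eqt_refl hz); apply: IHa => //; first exact: wf_shift_ty.
    by rewrite lin_free_cons lin_free_map.
  apply: eqt_beta_lam; apply: ty_app sp _ hz; apply: typing_id => //.
  by rewrite lin_free_cons lin_free_map.
Qed.

(** * The initial algebra structure *)

Lemma subst_lamI ft fm s t :
  subst_tm ft fm (tmLamI s t) = tmLamI (subst_ty ft s) (subst_tm ft (up_tm fm) t).
Proof.
rewrite /tmLamI /= subst_ren_tm ren_subst_tm; do 2 f_equal.
f_equal; fext; first by rewrite ren_id_ty.
by case: i => //= i; rewrite /shift_tm !ren_ren_tm.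
Qed.

Lemma subst_fmap ft fm s t t' f :
  wf_ty 1 s ->
  subst_tm ft fm (fmap s t t' f)
    = fmap s (subst_ty ft t) (subst_ty ft t') (subst_tm ft fm f).
Proof. by move=> ws; apply: act_subst. Qed.

Lemma ren_fmap rt r s t t' f :
  wf_ty 1 s ->
  ren_tm rt r (fmap s t t' f) = fmap s (ren_ty rt t) (ren_ty rt t') (ren_tm rt r f).
Proof. by move=> ws; apply: act_ren. Qed.

Lemma tinst_tshift_tm r t : tinst_tm r (tshift_tm 1 t) = t.
Proof. by rewrite /tinst_tm /tshift_tm subst_ren_tm subst_id_tm. Qed.

(** Under a binder for its variable, [s] can thus be read both as itself and as the instance
    [tapp s (tyVar 0)], the form in which the typing lemmas are stated. *)
Lemma inst_var0_ty s : wf_ty 1 s -> inst_ty (tyVar 0) s = s.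
Proof.
move=> ws; rewrite /inst_ty -[RHS]subst_id_ty.
by apply: eq_subst_ty ws _; case.
Qed.

Lemma subst_tapp ft s t : wf_ty 1 s -> subst_ty ft (tapp s t) = tapp s (subst_ty ft t).
Proof. by move=> ws; rewrite /tapp -!put0; apply: subst_put. Qed.

Lemma ren_tapp r s t : wf_ty 1 s -> ren_ty r (tapp s t) = tapp s (ren_ty r t).
Proof. by move=> ws; rewrite !ren_as_subst_ty; apply: subst_tapp. Qed.

Lemma wf_tapp n s t : wf_ty 1 s -> wf_ty n t -> wf_ty n (tapp s t).
Proof. by move=> ws wt; rewrite /tapp -put0; apply: wf_put. Qed.

Section MuTypes.

Variables (s : ty) (ws : wf_ty 1 s).

Let wlolli n : 0 < n -> wf_ty n (s --o tyVar 0).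
Proof. by move=> hn; apply: (wf_ty_le (n := 1)) => //=; rewrite ws. Qed.

Lemma mu_closed : closed_ty (mu s).
Proof. by rewrite /closed_ty /= ws. Qed.

Lemma wf_mu n : wf_ty n (mu s).
Proof. exact: wf_ty_le mu_closed _. Qed.

Lemma subst_mu ft : subst_ty ft (mu s) = mu s.
Proof. exact: subst_closed_ty mu_closed. Qed.

Lemma ren_mu r : ren_ty r (mu s) = mu s.
Proof. exact: ren_closed_ty mu_closed. Qed.

Lemma typing_tapp_mu n G u t :
  typing n G u (mu s) -> wf_ty n t ->
  typing n G (tmTApp u t) (tyArr (tapp s t --o t) t).
Proof. exact: ty_tapp. Qed.

Lemma fold_typing : typing 0 [::] (fold s) (tyPi (tyArr (s --o tyVar 0) (mu s --o tyVar 0))).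
Proof.
apply: ty_tlam; apply: typing_lamI; first exact: wlolli.
apply: ty_lam; first exact: wf_mu.
have hu : typing 1 [:: Lin (mu s); Int (s --o tyVar 0)] (tmTApp (tmVar 0) (tyVar 0))
    (tyArr (s --o tyVar 0) (tyVar 0)).
  have {3}<- : tapp s (tyVar 0) = s by apply: inst_var0_ty.
  by apply: typing_tapp_mu => //; apply: ty_lin.
apply: ty_app hu _; first by apply: cs_left; apply: cs_int; apply: cs_nil.
by apply: ty_bang => //; apply: ty_int.
Qed.

Lemma subst_fold ft fm : subst_tm ft fm (fold s) = fold s.
Proof. exact: subst_closed_tm fold_typing. Qed.

Lemma subst_fold_at ft fm t f :
  subst_tm ft fm (fold_at s t f) = fold_at s (subst_ty ft t) (subst_tm ft fm f).
Proof. by rewrite /fold_at; cbn -[fold]; rewrite subst_fold. Qed.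

Lemma ren_fold_at rt r t f :
  ren_tm rt r (fold_at s t f) = fold_at s (ren_ty rt t) (ren_tm rt r f).
Proof. by rewrite !ren_as_subst_tm !ren_as_subst_ty subst_fold_at. Qed.

Lemma fold_tapp_typing n G t :
  lin_free G -> wf_ty n t ->
  typing n G (tmTApp (fold s) t) (tyArr (tapp s t --o t) (mu s --o t)).
Proof.
move=> hG wt.
have -> : tyArr (tapp s t --o t) (mu s --o t)
    = inst_ty t (tyArr (s --o tyVar 0) (mu s --o tyVar 0)).
  by rewrite /inst_ty; cbn -[mu]; rewrite subst_mu.
apply: ty_tapp => //; apply: typing_closed fold_typing hG.
by rewrite /closed_ty; cbn -[mu]; rewrite ws wf_mu.
Qed.

Lemma fold_at_typing n G t f :
  lin_free G -> wf_ty n t -> typing n G f (tapp s t --o t) ->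
  typing n G (fold_at s t f) (mu s --o t).
Proof.
move=> hG wt hf; apply: free_app (fold_tapp_typing hG wt) _ => //.
exact: ty_bang.
Qed.

(** Pure β-reduction: at the type, at the [!]-abstraction of the algebra, and at the linear
    abstraction of [u]. *)
Lemma fold_beta n G t f u :
  lin_free G -> wf_ty n t -> typing n G f (tapp s t --o t) -> typing n G u (mu s) ->
  eqt n G (tmApp (fold_at s t f) u) (tmApp (tmTApp u t) (tmBang f)) t.
Proof.
move=> hG wt hf hu; have hF := fold_tapp_typing hG wt.
have wT := wf_tapp ws wt.
have hb e g : typing n (e :: G) g (tapp s t --o t) -> ~~ is_lin e ->
    typing n (e :: G) (tmLam (mu s) (tmApp (tmTApp (tmVar 0) t) (tmBang (shift_tm 1 g)))) (mu s --o t).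
  move=> hg he; have hG' : lin_free (e :: G) by rewrite lin_free_cons he.
  apply: ty_lam; first exact: wf_mu.
  apply: ty_app; first by apply: cs_left; apply: csplit_free.
    by apply: typing_tapp_mu => //; apply: ty_lin => //=; rewrite (negbTE he) (eqP hG).
  by apply: ty_bang => //; apply: typing_shift1 hg.
have hv0 : typing n (Int (tapp s t --o t) :: G) (tmVar 0) (tapp s t --o t) by apply: ty_int.
have hb0 := hb _ _ hv0 isT.
apply: eqt_trans.
  apply: free_eqt_appl hu => //; apply: eqt_trans.
    apply: free_eqt_appl (ty_bang hG hf) => //.
    exact: eqt_beta_tlam.
  rewrite /tinst_tm subst_lamI.
  set b := subst_tm _ _ _.
  have -> : b = tmLam (mu s) (tmApp (tmTApp (tmVar 0) t) (tmBang (shift_tm 1 (tmVar 0)))).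
    by rewrite /b; cbn -[mu]; rewrite subst_mu.
  by apply: eqt_beta_lamI hb0 hf => //=; rewrite -/(tapp s t) wT wt.
rewrite /inst_tm; cbn -[mu]; rewrite subst_mu subst_id_ty.
apply: eqt_trans.
  apply: eqt_beta_lam; apply: free_app hu => //.
  apply: ty_lam; first exact: wf_mu.
  apply: ty_app; first by apply: cs_left; apply: csplit_free.
    by apply: typing_tapp_mu => //; apply: ty_lin => //=; rewrite (eqP hG).
  by apply: ty_bang => //; apply: typing_shift1 hf.
rewrite /inst_tm; cbn -[mu]; rewrite subst_id_ty -/(inst_tm u _) inst_shift_tm.
apply: eqt_refl; apply: free_app (ty_bang hG hf) => //; exact: typing_tapp_mu.
Qed.

Hypothesis occ : occurs_only true 0 s.

Lemma fmap_typing n G t t' f :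
  lin_free G -> wf_ty n t -> wf_ty n t' -> typing n G f (t --o t') ->
  typing n G (fmap s t t' f) (tapp s t --o tapp s t').
Proof.
move=> hG wt wt' hf; have := act_typing occ ws (leq0n n) wt wt' hG hf.
by rewrite !put0.
Qed.

(* The body of [in_ s z] below the type abstraction, at the type t. *)
Let inb t z : tm :=
  tmLamI (tapp s t --o t)
    (tmApp (tmVar 0)
      (tmApp (fmap s (mu s) t (fold_at s t (tmVar 0))) (shift_tm 1 z))).

(** Since [inb] is closed under substitution, the β-steps at [z] and at the type lead from one
    instance of it to another. *)
Let inb_subst ft fm t z :
  subst_tm ft fm (inb t z) = inb (subst_ty ft t) (subst_tm ft fm z).
Proof.
rewrite /inb subst_lamI; cbn -[mu fold_at fmap].
rewrite subst_fmap // subst_fold_at subst_mu subst_tapp //.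
by rewrite subst_shift1_tm.
Qed.

Let in_E : in_ s = tmLam (tapp s (mu s)) (tmTLam (inb (tyVar 0) (tmVar 0))).
Proof. by rewrite /inb /tapp inst_var0_ty. Qed.

(** Linear variables are allowed in [G] because [in_] applies this to a linear variable [z]; the
    splits hand all of them to [z]. *)
Let inb_body n G t z :
  wf_ty n t -> typing n G z (tapp s (mu s)) ->
  typing n (Int (tapp s t --o t) :: G)
    (tmApp (tmVar 0) (tmApp (fmap s (mu s) t (fold_at s t (tmVar 0))) (shift_tm 1 z))) t.
Proof.
move=> wt hz; have wm := wf_mu n.
have hU : lin_free (Int (tapp s t --o t) :: map unlin G) by rewrite /lin_free /= lin_free_unlin.
apply: ty_app; first by apply: cs_int; apply: csplit_unlin.
  by apply: ty_int.
apply: ty_app; first by apply: cs_int; apply: csplit_unlin.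
  apply: fmap_typing => //; apply: fold_at_typing => //; exact: ty_int.
exact: typing_shift1.
Qed.

Let inb_typing n G t z :
  wf_ty n t -> typing n G z (tapp s (mu s)) ->
  typing n G (inb t z) (tyArr (tapp s t --o t) t).
Proof.
move=> wt hz; apply: typing_lamI; last exact: inb_body.
by rewrite /= wt wf_tapp.
Qed.

Let inb_tlam n G z :
  typing n G z (tapp s (mu s)) ->
  typing n G (tmTLam (inb (tyVar 0) (tshift_tm 1 z))) (mu s).
Proof.
move=> hz; apply: ty_tlam; rewrite -(inst_var0_ty ws); apply: inb_typing => //.
have := typing_tshift1 hz; rewrite ren_tapp // ren_mu; exact.
Qed.

Lemma in_typing : typing 0 [::] (in_ s) (tapp s (mu s) --o mu s).
Proof.
rewrite in_E; apply: ty_lam; first by apply: wf_tapp => //; apply: wf_mu.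
apply: (@inb_tlam 0 _ (tmVar 0)); exact: ty_lin.
Qed.

Lemma subst_in ft fm : subst_tm ft fm (in_ s) = in_ s.
Proof. exact: subst_closed_tm in_typing. Qed.

Lemma ren_in rt r : ren_tm rt r (in_ s) = in_ s.
Proof. exact: ren_closed_tm in_typing. Qed.

Lemma in_typing_free n G : lin_free G -> typing n G (in_ s) (tapp s (mu s) --o mu s).
Proof.
apply: typing_closed in_typing.
by rewrite /closed_ty; cbn -[mu]; rewrite wf_mu wf_tapp // wf_mu.
Qed.

Lemma in_beta n G t f z :
  lin_free G -> wf_ty n t -> typing n G f (tapp s t --o t) ->
  typing n G z (tapp s (mu s)) ->
  eqt n G (tmApp (tmTApp (tmApp (in_ s) z) t) (tmBang f))
    (tmApp f (tmApp (fmap s (mu s) t (fold_at s t f)) z)) t.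
Proof.
move=> hG wt hf hz; have hi := in_typing_free n hG.
apply: eqt_trans.
  apply: free_eqt_appl (ty_bang hG hf) => //.
  apply: eqt_trans.
    apply: (eqt_tapp (s := tyArr (s --o tyVar 0) (tyVar 0))) => //.
    rewrite in_E; apply: eqt_beta_lam; rewrite -in_E; exact: free_app hi hz.
  have -> : inst_tm z (tmTLam (inb (tyVar 0) (tmVar 0))) = tmTLam (inb (tyVar 0) (tshift_tm 1 z)).
    transitivity (tmTLam (subst_tm (up_ty tyVar) (fun i => tshift_tm 1 (scons z tmVar i))
      (inb (tyVar 0) (tmVar 0)))); first by [].
    by rewrite inb_subst.
  by apply: eqt_beta_tlam; apply: typing_tapp_mu => //; apply: inb_tlam.
rewrite /tinst_tm inb_subst -/(tinst_tm t _) tinst_tshift_tm.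
apply: eqt_trans.
  by apply: eqt_beta_lamI (inb_body wt hz) hf => //=; rewrite wt wf_tapp.
rewrite /inst_tm; cbn -[mu fold_at fmap shift_tm].
have -> : subst_tm tyVar (scons f tmVar) (shift_tm 1 z) = z by apply: inst_shift_tm.
rewrite subst_fmap // subst_fold_at subst_mu !subst_id_ty.
apply: eqt_refl; apply: (free_app hG hf); apply: (free_app hG _ hz).
exact: fmap_typing hG (wf_mu n) wt (fold_at_typing hG wt hf).
Qed.

(** The algebra law of [fold] is computation: [fold_beta] turns the left side into [in z] at [t] and
    [!f], which [in_beta] evaluates. It gives the existence half of initiality and also enters the
    uniqueness half through [d_mu_eta]. *)
Lemma fold_algebra n G t f z :
  lin_free G -> wf_ty n t -> typing n G f (tapp s t --o t) ->
  typing n G z (tapp s (mu s)) ->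
  eqt n G (tmApp (fold_at s t f) (tmApp (in_ s) z))
    (tmApp f (tmApp (fmap s (mu s) t (fold_at s t f)) z)) t.
Proof.
move=> hG wt hf hz; apply: eqt_trans (in_beta hG wt hf hz).
by apply: fold_beta => //; apply: free_app hz => //; apply: in_typing_free.
Qed.

Lemma fmap_id n G t :
  lin_free G -> wf_ty n t ->
  eqt n G (fmap s t t (tmId t)) (tmId (tapp s t)) (tapp s t --o tapp s t).
Proof.
move=> hG wt; have := act_id occ ws (leq0n n) wt hG; by rewrite !put0.
Qed.

End MuTypes.

(** * Well-formed relations *)

Definition ren_rdecl (rt : nat -> nat) (d : rdecl) : rdecl :=
  let: (k, s, t) := d in (k, ren_ty rt s, ren_ty rt t).

Definition rweak (rt rr : nat -> nat) (Th Th' : seq rdecl) : Prop :=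
  forall i d, onth Th i = Some d -> onth Th' (rr i) = Some (ren_rdecl rt d).

Lemma onth_map (T U : Type) (g : T -> U) (s : seq T) i :
  onth (map g s) i = omap g (onth s i).
Proof. by elim: s i => [|x s IH] [|i] //=; apply: IH. Qed.

Lemma rweak_up rt rr k s t Th Th' :
  rweak rt rr Th Th' ->
  rweak rt (upren rr) ((k, s, t) :: Th) ((k, ren_ty rt s, ren_ty rt t) :: Th').
Proof. by move=> h [|i] d /=; [case=> <- | apply: h]. Qed.

Lemma rweak_tshift rt rr Th Th' :
  rweak rt rr Th Th' ->
  rweak (upren rt) rr (map tshift_rdecl Th) (map tshift_rdecl Th').
Proof.
move=> h i d; rewrite !onth_map; case E: (onth Th i) => [[[k s] t]|] //= [<-].
by rewrite (h _ _ E) /= !ren_ren_ty.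
Qed.

Lemma map_Int_ren g Gam : map Int (map g Gam) = map (map_entry g) (map Int Gam).
Proof. by rewrite -!map_comp. Qed.

Scheme wf_prop_mut := Minimality for wf_prop Sort Prop
  with wf_rel_mut := Minimality for wf_rel Sort Prop.
Combined Scheme wf_prop_rel_ind from wf_prop_mut, wf_rel_mut.

Lemma ren_wf_prop_rel :
  (forall n Gam Th p, wf_prop n Gam Th p ->
     forall m rt r rr Gam' Th', (forall i, i < n -> rt i < m) ->
     weak rt r (map Int Gam) (map Int Gam') -> rweak rt rr Th Th' ->
     wf_prop m Gam' Th' (ren_prop rt r rr p)) /\
  (forall n Gam Th R s t, wf_rel n Gam Th R s t ->
     forall m rt r rr Gam' Th', (forall i, i < n -> rt i < m) ->
     weak rt r (map Int Gam) (map Int Gam') -> rweak rt rr Th Th' ->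
     wf_rel m Gam' Th' (ren_rel rt r rr R) (ren_ty rt s) (ren_ty rt t)).
Proof.
have upb n m rt : (forall i, i < n -> rt i < m) -> forall i, i < n.+1 -> upren rt i < m.+1.
  by move=> h [|i] //= /h.
have upT rt r Gam Gam' : weak rt r (map Int Gam) (map Int Gam') ->
    weak (upren rt) r (map Int (map (ren_ty S) Gam)) (map Int (map (ren_ty S) Gam')).
  by rewrite !map_Int_ren; apply: weak_tshift.
have upV rt r a Gam Gam' : weak rt r (map Int Gam) (map Int Gam') ->
    weak rt (upren r) (map Int (a :: Gam)) (map Int (ren_ty rt a :: Gam')).
  exact: (@weak_keep rt r (Int a)).
apply: wf_prop_rel_ind => /=.
- move=> n Gam Th s t u ht hu m rt r rr Gam' Th' h w h'.
  by apply: wf_eq; [apply: typing_ren ht h w | apply: typing_ren hu h w].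
- move=> n Gam Th R s t x y _ IH hx hy m rt r rr Gam' Th' h w h'.
  by apply: wf_app; [apply: IH | apply: typing_ren hx h w | apply: typing_ren hy h w].
- by move=> *; apply: wf_top.
- by move=> *; apply: wf_bot.
- by move=> *; apply: wf_imp; eauto.
- by move=> *; apply: wf_and; eauto.
- by move=> *; apply: wf_or; eauto.
- by move=> n Gam Th p _ IH m rt r rr Gam' Th' h w h'; apply: wf_allT; apply: IH;
    [apply: upb | apply: upT | apply: rweak_tshift].
- by move=> n Gam Th p _ IH m rt r rr Gam' Th' h w h'; apply: wf_exT; apply: IH;
    [apply: upb | apply: upT | apply: rweak_tshift].
- by move=> n Gam Th s p ws _ IH m rt r rr Gam' Th' h w h'; apply: wf_all;
    [apply: wf_ren_ty ws h | apply: IH => //; apply: upV].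
- by move=> n Gam Th s p ws _ IH m rt r rr Gam' Th' h w h'; apply: wf_ex;
    [apply: wf_ren_ty ws h | apply: IH => //; apply: upV].
- by move=> n Gam Th k s t p ws wt _ IH m rt r rr Gam' Th' h w h'; apply: wf_allR;
    [apply: wf_ren_ty ws h | apply: wf_ren_ty wt h | apply: IH => //; apply: rweak_up].
- by move=> n Gam Th k s t p ws wt _ IH m rt r rr Gam' Th' h w h'; apply: wf_exR;
    [apply: wf_ren_ty ws h | apply: wf_ren_ty wt h | apply: IH => //; apply: rweak_up].
- by move=> n Gam Th i k s t hi m rt r rr Gam' Th' h w h'; apply: (@wf_rvar _ _ _ _ k);
    apply: (h' _ _ hi).
- by move=> n Gam Th s t p ws wt _ IH m rt r rr Gam' Th' h w h'; apply: wf_compr;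
    [apply: wf_ren_ty ws h | apply: wf_ren_ty wt h | apply: IH => //; exact: (upV _ _ _ _ _ (upV _ _ _ _ _ w))].
Qed.

Lemma rweak_id Th : rweak id id Th Th.
Proof. by move=> i [[k s] t] ->; rewrite /= !ren_id_ty. Qed.

Lemma wf_shift_rel n Gam0 Gam Th R s t :
  wf_rel n Gam Th R s t ->
  wf_rel n (Gam0 ++ Gam) Th (shift_rel (size Gam0) R) s t.
Proof.
move=> h; rewrite -(ren_id_ty s) -(ren_id_ty t).
apply: (ren_wf_prop_rel.2 _ _ _ _ _ _ h) => //; last exact: rweak_id.
by elim: Gam0 => [|a Gam0 IH]; [apply: weak_id | apply: weak_skip IH].
Qed.

Lemma wf_shift2_rel n a b Gam Th R s t :
  wf_rel n Gam Th R s t -> wf_rel n (a :: b :: Gam) Th (shift_rel 2 R) s t.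
Proof. exact: (@wf_shift_rel _ [:: a; b]). Qed.

Lemma wf_shift4_rel n a b c d Gam Th R s t :
  wf_rel n Gam Th R s t -> wf_rel n (a :: b :: c :: d :: Gam) Th (shift_rel 4 R) s t.
Proof. exact: (@wf_shift_rel _ [:: a; b; c; d]). Qed.

(** With [tshift2_rctx] below, the contexts of the body of [rAll]: two fresh type variables and an
    admissible relation between them. *)
Definition tshift2_ctx (Gam : seq ty) : seq ty := map (ren_ty S) (map (ren_ty S) Gam).
Definition tshift2_rctx (Th : seq rdecl) : seq rdecl :=
  (Adm, tyVar 1, tyVar 0) :: map tshift_rdecl (map tshift_rdecl Th).

Lemma weak_tshift2 Gam : weak (addn 2) id (map Int Gam) (map Int (tshift2_ctx Gam)).
Proof.
rewrite /tshift2_ctx !map_Int_ren -map_comp.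
elim: Gam => [|a Gam IH] /=; first by constructor.
rewrite -[X in weak _ X]upren_id ren_ren_ty; exact: (@weak_keep _ _ (Int a)).
Qed.

Lemma wf_rwk n Gam Th R s t :
  wf_rel n Gam Th R s t ->
  wf_rel n.+2 (tshift2_ctx Gam) (tshift2_rctx Th) (rwk R)
    (ren_ty (addn 2) s) (ren_ty (addn 2) t).
Proof.
move=> h; apply: (ren_wf_prop_rel.2 _ _ _ _ _ _ h) => //; first exact: weak_tshift2.
by move=> i d hi; rewrite /= !onth_map hi; case: d hi => [[k a] b] _ /=; rewrite !ren_ren_ty.
Qed.

Lemma typing_cast n G t s s' : typing n G t s -> s = s' -> typing n G t s'.
Proof. by move=> h <-. Qed.

Lemma typing_int n Gam i s : onth Gam i = Some s -> typing n (map Int Gam) (tmVar i) s.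
Proof. by move=> h; apply: ty_int; [rewrite onth_map h | apply: lin_free_Int]. Qed.

Lemma typing_app n Gam t u s r :
  typing n (map Int Gam) t (s --o r) -> typing n (map Int Gam) u s ->
  typing n (map Int Gam) (tmApp t u) r.
Proof. exact: free_app (lin_free_Int Gam). Qed.

Lemma typing_bang n Gam t s :
  typing n (map Int Gam) t s -> typing n (map Int Gam) (tmBang t) (tyBang s).
Proof. exact: ty_bang (lin_free_Int Gam). Qed.

Lemma wf_rEq n Gam Th s : wf_ty n s -> wf_rel n Gam Th (rEq s) s s.
Proof. by move=> ws; apply: wf_compr => //; apply: wf_eq; apply: typing_int. Qed.

Lemma wf_rLolli n Gam Th s t s' t' R R' :
  wf_ty n s -> wf_ty n t -> wf_ty n s' -> wf_ty n t' ->
  wf_rel n Gam Th R s t -> wf_rel n Gam Th R' s' t' ->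
  wf_rel n Gam Th (rLolli s t s' t' R R') (s --o s') (t --o t').
Proof.
move=> ws wt ws' wt' hR hR'.
apply: wf_compr; rewrite /= ?ws ?wt ?ws' ?wt' //.
do 2 apply: wf_all => //; apply: wf_imp.
  by apply: wf_app (wf_shift4_rel _ _ _ _ hR) _ _; apply: typing_int.
by apply: wf_app (wf_shift4_rel _ _ _ _ hR') _ _;
  [apply: (typing_app (s := s)) | apply: (typing_app (s := t))]; apply: typing_int.
Qed.

Lemma wf_rArr n Gam Th s t s' t' R R' :
  wf_ty n s -> wf_ty n t -> wf_ty n s' -> wf_ty n t' ->
  wf_rel n Gam Th R s t -> wf_rel n Gam Th R' s' t' ->
  wf_rel n Gam Th (rArr s t s' t' R R') (tyArr s s') (tyArr t t').
Proof.
move=> ws wt ws' wt' hR hR'.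
apply: wf_compr; rewrite /= ?ws ?wt ?ws' ?wt' //.
do 2 apply: wf_all => //; apply: wf_imp.
  by apply: wf_app (wf_shift4_rel _ _ _ _ hR) _ _; apply: typing_int.
by apply: wf_app (wf_shift4_rel _ _ _ _ hR') _ _;
  [apply: (typing_app (s := tyBang s)) | apply: (typing_app (s := tyBang t))];
  try apply: typing_bang; apply: typing_int.
Qed.

(** The bound variable of [s] is read as the first new type variable, index 1, that of [t] as the
    second, index 0; hence the different heads of the two [scons]. *)
Lemma wf_rAll n Gam Th s t R :
  wf_ty n.+1 s -> wf_ty n.+1 t ->
  wf_rel n.+2 (tshift2_ctx Gam) (tshift2_rctx Th) R
    (ren_ty (scons 1 (addn 2)) s) (ren_ty (scons 0 (addn 2)) t) ->
  wf_rel n Gam Th (rAll s t R) (tyPi s) (tyPi t).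
Proof.
move=> ws wt hR; apply: wf_compr => //; do 2 apply: wf_allT; apply: wf_allR => //=.
apply: wf_app; first exact: wf_shift2_rel hR.
- apply: (@typing_cast _ _ _ (inst_ty (tyVar 1) (ren_ty (upren S) (ren_ty (upren S) s)))).
    by apply: ty_tapp => //; apply: typing_int.
  by rewrite /inst_ty !subst_ren_ty ren_as_subst_ty; f_equal; fext; case: i.
- apply: (@typing_cast _ _ _ (inst_ty (tyVar 0) (ren_ty (upren S) (ren_ty (upren S) t)))).
    by apply: ty_tapp => //; apply: typing_int.
  by rewrite /inst_ty !subst_ren_ty ren_as_subst_ty; f_equal; fext; case: i.
Qed.

(** * The second-order encodings and the relations pulled back along them *)

Lemma encI_typing n G : lin_free G -> typing n G encI (tyI --o tyPi (tyVar 0 --o tyVar 0)).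
Proof.
move=> hG; have hG' : lin_free (map (map_entry (ren_ty S)) G) by rewrite lin_free_map.
apply: ty_lam => //; apply: ty_tlam; apply: ty_lam => //=.
apply: ty_letS; first by apply: cs_right; apply: cs_left; apply: csplit_free.
  by apply: ty_lin => //=; rewrite (eqP hG').
by apply: ty_lin => //=; rewrite (eqP hG').
Qed.

Lemma encT_typing n G s t :
  lin_free G -> wf_ty n s -> wf_ty n t ->
  typing n G (encT s t)
    (tyTensor s t --o tyPi ((ren_ty S s --o ren_ty S t --o tyVar 0) --o tyVar 0)).
Proof.
move=> hG ws wt; have hG' : lin_free (map (map_entry (ren_ty S)) G) by rewrite lin_free_map.
apply: ty_lam; first by rewrite /= ws wt.
apply: ty_letT; first by apply: cs_left; apply: csplit_free.
  by apply: ty_lin => //=; rewrite (eqP hG).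
apply: ty_tlam; apply: ty_lam; first by rewrite /= !wf_shift_ty.
(* From the front, the entries are the continuation, the second component, the first component and
   the consumed pair. *)
apply: (@ty_app _ _ [:: Lin _, Used _, Lin _, Used _ & map _ G] [:: Used _, Lin _, Used _, Used _ & map _ G]).
- by apply: cs_left; apply: cs_right; apply: cs_left; apply: cs_used; apply: csplit_free.
- apply: (@ty_app _ _ [:: Lin _, Used _, Used _, Used _ & map _ G] [:: Used _, Used _, Lin _, Used _ & map _ G]).
  + by apply: cs_left; apply: cs_used; apply: cs_right; apply: cs_used; apply: csplit_free.
  + by apply: ty_lin => //=; rewrite (eqP hG').
  + by apply: ty_lin => //=; rewrite (eqP hG').
- by apply: ty_lin => //=; rewrite (eqP hG').
Qed.

Lemma encB_typing n G s :
  lin_free G -> wf_ty n s ->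
  typing n G (encB s) (tyBang s --o tyPi (tyArr (ren_ty S s) (tyVar 0) --o tyVar 0)).
Proof.
move=> hG ws; have hG' : lin_free (map (map_entry (ren_ty S)) G) by rewrite lin_free_map.
apply: ty_lam => //; apply: ty_tlam; apply: ty_lam; first by rewrite /= wf_shift_ty.
apply: ty_app; first by apply: cs_left; apply: cs_right; apply: csplit_free.
  by apply: ty_lin => //=; rewrite (eqP hG').
by apply: ty_lin => //=; rewrite (eqP hG').
Qed.

Lemma ren_sconsS k s : ren_ty (scons k (addn 2)) (ren_ty S s) = ren_ty (addn 2) s.
Proof. by rewrite ren_ren_ty. Qed.

Lemma wf_addn2 n s : wf_ty n s -> wf_ty n.+2 (ren_ty (addn 2) s).
Proof. by move=> h; apply: wf_ren_ty h _. Qed.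

Lemma wf_rI n Gam Th : wf_rel n Gam Th rI tyI tyI.
Proof.
have hv : wf_rel n.+2 (tshift2_ctx [:: tyI, tyI & Gam]) (tshift2_rctx Th) (rVar 0) (tyVar 1) (tyVar 0).
  exact: wf_rvar.
apply: wf_compr => //; apply: (@wf_app _ _ _ _ (tyPi (tyVar 0 --o tyVar 0)) (tyPi (tyVar 0 --o tyVar 0))).
- by apply: wf_rAll => //=; apply: wf_rLolli.
- by apply: (typing_app (s := tyI)); [apply: encI_typing; apply: lin_free_Int | apply: typing_int].
- by apply: (typing_app (s := tyI)); [apply: encI_typing; apply: lin_free_Int | apply: typing_int].
Qed.

Lemma wf_rTensor n Gam Th s t s' t' R R' :
  wf_ty n s -> wf_ty n t -> wf_ty n s' -> wf_ty n t' ->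
  wf_rel n Gam Th R s t -> wf_rel n Gam Th R' s' t' ->
  wf_rel n Gam Th (rTensor s t s' t' R R') (tyTensor s s') (tyTensor t t').
Proof.
move=> ws wt ws' wt' hR hR'.
have hv : wf_rel n.+2 (tshift2_ctx Gam) (tshift2_rctx Th) (rVar 0) (tyVar 1) (tyVar 0).
  exact: wf_rvar.
apply: wf_compr; rewrite /= ?ws ?wt ?ws' ?wt' //.
apply: wf_app.
- apply: wf_shift2_rel; apply: wf_rAll; rewrite /= ?wf_shift_ty //.
  rewrite !ren_sconsS; apply: wf_rLolli; rewrite /= ?wf_addn2 //.
  apply: wf_rLolli; rewrite /= ?wf_addn2 //; first exact: wf_rwk.
  by apply: wf_rLolli; rewrite /= ?wf_addn2 //; apply: wf_rwk.
- apply: (typing_app (s := tyTensor s s')); last exact: typing_int.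
  by apply: encT_typing => //; apply: lin_free_Int.
- apply: (typing_app (s := tyTensor t t')); last exact: typing_int.
  by apply: encT_typing => //; apply: lin_free_Int.
Qed.

Lemma wf_rBang_enc n Gam Th s t R :
  wf_ty n s -> wf_ty n t -> wf_rel n Gam Th R s t ->
  wf_rel n Gam Th
    (rAll (tyArr (ren_ty S s) (tyVar 0) --o tyVar 0) (tyArr (ren_ty S t) (tyVar 0) --o tyVar 0)
       (rLolli (tyArr (ren_ty (addn 2) s) (tyVar 1)) (tyArr (ren_ty (addn 2) t) (tyVar 0))
          (tyVar 1) (tyVar 0)
          (rArr (ren_ty (addn 2) s) (ren_ty (addn 2) t) (tyVar 1) (tyVar 0) (rwk R) (rVar 0))
          (rVar 0)))
    (tyPi (tyArr (ren_ty S s) (tyVar 0) --o tyVar 0))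
    (tyPi (tyArr (ren_ty S t) (tyVar 0) --o tyVar 0)).
Proof.
move=> ws wt hR.
have hv : wf_rel n.+2 (tshift2_ctx Gam) (tshift2_rctx Th) (rVar 0) (tyVar 1) (tyVar 0).
  exact: wf_rvar.
apply: wf_rAll; rewrite /= ?wf_shift_ty // !ren_sconsS.
apply: wf_rLolli; rewrite /= ?wf_addn2 //.
by apply: wf_rArr; rewrite /= ?wf_addn2 //; apply: wf_rwk.
Qed.

Lemma wf_rBang n Gam Th s t R :
  wf_ty n s -> wf_ty n t -> wf_rel n Gam Th R s t ->
  wf_rel n Gam Th (rBang s t R) (tyBang s) (tyBang t).
Proof.
move=> ws wt hR; apply: wf_compr => //; apply: wf_app.
- by apply: wf_shift2_rel; apply: wf_rBang_enc.
- apply: (typing_app (s := tyBang s)); last exact: typing_int.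
  by apply: encB_typing => //; apply: lin_free_Int.
- apply: (typing_app (s := tyBang t)); last exact: typing_int.
  by apply: encB_typing => //; apply: lin_free_Int.
Qed.

(** * The relational interpretation *)

(** Beyond its length an environment returns a closed default. A map fixing that default commutes
    with lookup at every index, in range or not. *)
Lemma env_at_map g e i :
  g (tyI, tyI, rEq tyI) = (tyI, tyI, rEq tyI) -> env_at (map g e) i = g (env_at e i).
Proof.
move=> h; rewrite /env_at; case: (ltnP i (size e)) => hi; first exact: nth_map.
by rewrite !nth_default ?size_map.
Qed.

Lemma env_at_up e i :
  env_at (up_env e) i.+1
    = (ren_ty (addn 2) (env_at e i).1.1, ren_ty (addn 2) (env_at e i).1.2, rwk (env_at e i).2).
Proof. exact: env_at_map. Qed.

Lemma wf_subst_all m f s : (forall i, wf_ty m (f i)) -> wf_ty m (subst_ty f s).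
Proof.
elim: s m f => //= [a IHa b IHb|a IHa b IHb|a IHa] m f h; rewrite ?IHa ?IHb //.
by case=> //= i; apply: wf_shift_ty.
Qed.

(** All indices are quantified, the default being itself a well-formed entry; [wf_rint] then holds
    for every type, whatever its free variables. *)
Definition env_ok n Gam Th (e : renv) : Prop :=
  forall i, [/\ wf_ty n (env_at e i).1.1, wf_ty n (env_at e i).1.2 &
    wf_rel n Gam Th (env_at e i).2 (env_at e i).1.1 (env_at e i).1.2].

Lemma env_ok_nil n Gam Th : env_ok n Gam Th [::].
Proof. by move=> i; rewrite /env_at nth_nil; split => //; apply: wf_rEq. Qed.

Lemma env_ok_cons n Gam Th s t R e :
  wf_ty n s -> wf_ty n t -> wf_rel n Gam Th R s t -> env_ok n Gam Th e ->
  env_ok n Gam Th ((s, t, R) :: e).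
Proof. by move=> ws wt hR he [|i] //; apply: he. Qed.

Lemma env_ok_up n Gam Th e :
  env_ok n Gam Th e -> env_ok n.+2 (tshift2_ctx Gam) (tshift2_rctx Th) (up_env e).
Proof.
move=> he [|i]; first by split => //; apply: wf_rvar.
rewrite env_at_up; case: (he i) => h1 h2 h3.
by split; [apply: wf_addn2 | apply: wf_addn2 | apply: wf_rwk].
Qed.

Lemma wf_src n Gam Th e s : env_ok n Gam Th e -> wf_ty n (src_ty e s).
Proof. by move=> he; apply: wf_subst_all => i; case: (he i). Qed.

Lemma wf_tgt n Gam Th e s : env_ok n Gam Th e -> wf_ty n (tgt_ty e s).
Proof. by move=> he; apply: wf_subst_all => i; case: (he i). Qed.

Lemma wf_rint n Gam Th e s :
  env_ok n Gam Th e -> wf_rel n Gam Th (rint s e) (src_ty e s) (tgt_ty e s).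
Proof.
elim: s n Gam Th e => [i||a IHa b IHb|a IHa b IHb|a IHa|a IHa] n Gam Th e he /=.
- by case: (he i).
- exact: wf_rI.
- by apply: wf_rTensor; rewrite ?(wf_src _ he) ?(wf_tgt _ he) //; [apply: IHa | apply: IHb].
- by apply: wf_rLolli; rewrite ?(wf_src _ he) ?(wf_tgt _ he) //; [apply: IHa | apply: IHb].
- by apply: wf_rBang; rewrite ?(wf_src _ he) ?(wf_tgt _ he) //; apply: IHa.
- apply: wf_rAll.
  + by apply: wf_subst_all => -[|i] //=; apply: wf_shift_ty; case: (he i).
  + by apply: wf_subst_all => -[|i] //=; apply: wf_shift_ty; case: (he i).
  + have := IHa _ _ _ _ (env_ok_up he).
    rewrite /src_ty /tgt_ty !ren_subst_ty.
    (* The two readings of the type of the body, by lookup in the extended environment and by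
       renaming after substitution under Π, agree entry by entry. *)
    set f1 := (fun i => (env_at (up_env e) i).1.1); set f2 := (fun i => (env_at (up_env e) i).1.2).
    set g1 := (fun i => ren_ty _ _); set g2 := (fun i => ren_ty (scons 0 _) _).
    have -> : f1 = g1 by fext; case: i => //= i; rewrite /f1 /g1 env_at_up /= ren_ren_ty.
    by have -> : f2 = g2 by fext; case: i => //= i; rewrite /f2 /g2 env_at_up /= ren_ren_ty.
Qed.

(** * Substitution and renaming in relational interpretations *)

Definition subst_env ft f fr (e : renv) : renv :=
  map (fun x => (subst_ty ft x.1.1, subst_ty ft x.1.2, subst_rel ft f fr x.2)) e.

Lemma env_at_subst ft f fr e i :
  env_at (subst_env ft f fr e) i
    = (subst_ty ft (env_at e i).1.1, subst_ty ft (env_at e i).1.2,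
       subst_rel ft f fr (env_at e i).2).
Proof. exact: env_at_map. Qed.

Lemma subst_shift4_rel ft f fr R :
  subst_rel ft (up_tm (up_tm (up_tm (up_tm f))))
      (fun i => shift_rel 1 (shift_rel 1 (shift_rel 2 (fr i)))) (shift_rel 4 R)
    = shift_rel 4 (subst_rel ft f fr R).
Proof.
rewrite /shift_rel subst_ren_rel ren_subst_rel; f_equal; fext.
- by rewrite ren_id_ty.
- by rewrite /= /shift_tm !ren_ren_tm.
- by rewrite !ren_ren_rel.
Qed.

Lemma subst_rLolli ft f fr s t s' t' R R' :
  subst_rel ft f fr (rLolli s t s' t' R R')
    = rLolli (subst_ty ft s) (subst_ty ft t) (subst_ty ft s') (subst_ty ft t')
        (subst_rel ft f fr R) (subst_rel ft f fr R').
Proof. by rewrite /rLolli /= !subst_shift4_rel. Qed.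

Lemma subst_rArr ft f fr s t s' t' R R' :
  subst_rel ft f fr (rArr s t s' t' R R')
    = rArr (subst_ty ft s) (subst_ty ft t) (subst_ty ft s') (subst_ty ft t')
        (subst_rel ft f fr R) (subst_rel ft f fr R').
Proof. by rewrite /rArr /= !subst_shift4_rel. Qed.

Lemma subst_rAll ft f fr s t R :
  subst_rel ft f fr (rAll s t R)
    = rAll (subst_ty (up_ty ft) s) (subst_ty (up_ty ft) t)
        (subst_rel (up_ty (up_ty ft)) (fun i => tshift_tm 1 (tshift_tm 1 (f i)))
           (up_rel (fun i => tshift_rel 1 (tshift_rel 1 (fr i)))) R).
Proof.
rewrite /rAll /=; do 6 f_equal.
rewrite /shift_rel subst_ren_rel ren_subst_rel; f_equal; fext.
- by rewrite ren_id_ty.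
- by rewrite /= /shift_tm /tshift_tm !ren_ren_tm.
- by case: i => //= i; rewrite /rshift_rel /tshift_rel /shift_rel !ren_ren_rel.
Qed.

Lemma subst_rwk ft f fr R :
  subst_rel (up_ty (up_ty ft)) (fun i => tshift_tm 1 (tshift_tm 1 (f i)))
      (up_rel (fun i => tshift_rel 1 (tshift_rel 1 (fr i)))) (rwk R)
    = rwk (subst_rel ft f fr R).
Proof.
rewrite /rwk subst_ren_rel ren_subst_rel; f_equal; fext.
- by rewrite /= !ren_ren_ty.
- by rewrite /= /tshift_tm !ren_ren_tm.
- by rewrite /= /tshift_rel /rshift_rel !ren_ren_rel.
Qed.

Lemma subst_up2_addn ft s :
  subst_ty (up_ty (up_ty ft)) (ren_ty (addn 2) s) = ren_ty (addn 2) (subst_ty ft s).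
Proof. by rewrite subst_ren_ty ren_subst_ty; f_equal; fext => /=; rewrite ren_ren_ty. Qed.

Lemma subst_up_shift_ty ft s : subst_ty (up_ty ft) (ren_ty S s) = ren_ty S (subst_ty ft s).
Proof. by rewrite subst_ren_ty ren_subst_ty. Qed.

Lemma subst_rTensor ft f fr s t s' t' R R' :
  subst_rel ft f fr (rTensor s t s' t' R R')
    = rTensor (subst_ty ft s) (subst_ty ft t) (subst_ty ft s') (subst_ty ft t')
        (subst_rel ft f fr R) (subst_rel ft f fr R').
Proof.
rewrite /rTensor; cbn -[rAll rLolli rwk shift_rel up_ty].
rewrite subst_shift2_rel subst_rAll !subst_rLolli !subst_rwk.
by rewrite /= -/(up_ty ft) !subst_up2_addn !subst_up_shift_ty.
Qed.

Lemma subst_rBang ft f fr s t R :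
  subst_rel ft f fr (rBang s t R)
    = rBang (subst_ty ft s) (subst_ty ft t) (subst_rel ft f fr R).
Proof.
rewrite /rBang; cbn -[rAll rLolli rArr rwk shift_rel up_ty].
rewrite subst_shift2_rel subst_rAll !subst_rLolli !subst_rArr !subst_rwk.
by rewrite /= -/(up_ty ft) !subst_up2_addn !subst_up_shift_ty.
Qed.

(** Every relational constructor commutes with substitution, so a substitution passes to the
    environment. This allows identity extension, stated for type variables, to be instantiated at
    types, and a Π-clause at an actual relation. *)
Lemma subst_rint ft f fr s e :
  subst_rel ft f fr (rint s e) = rint s (subst_env ft f fr e).
Proof.
have srcE g gm gr (d : renv) a : src_ty (subst_env g gm gr d) a = subst_ty g (src_ty d a).
  by rewrite /src_ty subst_subst_ty; f_equal; fext; rewrite env_at_subst.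
have tgtE g gm gr (d : renv) a : tgt_ty (subst_env g gm gr d) a = subst_ty g (tgt_ty d a).
  by rewrite /tgt_ty subst_subst_ty; f_equal; fext; rewrite env_at_subst.
elim: s ft f fr e => [i||a IHa b IHb|a IHa b IHb|a IHa|a IHa] ft f fr e.
- by rewrite /= env_at_subst.
- by [].
- by cbn -[rTensor]; rewrite subst_rTensor !srcE !tgtE IHa IHb.
- by cbn -[rLolli]; rewrite subst_rLolli !srcE !tgtE IHa IHb.
- by cbn -[rBang]; rewrite subst_rBang !srcE !tgtE IHa.
- cbn -[rAll]; rewrite subst_rAll IHa !subst_subst_ty !subst_up_ty; f_equal.
  + by f_equal; f_equal; fext; rewrite env_at_subst.
  + by f_equal; f_equal; fext; rewrite env_at_subst.
  + rewrite /up_env /=; do 2 f_equal; rewrite /subst_env -!map_comp.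
    by apply: eq_map => -[[x y] R] /=; rewrite !subst_up2_addn subst_rwk.
Qed.

(** Only the entries at free variables matter. It serves to drop from a two-entry environment the
    entry that does not concern the type at hand. *)
Lemma rint_ren k r s e e' :
  wf_ty k s -> (forall i, i < k -> env_at e (r i) = env_at e' i) ->
  rint (ren_ty r s) e = rint s e'.
Proof.
have srcE (d d' : renv) j q a : wf_ty j a -> (forall i, i < j -> env_at d (q i) = env_at d' i) ->
    (src_ty d (ren_ty q a) = src_ty d' a) * (tgt_ty d (ren_ty q a) = tgt_ty d' a).
  move=> wa h; rewrite /src_ty /tgt_ty !subst_ren_ty.
  by split; apply: eq_subst_ty wa _ => i /h ->.
elim: s k r e e' => [i||a IHa b IHb|a IHa b IHb|a IHa|a IHa] k r e e' ws h //=.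
- by rewrite h.
- by case/andP: ws => wa wb; rewrite !(srcE e e' k) // (IHa k r e e') // (IHb k r e e').
- by case/andP: ws => wa wb; rewrite !(srcE e e' k) // (IHa k r e e') // (IHb k r e e').
- by rewrite !(srcE e e' k) // (IHa k r e e').
- rewrite (IHa k.+1 _ _ (up_env e')) //; last first.
    by case=> // i hi; rewrite [upren r i.+1]/= !env_at_up h.
  rewrite !subst_ren_ty; f_equal; apply: (@eq_subst_ty k.+1 _ _ a ws) => -[|i] //= hi; by rewrite h.
Qed.

(** * Derived rules *)

Section Derived.

Variables (A : adm_pred) (hA : adm_class A).

Lemma d_cast n Gam Th Ph p q : drv A n Gam Th Ph p -> p = q -> drv A n Gam Th Ph q.
Proof. by move=> h <-. Qed.

Lemma inst_prop_eq u s t t' :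
  inst_prop u (pEq s t t') = pEq s (inst_tm u t) (inst_tm u t').
Proof. by rewrite /inst_prop /= subst_id_ty. Qed.

Lemma d_eq_trans n Gam Th Ph s t u v :
  typing n (map Int Gam) t s ->
  drv A n Gam Th Ph (pEq s t u) -> drv A n Gam Th Ph (pEq s u v) ->
  drv A n Gam Th Ph (pEq s t v).
Proof.
move=> ht h1 h2.
have := @d_leibniz A n Gam Th Ph s u v (pEq s (shift_tm 1 t) (tmVar 0)).
rewrite !inst_prop_eq !inst_shift_tm; apply => //.
by apply: wf_eq; [apply: typing_shift1 | apply: (@typing_int _ (s :: Gam))].
Qed.

Lemma d_eq_sym n Gam Th Ph s t u :
  typing n (map Int Gam) t s ->
  drv A n Gam Th Ph (pEq s t u) -> drv A n Gam Th Ph (pEq s u t).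
Proof.
move=> ht h1.
have := @d_leibniz A n Gam Th Ph s t u (pEq s (tmVar 0) (shift_tm 1 t)).
rewrite !inst_prop_eq !inst_shift_tm; apply => //.
- by apply: wf_eq; [apply: (@typing_int _ (s :: Gam)) | apply: typing_shift1].
- by apply: d_ext; apply: eqt_refl.
Qed.

Lemma d_eq_conv n Gam Th Ph s t t' u u' :
  typing n (map Int Gam) t' s ->
  eqt n (map Int Gam) t t' s -> eqt n (map Int Gam) u u' s ->
  drv A n Gam Th Ph (pEq s t u) -> drv A n Gam Th Ph (pEq s t' u').
Proof.
move=> ht' ht hu h; apply: (d_eq_trans ht' (u := u)); last exact: d_ext.
by apply: (d_eq_trans ht' _ h); apply: d_ext; apply: eqt_sym.
Qed.

Lemma d_eq_appl n Gam Th Ph s r g g' x :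
  typing n (map Int Gam) g (s --o r) -> typing n (map Int Gam) x s ->
  drv A n Gam Th Ph (pEq (s --o r) g g') ->
  drv A n Gam Th Ph (pEq r (tmApp g x) (tmApp g' x)).
Proof.
move=> hg hx h.
have := @d_leibniz A n Gam Th Ph (s --o r) g g'
  (pEq r (shift_tm 1 (tmApp g x)) (tmApp (tmVar 0) (shift_tm 1 x))).
have hgx := typing_app hg hx.
rewrite !inst_prop_eq !inst_shift_tm /inst_tm /= -!/(inst_tm _ (shift_tm 1 x)) !inst_shift_tm.
apply => //; last by apply: d_ext; apply: eqt_refl.
apply: wf_eq; first exact: typing_shift1.
apply: (@typing_app _ (_ :: Gam) _ _ s); first exact: (@typing_int _ (_ :: Gam)).
exact: typing_shift1.
Qed.

Lemma d_eq_appr n Gam Th Ph s r f x x' :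
  typing n (map Int Gam) f (s --o r) -> typing n (map Int Gam) x s ->
  drv A n Gam Th Ph (pEq s x x') ->
  drv A n Gam Th Ph (pEq r (tmApp f x) (tmApp f x')).
Proof.
move=> hf hx h.
have := @d_leibniz A n Gam Th Ph s x x'
  (pEq r (shift_tm 1 (tmApp f x)) (tmApp (shift_tm 1 f) (tmVar 0))).
have hgx := typing_app hf hx.
rewrite !inst_prop_eq !inst_shift_tm /inst_tm /= -!/(inst_tm _ (shift_tm 1 f)) !inst_shift_tm.
apply => //; last by apply: d_ext; apply: eqt_refl.
apply: wf_eq; first exact: typing_shift1.
apply: (@typing_app _ (_ :: Gam) _ _ s); last exact: (@typing_int _ (_ :: Gam)).
exact: typing_shift1.
Qed.

Lemma inst_shift_rel u R : subst_rel tyVar (scons u tmVar) rVar (shift_rel 1 R) = R.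
Proof. by rewrite /shift_rel subst_ren_rel subst_id_rel. Qed.

Lemma d_rel_conv n Gam Th Ph R s r t t' u u' :
  wf_rel n Gam Th R s r -> typing n (map Int Gam) t' s ->
  typing n (map Int Gam) u r ->
  eqt n (map Int Gam) t t' s -> eqt n (map Int Gam) u u' r ->
  drv A n Gam Th Ph (pRel R t u) -> drv A n Gam Th Ph (pRel R t' u').
Proof.
move=> hR ht' hu htt huu h.
have instE a b c : inst_prop c (pRel (shift_rel 1 R) a b) = pRel R (inst_tm c a) (inst_tm c b).
  by rewrite /inst_prop /= inst_shift_rel.
have h1 : drv A n Gam Th Ph (pRel R t' u).
  have := @d_leibniz A n Gam Th Ph s t t' (pRel (shift_rel 1 R) (tmVar 0) (shift_tm 1 u)).
  rewrite !instE !inst_shift_tm; apply => //; last exact: d_ext.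
  by apply: wf_app (wf_shift_rel [:: s] hR) _ _;
    [apply: (@typing_int _ (_ :: Gam)) | apply: typing_shift1].
have := @d_leibniz A n Gam Th Ph r u u' (pRel (shift_rel 1 R) (shift_tm 1 t') (tmVar 0)).
rewrite !instE !inst_shift_tm; apply => //; last exact: d_ext.
by apply: wf_app (wf_shift_rel [:: r] hR) _ _;
  [apply: typing_shift1 | apply: (@typing_int _ (_ :: Gam))].
Qed.

(** * Introduction and elimination for the relational constructions *)

Lemma d_rEqE n Gam Th Ph s x y :
  drv A n Gam Th Ph (pRel (rEq s) x y) -> drv A n Gam Th Ph (pEq s x y).
Proof.
by move/d_comprE; rewrite /inst2_prop /= subst_id_ty.
Qed.

Lemma d_rEqI n Gam Th Ph s x y :
  wf_ty n s -> typing n (map Int Gam) x s -> typing n (map Int Gam) y s ->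
  drv A n Gam Th Ph (pEq s x y) -> drv A n Gam Th Ph (pRel (rEq s) x y).
Proof.
move=> ws hx hy h; apply: d_comprI; first by apply: wf_app hx hy; apply: wf_rEq.
by rewrite /inst2_prop /= subst_id_ty.
Qed.

Lemma inst2_shift2_tm x y t : subst_tm tyVar (scons y (scons x tmVar)) (shift_tm 2 t) = t.
Proof. by rewrite /shift_tm subst_ren_tm subst_id_tm. Qed.

Lemma inst2_graph f x y t :
  inst2_prop x y (pEq t (tmApp (shift_tm 2 f) (tmVar 1)) (tmVar 0)) = pEq t (tmApp f x) y.
Proof. by rewrite /inst2_prop /= inst2_shift2_tm subst_id_ty. Qed.

Lemma wf_rGraph n Gam Th s t f :
  wf_ty n s -> wf_ty n t -> typing n (map Int Gam) f (s --o t) ->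
  wf_rel n Gam Th (rGraph s t f) s t.
Proof. by move=> ws wt hf; apply: (adm_rel hA); apply: (adm_graph hA). Qed.

Lemma d_graphE n Gam Th Ph s t f x y :
  drv A n Gam Th Ph (pRel (rGraph s t f) x y) -> drv A n Gam Th Ph (pEq t (tmApp f x) y).
Proof. by move/d_comprE; rewrite inst2_graph. Qed.

Lemma d_graphI n Gam Th Ph s t f x y :
  wf_ty n s -> wf_ty n t -> typing n (map Int Gam) f (s --o t) ->
  typing n (map Int Gam) x s -> typing n (map Int Gam) y t ->
  drv A n Gam Th Ph (pEq t (tmApp f x) y) -> drv A n Gam Th Ph (pRel (rGraph s t f) x y).
Proof.
move=> ws wt hf hx hy h; apply: d_comprI; last by rewrite inst2_graph.
by apply: wf_app hx hy; apply: wf_rGraph.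
Qed.

(** [rLolli] and [rArr] share this shape: a comprehension over [f], [g] followed by two universal
    quantifiers. In the matrix [Q] the indices 0 to 3 stand for [y], [x], [g], [f]. *)
Lemma d_all2E n Gam Th Ph s t f g x y Q :
  typing n (map Int Gam) x s -> typing n (map Int Gam) y t ->
  drv A n Gam Th Ph (inst2_prop f g (pAll s (pAll t Q))) ->
  drv A n Gam Th Ph
    (subst_prop tyVar (scons y (scons x (scons g (scons f tmVar)))) rVar Q).
Proof.
rewrite /inst2_prop /= !subst_id_ty => hx hy h.
have h1 := d_allE hx h; rewrite /inst_prop /= subst_id_ty in h1.
have h2 := d_allE hy h1; rewrite /inst_prop !subst_subst_prop in h2.
apply: d_cast h2 _; f_equal; fext; case: i => [|[|[|[|i]]]] //=.
- by rewrite -!/(shift_tm 1 _) /shift_tm !subst_ren_tm /= subst_id_tm.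
- by rewrite /shift_tm !subst_ren_tm /= !subst_id_tm.
- by rewrite /shift_tm !subst_ren_tm /= !subst_id_tm.
Qed.

Lemma d_all2I n Gam Th Ph s t f g Q :
  wf_ty n s -> wf_ty n t ->
  drv A n (t :: s :: Gam) Th (map (shift_prop 2) Ph)
    (subst_prop tyVar
       (scons (tmVar 0) (scons (tmVar 1)
          (scons (shift_tm 2 g) (scons (shift_tm 2 f) (fun i => tmVar i.+2))))) rVar Q) ->
  drv A n Gam Th Ph (inst2_prop f g (pAll s (pAll t Q))).
Proof.
move=> ws wt h; rewrite /inst2_prop /= !subst_id_ty.
apply: d_allI => //; apply: d_allI => //.
have -> : map (shift_prop 1) (map (shift_prop 1) Ph) = map (shift_prop 2) Ph.
  rewrite -map_comp; apply: eq_map => p /=; exact: ren_ren_prop.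
apply: d_cast h _; f_equal; fext; case: i => [|[|[|[|i]]]] //=;
  by rewrite /shift_tm !ren_ren_tm.
Qed.

Lemma subst_shift4E x y g f R :
  subst_rel tyVar (scons y (scons x (scons g (scons f tmVar)))) rVar (shift_rel 4 R) = R.
Proof. by rewrite /shift_rel subst_ren_rel subst_id_rel. Qed.

Lemma subst_shift4I x y g f R :
  subst_rel tyVar (scons y (scons x (scons g (scons f (fun i => tmVar i.+2))))) rVar
    (shift_rel 4 R) = shift_rel 2 R.
Proof. by rewrite /shift_rel subst_ren_rel [RHS]ren_as_subst_rel. Qed.

Lemma d_lolliE n Gam Th Ph s t s' t' R R' f g x y :
  typing n (map Int Gam) x s -> typing n (map Int Gam) y t ->
  drv A n Gam Th Ph (pRel (rLolli s t s' t' R R') f g) ->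
  drv A n Gam Th Ph (pRel R x y) ->
  drv A n Gam Th Ph (pRel R' (tmApp f x) (tmApp g y)).
Proof.
move=> hx hy /d_comprE /(d_all2E hx hy) /=; rewrite !subst_shift4E; exact: d_impE.
Qed.

Lemma d_arrE n Gam Th Ph s t s' t' R R' f g x y :
  typing n (map Int Gam) x s -> typing n (map Int Gam) y t ->
  drv A n Gam Th Ph (pRel (rArr s t s' t' R R') f g) ->
  drv A n Gam Th Ph (pRel R x y) ->
  drv A n Gam Th Ph (pRel R' (tmApp f (tmBang x)) (tmApp g (tmBang y))).
Proof.
move=> hx hy /d_comprE /(d_all2E hx hy) /=; rewrite !subst_shift4E; exact: d_impE.
Qed.

Lemma d_lolliI n Gam Th Ph s t s' t' R R' f g :
  wf_ty n s -> wf_ty n t -> wf_ty n s' -> wf_ty n t' ->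
  wf_rel n Gam Th R s t -> wf_rel n Gam Th R' s' t' ->
  typing n (map Int Gam) f (s --o s') -> typing n (map Int Gam) g (t --o t') ->
  drv A n (t :: s :: Gam) Th
    (pRel (shift_rel 2 R) (tmVar 1) (tmVar 0) :: map (shift_prop 2) Ph)
    (pRel (shift_rel 2 R') (tmApp (shift_tm 2 f) (tmVar 1)) (tmApp (shift_tm 2 g) (tmVar 0))) ->
  drv A n Gam Th Ph (pRel (rLolli s t s' t' R R') f g).
Proof.
move=> ws wt ws' wt' hR hR' hf hg h; apply: d_comprI.
  by apply: wf_app hf hg; apply: wf_rLolli.
apply: d_all2I => //=; rewrite !subst_shift4I; apply: d_impI => //.
by apply: wf_app (wf_shift2_rel _ _ hR) _ _; apply: typing_int.
Qed.

Lemma d_arrI n Gam Th Ph s t s' t' R R' f g :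
  wf_ty n s -> wf_ty n t -> wf_ty n s' -> wf_ty n t' ->
  wf_rel n Gam Th R s t -> wf_rel n Gam Th R' s' t' ->
  typing n (map Int Gam) f (tyArr s s') -> typing n (map Int Gam) g (tyArr t t') ->
  drv A n (t :: s :: Gam) Th
    (pRel (shift_rel 2 R) (tmVar 1) (tmVar 0) :: map (shift_prop 2) Ph)
    (pRel (shift_rel 2 R') (tmApp (shift_tm 2 f) (tmBang (tmVar 1)))
                           (tmApp (shift_tm 2 g) (tmBang (tmVar 0)))) ->
  drv A n Gam Th Ph (pRel (rArr s t s' t' R R') f g).
Proof.
move=> ws wt ws' wt' hR hR' hf hg h; apply: d_comprI.
  by apply: wf_app hf hg; apply: wf_rArr.
apply: d_all2I => //=; rewrite !subst_shift4I; apply: d_impI => //.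
by apply: wf_app (wf_shift2_rel _ _ hR) _ _; apply: typing_int.
Qed.

Lemma d_allE_rel n Gam Th Ph s t R f g x y S0 :
  wf_ty n x -> wf_ty n y -> A n Gam Th S0 x y ->
  drv A n Gam Th Ph (pRel (rAll s t R) f g) ->
  drv A n Gam Th Ph
    (pRel (subst_rel (scons y (scons x tyVar)) tmVar (scons S0 rVar) R)
       (tmTApp f x) (tmTApp g y)).
Proof.
move=> wx wy hS /d_comprE; rewrite /inst2_prop /= => h.
have h1 := d_allTE wx h; rewrite /tinst_prop /= in h1.
have h2 := d_allTE wy h1; rewrite /tinst_prop /= in h2.
rewrite !subst_ren_ty !subst_id_ty in h2.
have h3 := d_allRE (k := Adm) hS h2; rewrite /rinst_prop /= in h3.
apply: d_cast h3 _; f_equal.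
- rewrite /shift_rel !subst_ren_rel !subst_subst_rel; f_equal; fext.
  + case: i => [|[|i]] //=; by rewrite ?subst_ren_ty !subst_id_ty.
  + by case: i.
- by rewrite /tshift_tm !ren_ren_tm !subst_subst_tm !subst_ren_tm /= !subst_id_tm !subst_id_ty.
- by rewrite /tshift_tm !ren_ren_tm !subst_subst_tm !subst_ren_tm /= !subst_id_tm !subst_id_ty.
Qed.

Lemma d_allI_rel n Gam Th Ph s t R f g :
  wf_rel n Gam Th (rAll s t R) (tyPi s) (tyPi t) ->
  typing n (map Int Gam) f (tyPi s) -> typing n (map Int Gam) g (tyPi t) ->
  drv A n.+2 (tshift2_ctx Gam) (tshift2_rctx Th) (map (ren_prop (addn 2) id S) Ph)
    (pRel R (tmTApp (tshift_tm 2 f) (tyVar 1)) (tmTApp (tshift_tm 2 g) (tyVar 0))) ->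
  drv A n Gam Th Ph (pRel (rAll s t R) f g).
Proof.
move=> wR hf hg h; apply: d_comprI; first exact: wf_app wR hf hg.
rewrite /inst2_prop /=; do 2 apply: d_allTI; apply: d_allRI => //.
have -> : map (rshift_prop 1) (map (tshift_prop 1) (map (tshift_prop 1) Ph))
    = map (ren_prop (addn 2) id S) Ph.
  by rewrite -!map_comp; apply: eq_map => p /=; rewrite /rshift_prop /tshift_prop !ren_ren_prop.
apply: d_cast h _; f_equal.
- rewrite /shift_rel subst_ren_rel -[LHS]subst_id_rel; f_equal; fext.
  + by case: i => [|[|i]].
  + by case: i.
- by rewrite /tshift_tm !ren_ren_tm.
- by rewrite /tshift_tm !ren_ren_tm.
Qed.

(** Instantiating the two type variables and the relation variable cancels the weakening that
    [up_env] put on the old entries, so eliminating a Π amounts to extending the environment. *)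
Lemma d_rint_piE n Gam Th Ph a e f g x y S0 :
  wf_ty n x -> wf_ty n y -> A n Gam Th S0 x y ->
  drv A n Gam Th Ph (pRel (rint (tyPi a) e) f g) ->
  drv A n Gam Th Ph (pRel (rint a ((x, y, S0) :: e)) (tmTApp f x) (tmTApp g y)).
Proof.
move=> wx wy hS /(d_allE_rel wx wy hS) h; apply: d_cast h _.
rewrite subst_rint /subst_env /up_env /= -map_comp; do 3 f_equal.
rewrite -[RHS]map_id; apply: eq_map => -[[u v] R] /=.
by rewrite !subst_ren_ty !subst_id_ty /rwk subst_ren_rel subst_id_rel.
Qed.

(** * Equalities and relations at exponential types *)

Lemma subst_encB ft f s : subst_tm ft f (encB s) = encB (subst_ty ft s).
Proof. by rewrite /encB /= subst_up_shift_ty. Qed.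

Lemma ren_encB rt r s : ren_tm rt r (encB s) = encB (ren_ty rt s).
Proof. by rewrite ren_as_subst_tm subst_encB -ren_as_subst_ty. Qed.

(** The encoding of [x] evaluates functions at [x]. Through this equation [!R], defined on
    encodings, becomes a statement about functions out of [!s]. *)
Lemma encB_beta n G s a x f :
  lin_free G -> wf_ty n s -> wf_ty n a -> typing n G x (tyBang s) ->
  typing n G f (tyArr s a) ->
  eqt n G (tmApp (tmTApp (tmApp (encB s) x) a) f) (tmApp f x) a.
Proof.
move=> hG ws wa hx hf; have hG' : lin_free (map (map_entry (ren_ty S)) G) by rewrite lin_free_map.
have hx' := typing_tshift1 hx; rewrite /= in hx'.
have hb m H y c : lin_free H -> wf_ty m s -> wf_ty m c -> typing m H y (tyBang s) ->
    typing m H (tmLam (tyArr s c) (tmApp (tmVar 0) (shift_tm 1 y))) (tyArr s c --o c).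
  move=> hH wsm wc hy; apply: ty_lam; first by rewrite /= wsm.
  apply: ty_app; first by apply: cs_left; apply: csplit_free.
    by apply: ty_lin => //=; rewrite (eqP hH).
  exact: typing_shift1.
have tE c d : inst_ty c (tyArr (ren_ty S d) (tyVar 0) --o tyVar 0) = tyArr d c --o c.
  by rewrite /inst_ty /= subst_ren_ty /= subst_id_ty.
apply: eqt_trans.
  apply: free_eqt_appl (hf) => //; apply: eqt_trans.
    rewrite -tE; apply: eqt_tapp => //; apply: eqt_beta_lam.
    by apply: (free_app hG _ hx); apply: encB_typing.
  rewrite /inst_tm /= !up_ty_var subst_id_ty.
  apply: eqt_beta_tlam; rewrite -[X in typing _ _ _ X]tE; apply: ty_tapp => //; apply: ty_tlam.
  apply: ty_lam; first by rewrite /= wf_shift_ty.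
  apply: ty_app; first by apply: cs_left; apply: csplit_free.
    by apply: ty_lin => //=; rewrite (eqP hG').
  exact: typing_shift1.
rewrite /tinst_tm /= subst_ren_ty subst_id_ty.
have -> : subst_tm (scons a tyVar) (up_tm tmVar) (shift_tm 1 (tshift_tm 1 x)) = shift_tm 1 x.
  by rewrite up_tm_var /shift_tm /tshift_tm ren_ren_tm subst_ren_tm [RHS]ren_as_subst_tm.
apply: eqt_trans.
  by apply: eqt_beta_lam; apply: (free_app hG _ hf); apply: hb.
rewrite /inst_tm /= -/(inst_tm f (shift_tm 1 x)) inst_shift_tm.
by apply: eqt_refl; apply: (free_app hG hf).
Qed.

End Derived.

Lemma shift2_rEq s : shift_rel 2 (rEq s) = rEq s.
Proof. by rewrite /shift_rel /rEq /= ren_id_ty. Qed.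

Lemma shift2_rGraph s t f : shift_rel 2 (rGraph s t f) = rGraph s t (shift_tm 2 f).
Proof. by rewrite /shift_rel /rGraph /= !ren_id_ty /shift_tm !ren_ren_tm. Qed.

Section Parametricity.

Variables (A : adm_pred) (hA : adm_class A).

Lemma d_eq_bang n Gam Th Ph s x x' :
  typing n (map Int Gam) x s -> drv A n Gam Th Ph (pEq s x x') ->
  drv A n Gam Th Ph (pEq (tyBang s) (tmBang x) (tmBang x')).
Proof.
move=> hx h.
have := @d_leibniz A n Gam Th Ph s x x'
  (pEq (tyBang s) (tmBang (shift_tm 1 x)) (tmBang (tmVar 0))).
have e c d : inst_tm c (tmBang d) = tmBang (inst_tm c d) by [].
rewrite !inst_prop_eq !e !inst_shift_tm; apply => //.
  apply: wf_eq; apply: (@typing_bang _ (_ :: Gam)); first exact: typing_shift1.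
  exact: (@typing_int _ (_ :: Gam)).
by apply: d_ext; apply: eqt_refl; apply: typing_bang.
Qed.

Lemma ren_rArr rt r rr s t s' t' R R' :
  ren_rel rt r rr (rArr s t s' t' R R')
    = rArr (ren_ty rt s) (ren_ty rt t) (ren_ty rt s') (ren_ty rt t')
        (ren_rel rt r rr R) (ren_rel rt r rr R').
Proof. by rewrite !ren_as_subst_rel subst_rArr !ren_as_subst_ty. Qed.

Lemma ren_rint rt r rr s e :
  ren_rel rt r rr (rint s e)
    = rint s (map (fun x => (ren_ty rt x.1.1, ren_ty rt x.1.2, ren_rel rt r rr x.2)) e).
Proof.
rewrite ren_as_subst_rel subst_rint; congr rint; apply: eq_map => x.
by rewrite !ren_as_subst_ty ren_as_subst_rel.
Qed.

Lemma rBang_inst s t R x y :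
  inst2_prop x y
    (pRel (shift_rel 2
       (rAll (tyArr (ren_ty S s) (tyVar 0) --o tyVar 0) (tyArr (ren_ty S t) (tyVar 0) --o tyVar 0)
       (rLolli (tyArr (ren_ty (addn 2) s) (tyVar 1)) (tyArr (ren_ty (addn 2) t) (tyVar 0))
          (tyVar 1) (tyVar 0)
          (rArr (ren_ty (addn 2) s) (ren_ty (addn 2) t) (tyVar 1) (tyVar 0) (rwk R) (rVar 0))
          (rVar 0))))
       (tmApp (encB s) (tmVar 1)) (tmApp (encB t) (tmVar 0)))
  = pRel
      (rAll (tyArr (ren_ty S s) (tyVar 0) --o tyVar 0) (tyArr (ren_ty S t) (tyVar 0) --o tyVar 0)
       (rLolli (tyArr (ren_ty (addn 2) s) (tyVar 1)) (tyArr (ren_ty (addn 2) t) (tyVar 0))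
          (tyVar 1) (tyVar 0)
          (rArr (ren_ty (addn 2) s) (ren_ty (addn 2) t) (tyVar 1) (tyVar 0) (rwk R) (rVar 0))
          (rVar 0)))
      (tmApp (encB s) x) (tmApp (encB t) y).
Proof.
rewrite /inst2_prop; set B := rAll _ _ _; cbn -[encB shift_rel].
by rewrite !subst_encB !subst_id_ty /shift_rel subst_ren_rel subst_id_rel.
Qed.

(** Unfolded through the encoding, the claim is that functions related by the arrow from [R] to an
    arbitrary admissible [S] have [S]-related values at [!x] and [!y]. That is the defining clause
    of [rArr] at [x] and [y]. *)
Lemma d_bangI n Gam Th Ph s t R x y :
  wf_ty n s -> wf_ty n t -> wf_rel n Gam Th R s t ->
  typing n (map Int Gam) x s -> typing n (map Int Gam) y t ->
  drv A n Gam Th Ph (pRel R x y) ->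
  drv A n Gam Th Ph (pRel (rBang s t R) (tmBang x) (tmBang y)).
Proof.
(* The assumption becomes a hypothesis, which the quantifier rules below weaken. *)
move=> ws wt hR hx hy h0; apply: d_impE h0; apply: d_impI; first exact: wf_app hR hx hy.
have fG := lin_free_Int.
have hbx := typing_bang hx; have hby := typing_bang hy.
apply: d_comprI; first exact: wf_app (wf_rBang ws wt hR) hbx hby.
rewrite rBang_inst; apply: d_allI_rel.
- exact: wf_rBang_enc.
- by apply: typing_app hbx; apply: encB_typing.
- by apply: typing_app hby; apply: encB_typing.
set w := ren_ty (addn 2).
have eB r u : tshift_tm 2 (tmApp (encB r) (tmBang u)) = tmApp (encB (w r)) (tmBang (tshift_tm 2 u)).
  by rewrite /w -(ren_encB _ id).
rewrite !eB.
have ws2 := wf_addn2 ws; have wt2 := wf_addn2 wt.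
have hv : wf_rel n.+2 (tshift2_ctx Gam) (tshift2_rctx Th) (rVar 0) (tyVar 1) (tyVar 0).
  exact: wf_rvar.
have tE c d : inst_ty c (tyArr (ren_ty S d) (tyVar 0) --o tyVar 0) = tyArr d c --o c.
  by rewrite /inst_ty /= subst_ren_ty /= subst_id_ty.
have hx2 : typing n.+2 (map Int (tshift2_ctx Gam)) (tshift_tm 2 x) (w s).
  by apply: typing_ren hx _ (weak_tshift2 Gam).
have hy2 : typing n.+2 (map Int (tshift2_ctx Gam)) (tshift_tm 2 y) (w t).
  by apply: typing_ren hy _ (weak_tshift2 Gam).
apply: d_lolliI; rewrite /= ?ws2 ?wt2 //.
- by apply: wf_rArr => //; apply: wf_rwk.
- rewrite -tE; apply: ty_tapp => //; apply: typing_app (typing_bang hx2).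
  exact: encB_typing.
- rewrite -tE; apply: ty_tapp => //; apply: typing_app (typing_bang hy2).
  exact: encB_typing.
set Gam2 := (_ :: _ :: tshift2_ctx Gam).
have hx4 : typing n.+2 (map Int Gam2) (shift_tm 2 (tshift_tm 2 x)) (w s).
  exact: typing_shift2.
have hy4 : typing n.+2 (map Int Gam2) (shift_tm 2 (tshift_tm 2 y)) (w t).
  exact: typing_shift2.
have hR4 : wf_rel n.+2 Gam2 (tshift2_rctx Th) (shift_rel 2 (rwk R)) (w s) (w t).
  by apply: wf_shift2_rel; apply: wf_rwk.
set Ph2 := (_ :: _ :: _).
have D1 : drv A n.+2 Gam2 (tshift2_rctx Th) Ph2
    (pRel (shift_rel 2 (rwk R)) (shift_tm 2 (tshift_tm 2 x)) (shift_tm 2 (tshift_tm 2 y))).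
  by apply: (@d_ax _ _ _ _ _ 1).
have D2 : drv A n.+2 Gam2 (tshift2_rctx Th) Ph2
    (pRel (rArr (w s) (w t) (tyVar 1) (tyVar 0) (shift_rel 2 (rwk R)) (rVar 0)) (tmVar 1) (tmVar 0)).
  by apply: (@d_ax _ _ _ _ _ 0); rewrite /Ph2 /= /shift_rel ren_rArr !ren_id_ty.
(* This is the claim with the functions applied directly to [!x] and [!y]; [encB_beta] converts both
   sides. *)
have D3 := d_arrE hx4 hy4 D2 D1.
have eS r u a : shift_tm 2 (tmTApp (tmApp (encB r) (tmBang u)) a)
    = tmTApp (tmApp (encB r) (tmBang (shift_tm 2 u))) a.
  by rewrite -[in RHS](ren_id_ty r) -(ren_encB id (addn 2)) -{2}(ren_id_ty a).
have h1 : typing n.+2 (map Int Gam2) (tmVar 1) (tyArr (w s) (tyVar 1)) by apply: typing_int.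
have h2 : typing n.+2 (map Int Gam2) (tmVar 0) (tyArr (w t) (tyVar 0)) by apply: typing_int.
rewrite !eS; apply: d_rel_conv D3.
- by apply: wf_rvar.
- apply: (typing_app _ h1); rewrite -tE; apply: ty_tapp => //.
  by apply: typing_app (typing_bang hx4); apply: encB_typing.
- by apply: typing_app h2 (typing_bang hy4).
- by apply: eqt_sym; apply: encB_beta => //; apply: typing_bang.
- by apply: eqt_sym; apply: encB_beta => //; apply: typing_bang.
Qed.

(** * Identity extension *)

Lemma d_equivE n Gam Th Ph s t R R' x y :
  typing n (map Int Gam) x s -> typing n (map Int Gam) y t ->
  drv A n Gam Th Ph (pEquiv s t R R') ->
  drv A n Gam Th Ph (pAnd (pImp (pRel R x y) (pRel R' x y)) (pImp (pRel R' x y) (pRel R x y))).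
Proof.
move=> hx hy h.
have h1 := d_allE hx h; rewrite /inst_prop /= subst_id_ty in h1.
have h2 := d_allE hy h1; rewrite /inst_prop /= in h2.
apply: d_cast h2 _; rewrite /shift_rel !subst_ren_rel !subst_subst_rel.
by rewrite -!/(inst_tm _ (shift_tm 1 _)) !inst_shift_tm /= !subst_id_rel.
Qed.

Lemma d_param n Gam Th Ph s x :
  closed_ty s -> typing n (map Int Gam) x s ->
  drv A n Gam Th Ph (pRel (rint s [::]) x x).
Proof.
move=> cs hx.
have h := d_equivE hx hx (@d_identity_extension A n Gam Th Ph 0 s cs).
apply: (d_impE (d_andEr h)); apply: d_rEqI => //; first exact: wf_ty_le cs _.
by apply: d_ext; apply: eqt_refl.
Qed.

(** The instance with one type variable, set to [a]; [subst_rint] turns the equality environment of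
    the variable into that of [a]. *)
Lemma d_identity_at n Gam Th Ph s a x y :
  wf_ty 1 s -> wf_ty n a ->
  typing n (map Int Gam) x (tapp s a) -> typing n (map Int Gam) y (tapp s a) ->
  drv A n Gam Th Ph
    (pAnd (pImp (pRel (rint s [:: (a, a, rEq a)]) x y) (pRel (rEq (tapp s a)) x y))
          (pImp (pRel (rEq (tapp s a)) x y) (pRel (rint s [:: (a, a, rEq a)]) x y))).
Proof.
move=> ws wa hx hy.
have h := d_allTE wa (@d_identity_extension A n Gam Th Ph 1 s ws).
apply: (d_equivE hx hy); apply: d_cast h _.
rewrite /tinst_prop /pEquiv; cbn -[rint shift_rel].
have e R : subst_rel (scons a tyVar) (up_tm (up_tm tmVar)) rVar (shift_rel 2 R)
    = shift_rel 2 (subst_rel (scons a tyVar) tmVar rVar R).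
  by rewrite -subst_shift2_rel.
have -> : (fun i => shift_rel 1 (shift_rel 1 (rVar i))) = rVar by [].
rewrite !e subst_rint /subst_env /eq_env /=.
by rewrite -/(inst_ty a s) -/(tapp s a).
Qed.

(** * The graph of the functorial action *)

Section Functor.

Variables (s : ty) (ws : wf_ty 1 s) (occ : occurs_only true 0 s).

(** With the inner variable at index 0, [s] as it stands is already the target instance. The
    argument is intuitionistic because the action may use its function any number of times; the type
    is closed so that [d_param] applies. *)
Definition functor_ty : ty :=
  tyPi (tyPi (tyArr (tyVar 1 --o tyVar 0) (tapp s (tyVar 1) --o s))).

Definition functor_tm : tm :=
  tmTLam (tmTLam (tmLamI (tyVar 1 --o tyVar 0) (fmap s (tyVar 1) (tyVar 0) (tmVar 0)))).

Lemma functor_closed : closed_ty functor_ty.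
Proof. by rewrite /closed_ty /= wf_tapp //= (wf_ty_le ws). Qed.

Let body_typing n G a b :
  lin_free G -> wf_ty n a -> wf_ty n b ->
  typing n (Int (a --o b) :: G) (fmap s a b (tmVar 0)) (tapp s a --o tapp s b).
Proof. by move=> hG wa wb; apply: fmap_typing => //; apply: ty_int. Qed.

Let lamI_typing n G a b :
  lin_free G -> wf_ty n a -> wf_ty n b ->
  typing n G (tmLamI (a --o b) (fmap s a b (tmVar 0))) (tyArr (a --o b) (tapp s a --o tapp s b)).
Proof.
by move=> hG wa wb; apply: typing_lamI; [rewrite /= wa | apply: body_typing].
Qed.

Lemma functor_typing n G : lin_free G -> typing n G functor_tm functor_ty.
Proof.
move=> hG; do 2 apply: ty_tlam.
apply: (typing_cast (lamI_typing (a := tyVar 1) (b := tyVar 0) _ _ _)) => //.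
  by rewrite !lin_free_map.
by rewrite [tapp s (tyVar 0)]inst_var0_ty.
Qed.

Let functor_tapp_ty a :
  inst_ty a (tyPi (tyArr (tyVar 1 --o tyVar 0) (tapp s (tyVar 1) --o s)))
  = tyPi (tyArr (ren_ty S a --o tyVar 0) (tapp s (ren_ty S a) --o s)).
Proof.
rewrite /inst_ty /= subst_tapp //=; do 3 f_equal.
by rewrite -[RHS]subst_id_ty; apply: eq_subst_ty ws _; case.
Qed.

Let functor_tapp2_ty a b :
  inst_ty b (tyArr (ren_ty S a --o tyVar 0) (tapp s (ren_ty S a) --o s))
  = tyArr (a --o b) (tapp s a --o tapp s b).
Proof. by rewrite /inst_ty /= subst_tapp //= subst_ren_ty /= subst_id_ty. Qed.

Lemma functor_tapp_typing n G a b :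
  lin_free G -> wf_ty n a -> wf_ty n b ->
  typing n G (tmTApp (tmTApp functor_tm a) b) (tyArr (a --o b) (tapp s a --o tapp s b)).
Proof.
move=> hG wa wb; rewrite -functor_tapp2_ty; apply: ty_tapp => //.
by rewrite -functor_tapp_ty; apply: ty_tapp => //; apply: functor_typing.
Qed.

Lemma functor_beta n G a b f :
  lin_free G -> wf_ty n a -> wf_ty n b -> typing n G f (a --o b) ->
  eqt n G (tmApp (tmTApp (tmTApp functor_tm a) b) (tmBang f)) (fmap s a b f)
    (tapp s a --o tapp s b).
Proof.
move=> hG wa wb hf.
have h1 : typing n G (tmTLam (tmLamI (ren_ty S a --o tyVar 0)
      (fmap s (ren_ty S a) (tyVar 0) (tmVar 0))))
    (tyPi (tyArr (ren_ty S a --o tyVar 0) (tapp s (ren_ty S a) --o s))).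
  apply: ty_tlam; apply: (typing_cast (lamI_typing _ (wf_shift_ty wa) (b := tyVar 0) _)) => //.
    by rewrite lin_free_map.
  by rewrite [tapp s (tyVar 0)]inst_var0_ty.
apply: eqt_trans.
  apply: free_eqt_appl (ty_bang hG hf) => //; apply: eqt_trans.
    rewrite -functor_tapp2_ty; apply: eqt_tapp => //.
    rewrite -functor_tapp_ty; apply: eqt_beta_tlam.
    by apply: ty_tapp => //; apply: functor_typing.
  have -> : tinst_tm a (tmTLam (tmLamI (tyVar 1 --o tyVar 0) (fmap s (tyVar 1) (tyVar 0) (tmVar 0))))
     = tmTLam (tmLamI (ren_ty S a --o tyVar 0) (fmap s (ren_ty S a) (tyVar 0) (tmVar 0))).
    transitivity (tmTLam (subst_tm (up_ty (scons a tyVar)) (fun i => tshift_tm 1 (tmVar i))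
      (tmLamI (tyVar 1 --o tyVar 0) (fmap s (tyVar 1) (tyVar 0) (tmVar 0))))); first by [].
    by rewrite subst_lamI subst_fmap.
  by apply: eqt_beta_tlam; rewrite -functor_tapp2_ty; apply: ty_tapp.
rewrite /tinst_tm subst_lamI subst_fmap //= subst_ren_ty /= subst_id_ty.
apply: eqt_trans.
  by apply: (eqt_beta_lamI hG _ (body_typing hG wa wb) hf); rewrite /= wa.
rewrite /inst_tm subst_fmap // !subst_id_ty; apply: eqt_refl; exact: fmap_typing.
Qed.

Lemma d_functor_graph n Gam Th Ph a b h x y :
  wf_ty n a -> wf_ty n b -> typing n (map Int Gam) h (a --o b) ->
  typing n (map Int Gam) x (tapp s a) -> typing n (map Int Gam) y (tapp s b) ->
  drv A n Gam Th Ph (pRel (rint s [:: (a, b, rGraph a b h)]) x y) ->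
  drv A n Gam Th Ph (pEq (tapp s b) (tmApp (fmap s a b h) x) y).
Proof.
move=> wa wb hh hx hy hxy.
have fG := lin_free_Int.
have gA := adm_graph hA (n := n) (Gam := Gam) Th wa wb hh.
have eA := adm_eq hA (n := n) Gam Th wb.
have gW := adm_rel hA gA; have eW := adm_rel hA eA.
have hid := typing_id (fG Gam) wb.
(* The outer variable is instantiated by the graph of [h], the inner one by equality on [b]. The
   left copy of the functor is then at [a], [b], the right copy at [b], [b]. *)
have D := d_rint_piE wb wb eA (d_rint_piE wa wb gA
  (d_param Th Ph functor_closed (functor_typing n (fG Gam)))).
(* [h] and the identity are related from graph to equality: [h x = y] gives [h x = id y]. *)
have B : drv A n Gam Th Ph (pRel (rBang (a --o b) (b --o b)
    (rLolli a b b b (rGraph a b h) (rEq b))) (tmBang h) (tmBang (tmId b))).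
  apply: d_bangI => //; rewrite /= ?wa ?wb //; first exact: wf_rLolli.
  apply: d_lolliI => //.
  set Gam2 := (_ :: _ :: Gam).
  have hh2 : typing n (map Int Gam2) (shift_tm 2 h) (a --o b) by apply: typing_shift2.
  have hv1 : typing n (map Int Gam2) (tmVar 1) a by apply: typing_int.
  have hv0 : typing n (map Int Gam2) (tmVar 0) b by apply: typing_int.
  have hid2 := typing_id (fG Gam2) wb.
  rewrite shift2_rEq shift2_rGraph.
  rewrite shift_id; apply: d_rEqI => //; try exact: typing_app hh2 hv1.
    exact: typing_app hid2 hv0.
  apply: d_eq_conv; last by apply: d_graphE; apply: (@d_ax _ _ _ _ _ 0); reflexivity.
  - exact: typing_app hh2 hv1.
  - by apply: eqt_refl; apply: typing_app hh2 hv1.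
  - by apply: eqt_sym; apply: free_beta_id => //; apply: eqt_refl.
have hT1 := typing_bang hh; have hT2 := typing_bang hid.
pose e := [:: (b, b, rEq b); (a, b, rGraph a b h)].
have {}D : drv A n Gam Th Ph (pRel
    (rLolli (src_ty e (tapp s (tyVar 1))) (tgt_ty e (tapp s (tyVar 1))) (src_ty e s) (tgt_ty e s)
       (rint (tapp s (tyVar 1)) e) (rint s e))
    (tmApp (tmTApp (tmTApp functor_tm a) b) (tmBang h))
    (tmApp (tmTApp (tmTApp functor_tm b) b) (tmBang (tmId b)))).
  exact: d_lolliE hT1 hT2 D B.
have srcE : src_ty e (tapp s (tyVar 1)) = tapp s a by apply: subst_tapp.
have tgtE : tgt_ty e (tapp s (tyVar 1)) = tapp s b by apply: subst_tapp.
(* In the domain the variable of [s] is the outer one and sees the graph; in the codomain it is the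
   inner one and sees equality. *)
have e1 : rint (tapp s (tyVar 1)) e = rint s [:: (a, b, rGraph a b h)].
  have -> : tapp s (tyVar 1) = ren_ty (scons 1 id) s.
    by rewrite /tapp /inst_ty ren_as_subst_ty; f_equal; fext; case: i.
  by apply: (rint_ren ws) => -[].
have e2 : rint s e = rint s [:: (b, b, rEq b)].
  by rewrite -[in LHS](ren_id_ty s); apply: (rint_ren ws) => -[].
rewrite e1 e2 srcE tgtE in D.
have {}D := d_lolliE hx hy D hxy.
have hM1 := typing_app (typing_app (functor_tapp_typing (fG Gam) wa wb) hT1) hx.
have hM2 := typing_app (typing_app (functor_tapp_typing (fG Gam) wb wb) hT2) hy.
(* Identity extension at [b] makes this an equality; β leaves the action of [h] on the left and, by
   [fmap_id], [y] on the right. *)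
have {}D := d_rEqE (d_impE (d_andEl (d_identity_at Th Ph ws wb hM1 hM2)) D).
apply: d_eq_conv D.
- by apply: typing_app hx; apply: fmap_typing.
- by apply: free_eqt_appl hx => //; apply: functor_beta.
- apply: eqt_trans; first by apply: free_eqt_appl hy => //; apply: functor_beta.
  by apply: free_beta_id => //; [apply: wf_tapp | apply: fmap_id].
Qed.

End Functor.

End Parametricity.

(** * Extensionality on exponentials and parametricity of [mu] *)

Section Uniqueness.

Variables (A : adm_pred) (hA : adm_class A).

(** The scheme demands agreement on all of [!s], while only elements [!x] are given. Identity
    extension closes the gap: any [z] in [!s] is related to itself by [!] of equality. Taken at
    equality on [r], the encoding of this relation sends functions related by [rArr] of equalities,
    here [t] and [u], to equal values [t z] and [u z]. *)
Lemma d_bang_ext n Gam Th Ph s r t u :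
  wf_ty n s -> wf_ty n r ->
  typing n (map Int Gam) t (tyArr s r) -> typing n (map Int Gam) u (tyArr s r) ->
  drv A n (s :: Gam) Th (map (shift_prop 1) Ph)
    (pEq r (tmApp (shift_tm 1 t) (tmBang (tmVar 0))) (tmApp (shift_tm 1 u) (tmBang (tmVar 0)))) ->
  drv A n Gam Th Ph (pEq (tyArr s r) t u).
Proof.
move=> ws wr ht hu /(d_allI ws) h; apply: d_impE h.
set P := pAll _ _.
have wP : wf_prop n Gam Th P.
  apply: wf_all => //; apply: wf_eq;
  by apply: (@typing_app _ (_ :: _) _ _ (tyBang s)); [apply: typing_shift1 |
    apply: typing_bang; apply: (@typing_int _ (_ :: _))].
apply: d_impI => //; apply: d_impE; first exact: d_extensionality.
apply: d_allI => //; rewrite [map _ _]/=.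
set Gam1 := (tyBang s :: Gam); set Ph1 := (_ :: _).
have ht1 : typing n (map Int Gam1) (shift_tm 1 t) (tyArr s r) by apply: typing_shift1.
have hu1 : typing n (map Int Gam1) (shift_tm 1 u) (tyArr s r) by apply: typing_shift1.
have hx : typing n (map Int Gam1) (tmVar 0) (tyBang s) by apply: (@typing_int _ Gam1).
have xx : drv A n Gam1 Th Ph1 (pRel (rBang s s (rEq s)) (tmVar 0) (tmVar 0)).
  (* The schema is used for [!] of a type variable and then set at [s], since [s] may have free
     variables. *)
  apply: d_impE; first exact: d_andEr (@d_identity_at A n Gam1 Th Ph1 (tyBang (tyVar 0)) s
    (tmVar 0) (tmVar 0) isT ws hx hx).
  by apply: d_rEqI => //; apply: d_ext; apply: eqt_refl.
have D := d_comprE xx; rewrite rBang_inst in D.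
have {}D := d_allE_rel wr wr (adm_eq hA (n := n) Gam1 Th wr) D.
have {}D : drv A n Gam1 Th Ph1
    (pRel (rLolli (tyArr s r) (tyArr s r) r r (rArr s s r r (rEq s) (rEq r)) (rEq r))
       (tmTApp (tmApp (encB s) (tmVar 0)) r) (tmTApp (tmApp (encB s) (tmVar 0)) r)).
  apply: d_cast D _; rewrite subst_rLolli subst_rArr /rwk subst_ren_rel subst_id_rel.
  by cbn -[rLolli rArr rEq encB]; rewrite !subst_ren_ty !subst_id_ty.
have R : drv A n Gam1 Th Ph1 (pRel (rArr s s r r (rEq s) (rEq r)) (shift_tm 1 t) (shift_tm 1 u)).
  have we q : wf_ty n q -> wf_rel n Gam1 Th (rEq q) q q by move=> wq; apply: wf_rEq.
  apply: d_arrI => //; try exact: we.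
  set Gam3 := (_ :: _ :: Gam1).
  rewrite !shift2_rEq.
  have hv1 : typing n (map Int Gam3) (tmVar 1) s by apply: (@typing_int _ Gam3).
  have hv0 : typing n (map Int Gam3) (tmVar 0) s by apply: (@typing_int _ Gam3).
  have ht3 : typing n (map Int Gam3) (shift_tm 2 (shift_tm 1 t)) (tyArr s r) by apply: typing_shift2.
  have hu3 : typing n (map Int Gam3) (shift_tm 2 (shift_tm 1 u)) (tyArr s r) by apply: typing_shift2.
  have h1 := typing_app ht3 (typing_bang hv1).
  have h2 := typing_app hu3 (typing_bang hv0).
  apply: d_rEqI => //.
  (* The hypothesis compares [t] and [u] at the first argument; congruence then passes to the
     second, which equals it. *)
  apply: (d_eq_trans h1 (u := tmApp (shift_tm 2 (shift_tm 1 u)) (tmBang (tmVar 1)))).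
    have HP : drv A n Gam3 Th (pRel (rEq s) (tmVar 1) (tmVar 0) :: map (shift_prop 2) Ph1)
      (pAll s (pEq r (tmApp (shift_tm 1 (shift_tm 2 (shift_tm 1 t))) (tmBang (tmVar 0)))
                     (tmApp (shift_tm 1 (shift_tm 2 (shift_tm 1 u))) (tmBang (tmVar 0))))).
      apply: (@d_ax _ _ _ _ _ 1); rewrite /Ph1 /P /shift_prop /= !ren_id_ty.
      by rewrite /shift_tm !ren_ren_tm.
    have := d_allE hv1 HP; rewrite inst_prop_eq /inst_tm /=.
    by rewrite -!/(inst_tm _ (shift_tm 1 _)) !inst_shift_tm.
  apply: (d_eq_appr hu3 (typing_bang hv1)); apply: (d_eq_bang hv1).
  by apply: d_rEqE; apply: (@d_ax _ _ _ _ _ 0).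
have {}D := d_rEqE (d_lolliE ht1 hu1 D R).
have fG := lin_free_Int Gam1.
by apply: d_eq_conv D; [apply: typing_app hx | apply: encB_beta | apply: encB_beta].
Qed.

Variables (s : ty) (ws : wf_ty 1 s) (occ : occurs_only true 0 s).

Lemma src_single a b R : (src_ty [:: (a, b, R)] s = tapp s a) * (tgt_ty [:: (a, b, R)] s = tapp s b).
Proof. by split; apply: eq_subst_ty ws _; case. Qed.

(* Parametricity of u at the graph of h. *)
Lemma d_algebra_map_unfold n Gam Th Ph t f h u :
  wf_ty n t -> typing n (map Int Gam) f (tapp s t --o t) ->
  typing n (map Int Gam) h (mu s --o t) -> typing n (map Int Gam) u (mu s) ->
  drv A n (tapp s (mu s) :: Gam) Th (map (shift_prop 1) Ph)
    (pEq t (tmApp (shift_tm 1 h) (tmApp (in_ s) (tmVar 0)))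
           (tmApp (shift_tm 1 f) (tmApp (fmap s (mu s) t (shift_tm 1 h)) (tmVar 0)))) ->
  drv A n Gam Th Ph
    (pEq t (tmApp h (tmApp (tmTApp u (mu s)) (tmBang (in_ s)))) (tmApp (tmTApp u t) (tmBang f))).
Proof.
move=> wt hf hh hu hP; have wm := wf_mu ws n.
have wsm := wf_tapp ws wm; have wst := wf_tapp ws wt.
(* The pointwise algebra law, generalized over its argument, becomes a hypothesis; it is needed
   under the two variables of a relational implication. *)
move/(d_allI wsm): hP => hP; apply: d_impE hP.
have fG := lin_free_Int.
apply: d_impI.
  have hx : typing n (map Int (tapp s (mu s) :: Gam)) (tmVar 0) (tapp s (mu s)).
    by apply: (@typing_int _ (_ :: _)).
  have hh1 : typing n (map Int (tapp s (mu s) :: Gam)) (shift_tm 1 h) (mu s --o t).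
    exact: typing_shift1.
  have hf1 : typing n (map Int (tapp s (mu s) :: Gam)) (shift_tm 1 f) (tapp s t --o t).
    exact: typing_shift1.
  apply: wf_all => //; apply: wf_eq.
    by apply: (typing_app hh1); apply: typing_app hx; apply: in_typing_free.
  by apply: (typing_app hf1); apply: typing_app hx; apply: fmap_typing.
set Ph1 := (_ :: Ph).
have gA := adm_graph hA (n := n) (Gam := Gam) Th wm wt hh.
have gW := adm_rel hA gA.
pose e : renv := [:: (mu s, t, rGraph (mu s) t h)].
have hi := in_typing_free ws occ n (fG Gam).
(* [u] is related to itself, with [mu s] and [t] linked by the graph of [h]; feeding it the related
   algebras of [B] gives the claim. *)
have D := d_rint_piE wm wt gA (d_param A Th Ph1 (mu_closed ws) hu).
have eok : env_ok n Gam Th e by apply: env_ok_cons => //; apply: env_ok_nil.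
have wR := wf_rint s eok; rewrite !src_single in wR.
have B : drv A n Gam Th Ph1 (pRel (rBang (tapp s (mu s) --o mu s) (tapp s t --o t)
    (rLolli (tapp s (mu s)) (tapp s t) (mu s) t (rint s e) (rGraph (mu s) t h)))
    (tmBang (in_ s)) (tmBang f)).
  have wc a : wf_ty n a -> wf_ty n (tapp s a --o a) by move=> wa; rewrite /= wf_tapp.
  apply: d_bangI => //; try exact: wc; first exact: wf_rLolli.
  apply: d_lolliI => //.
  set Gam3 := (_ :: _ :: Gam).
  have hh3 : typing n (map Int Gam3) (shift_tm 2 h) (mu s --o t) by apply: typing_shift2.
  have hf3 : typing n (map Int Gam3) (shift_tm 2 f) (tapp s t --o t) by apply: typing_shift2.
  have hi3 : typing n (map Int Gam3) (in_ s) (tapp s (mu s) --o mu s) by apply: in_typing_free.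
  have hv1 : typing n (map Int Gam3) (tmVar 1) (tapp s (mu s)) by apply: (@typing_int _ Gam3).
  have hv0 : typing n (map Int Gam3) (tmVar 0) (tapp s t) by apply: (@typing_int _ Gam3).
  have gE : shift_rel 2 (rGraph (mu s) t h) = rGraph (mu s) t (shift_tm 2 h).
    exact: shift2_rGraph.
  have rE : shift_rel 2 (rint s e) = rint s [:: (mu s, t, rGraph (mu s) t (shift_tm 2 h))].
    rewrite /shift_rel ren_rint -gE.
    by congr (rint s [:: (_, _, _)]); exact: ren_id_ty.
  rewrite gE rE; set Ph3 := (_ :: _).
  have iE : shift_tm 2 (in_ s) = in_ s by apply: ren_in.
  rewrite iE; apply: d_graphI => //; try exact: typing_app hi3 hv1; try exact: typing_app hf3 hv0.
  have h1 := typing_app hh3 (typing_app hi3 hv1).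
  have hF : typing n (map Int Gam3) (fmap s (mu s) t (shift_tm 2 h)) (tapp s (mu s) --o tapp s t).
    exact: fmap_typing.
  (* For related [x], [y] the algebra law rewrites [h (in x)] to [f] of the action of [h] on [x],
     which [d_functor_graph] identifies with [y]. *)
  apply: (d_eq_trans h1
    (u := tmApp (shift_tm 2 f) (tmApp (fmap s (mu s) t (shift_tm 2 h)) (tmVar 1)))).
    have HP : drv A n Gam3 Th Ph3
      (pAll (tapp s (mu s)) (pEq t (tmApp (shift_tm 1 (shift_tm 2 h)) (tmApp (in_ s) (tmVar 0)))
        (tmApp (shift_tm 1 (shift_tm 2 f))
           (tmApp (fmap s (mu s) t (shift_tm 1 (shift_tm 2 h))) (tmVar 0))))).
      apply: (@d_ax _ _ _ _ _ 1); rewrite /Ph3 /Ph1 /shift_prop; cbn -[in_ mu fmap shift_tm upren].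
      by rewrite ren_in // ren_fmap // !ren_id_ty /shift_tm !ren_ren_tm.
    have := d_allE hv1 HP; rewrite inst_prop_eq /inst_tm; cbn -[in_ mu fmap shift_tm].
    rewrite subst_in // subst_fmap // !subst_id_ty.
    by rewrite -!/(inst_tm _ (shift_tm 1 _)) !inst_shift_tm.
  apply: (d_eq_appr hf3 (typing_app hF hv1)).
  by apply: d_functor_graph => //; apply: (@d_ax _ _ _ _ _ 0).
have {}D : drv A n Gam Th Ph1 (pRel
   (rLolli (tyBang (src_ty e s --o mu s)) (tyBang (tgt_ty e s --o t)) (mu s) t
     (rBang (src_ty e s --o mu s) (tgt_ty e s --o t)
        (rLolli (src_ty e s) (tgt_ty e s) (mu s) t (rint s e) (rGraph (mu s) t h)))
     (rGraph (mu s) t h))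
   (tmTApp u (mu s)) (tmTApp u t)) by exact: D.
rewrite !src_single in D.
apply: d_graphE; apply: d_lolliE D B; exact: typing_bang.
Qed.

(** The reflection law: up to β the left side is [fold] at the algebra [in_], applied to [u]. *)
Lemma d_mu_eta n Gam Th Ph u :
  typing n (map Int Gam) u (mu s) ->
  drv A n Gam Th Ph (pEq (mu s) (tmApp (tmTApp u (mu s)) (tmBang (in_ s))) u).
Proof.
move=> hu; have fG := lin_free_Int; have wm k := wf_mu ws k.
have hw m Gm v : typing m (map Int Gm) v (mu s) ->
    typing m (map Int Gm) (tmApp (tmTApp v (mu s)) (tmBang (in_ s))) (mu s).
  move=> hv; apply: typing_app (typing_tapp_mu hv (wm m)) _.
  by apply: typing_bang; apply: in_typing_free.
have tE : tapp s (tyVar 0) = s by apply: inst_var0_ty.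
apply: d_impE; first exact: d_extensionalityT (hw _ _ _ hu) hu.
apply: d_allTI; set Gam1 := map _ Gam.
have hu1 : typing n.+1 (map Int Gam1) (tshift_tm 1 u) (mu s).
  have := typing_tshift1 hu; rewrite ren_mu // -map_Int_ren; exact.
have w1 : wf_ty n.+1 (s --o tyVar 0).
  by rewrite /= (wf_ty_le ws).
have eE : tshift_tm 1 (tmApp (tmTApp u (mu s)) (tmBang (in_ s)))
    = tmApp (tmTApp (tshift_tm 1 u) (mu s)) (tmBang (in_ s)).
  by rewrite /tshift_tm; cbn -[in_ mu]; rewrite ren_mu // ren_in.
rewrite eE; have hv0 : forall v, typing n.+1 (map Int Gam1) v (mu s) ->
    typing n.+1 (map Int Gam1) (tmTApp v (tyVar 0)) (tyArr (s --o tyVar 0) (tyVar 0)).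
  by move=> v hv; apply: (typing_cast (typing_tapp_mu hv _)) => //; rewrite tE.
apply: d_bang_ext => //; [exact: hv0 (hw _ _ _ hu1) | exact: hv0 | ].
set Gam2 := (_ :: Gam1).
have hu2 : typing n.+1 (map Int Gam2) (shift_tm 1 (tshift_tm 1 u)) (mu s) by apply: typing_shift1.
have hg : typing n.+1 (map Int Gam2) (tmVar 0) (tapp s (tyVar 0) --o tyVar 0).
  by rewrite tE; apply: (@typing_int _ Gam2).
have hF : typing n.+1 (map Int Gam2) (fold_at s (tyVar 0) (tmVar 0)) (mu s --o tyVar 0).
  exact: fold_at_typing.
set u2 := shift_tm 1 (tshift_tm 1 u).
have -> : shift_tm 1 (tmTApp (tmApp (tmTApp (tshift_tm 1 u) (mu s)) (tmBang (in_ s))) (tyVar 0))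
    = tmTApp (tmApp (tmTApp u2 (mu s)) (tmBang (in_ s))) (tyVar 0).
  by rewrite /shift_tm; cbn -[in_ mu tshift_tm]; rewrite ren_mu // ren_in.
have -> : shift_tm 1 (tmTApp (tshift_tm 1 u) (tyVar 0)) = tmTApp u2 (tyVar 0) by [].
have hr : typing n.+1 (map Int Gam2) (tmApp (tmTApp u2 (tyVar 0)) (tmBang (tmVar 0))) (tyVar 0).
  by apply: typing_app (typing_bang hg); apply: typing_tapp_mu.
(* Both sides are now at a fresh type variable and a fresh algebra on it. By β the left side is the
   fold for that algebra at the unfolded [u], and parametricity applies because this fold satisfies
   the algebra law externally. *)
apply: d_eq_conv (d_algebra_map_unfold _ hg hF hu2 _) => //.
- by apply: typing_app (typing_bang hg); apply: typing_tapp_mu => //; apply: hw.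
- by apply: fold_beta => //; apply: hw.
- exact: eqt_refl.
set Gam3 := (_ :: Gam2); apply: d_ext.
have -> : shift_tm 1 (fold_at s (tyVar 0) (tmVar 0)) = fold_at s (tyVar 0) (tmVar 1).
  exact: ren_fold_at.
have hg3 : typing n.+1 (map Int Gam3) (tmVar 1) (tapp s (tyVar 0) --o tyVar 0).
  by rewrite tE; apply: (@typing_int _ Gam3).
by apply: fold_algebra => //; apply: (@typing_int _ Gam3).
Qed.

(** * Composites and the two halves of initiality *)

Lemma comp_typing n G a b c g f :
  lin_free G -> wf_ty n a -> typing n G f (a --o b) -> typing n G g (b --o c) ->
  typing n G (tmComp a g f) (a --o c).
Proof.
move=> hG wa hf hg; apply: ty_lam => //.
apply: ty_app; first by apply: cs_right; apply: csplit_free.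
  exact: typing_shift1 hg.
apply: ty_app; first by apply: cs_right; apply: csplit_free.
  exact: typing_shift1 hf.
by apply: ty_lin => //=; rewrite (eqP hG).
Qed.

Lemma comp_beta n G a b c g f x :
  lin_free G -> wf_ty n a -> typing n G f (a --o b) -> typing n G g (b --o c) ->
  typing n G x a ->
  eqt n G (tmApp (tmComp a g f) x) (tmApp g (tmApp f x)) c.
Proof.
move=> hG wa hf hg hx; apply: eqt_trans.
  by apply: eqt_beta_lam; apply: (free_app hG _ hx); apply: comp_typing hf hg.
rewrite /inst_tm /= -!/(inst_tm x (shift_tm 1 _)) !inst_shift_tm.
by apply: eqt_refl; apply: (free_app hG hg); apply: (free_app hG hf hx).
Qed.

Lemma ren_comp rt r a g f :
  ren_tm rt r (tmComp a g f) = tmComp (ren_ty rt a) (ren_tm rt r g) (ren_tm rt r f).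
Proof. by rewrite !ren_as_subst_tm subst_comp ren_as_subst_ty. Qed.

Lemma algebra_map_unique n t f h :
  is_algebra n s t f -> algebra_map A n s (mu s) (in_ s) t f h ->
  eq_morphism A n (mu s) t h (fold_at s t f).
Proof.
case=> wt hf [hh hE]; rewrite /morphism in hf hh.
have wm := wf_mu ws n; have wsm := wf_tapp ws wm; have fG := lin_free_Int.
have hF (Gm : seq ty) h' : typing n (map Int Gm) h' (mu s --o t) ->
  typing n (map Int Gm) (fmap s (mu s) t h') (tapp s (mu s) --o tapp s t).
  by move=> h1; apply: fmap_typing.
have hi (Gm : seq ty) := in_typing_free ws occ n (fG Gm).
have hfold : typing n (map Int [::]) (fold_at s t f) (mu s --o t) by apply: fold_at_typing.
(* The algebra equation is provable in the empty context; as a hypothesis it stays available under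
   the variables introduced below. *)
rewrite /eq_morphism /provable; apply: d_impE hE; apply: d_impI.
  apply: wf_eq; first by apply: (comp_typing (b := mu s)) => //; apply: (hi [::]).
  by apply: (comp_typing (b := tapp s t)) => //; apply: (hF [::] _ hh).
apply: d_impE; first exact: (@d_extensionality A n [::] [::] _ (mu s) t h (fold_at s t f)).
apply: d_allI => //; set Gam1 := [:: mu s]; set Ph1 := map _ _.
have hu : typing n (map Int Gam1) (tmVar 0) (mu s) by apply: (@typing_int _ Gam1).
have hh1 : typing n (map Int Gam1) (shift_tm 1 h) (mu s --o t) by apply: (@typing_shift1 _ _ [::]).
have hf1 : typing n (map Int Gam1) (shift_tm 1 f) (tapp s t --o t) by apply: (@typing_shift1 _ _ [::]).
have -> : shift_tm 1 (fold_at s t f) = fold_at s t (shift_tm 1 f).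
  by rewrite /shift_tm ren_fold_at // ren_id_ty.
have hw : typing n (map Int Gam1) (tmApp (tmTApp (tmVar 0) (mu s)) (tmBang (in_ s))) (mu s).
  by apply: typing_app (typing_tapp_mu hu wm) (typing_bang (hi Gam1)).
have hfold1 : typing n (map Int Gam1) (fold_at s t (shift_tm 1 f)) (mu s --o t).
  exact: fold_at_typing.
(* The argument is expanded by [d_mu_eta] into the form to which parametricity applies. *)
apply: (d_eq_trans (typing_app hh1 hu)
  (u := tmApp (shift_tm 1 h) (tmApp (tmTApp (tmVar 0) (mu s)) (tmBang (in_ s))))).
  by apply: d_eq_sym; [apply: typing_app hh1 hw | apply: (d_eq_appr hh1 hw); apply: d_mu_eta].
have h1 := typing_app hh1 hw.
apply: (d_eq_conv h1 (eqt_refl h1)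
  (u := tmApp (tmTApp (tmVar 0) t) (tmBang (shift_tm 1 f)))).
  by apply: eqt_sym; apply: fold_beta.
apply: d_algebra_map_unfold => //.
set Gam2 := (_ :: Gam1).
have hx : typing n (map Int Gam2) (tmVar 0) (tapp s (mu s)) by apply: (@typing_int _ Gam2).
have hh2 : typing n (map Int Gam2) (shift_tm 1 (shift_tm 1 h)) (mu s --o t) by apply: typing_shift1.
have hf2 : typing n (map Int Gam2) (shift_tm 1 (shift_tm 1 f)) (tapp s t --o t) by apply: typing_shift1.
have hF2 := hF Gam2 _ hh2.
have hE : drv A n Gam2 [::] (map (shift_prop 1) Ph1)
    (pEq (tapp s (mu s) --o t)
      (tmComp (tapp s (mu s)) (shift_tm 1 (shift_tm 1 h)) (in_ s))
      (tmComp (tapp s (mu s)) (shift_tm 1 (shift_tm 1 f))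
         (fmap s (mu s) t (shift_tm 1 (shift_tm 1 h))))).
  apply: (@d_ax _ _ _ _ _ 0); rewrite /Ph1 /shift_prop; cbn -[in_ mu fmap tmComp].
  by rewrite !ren_comp !ren_in // !ren_fmap // !ren_id_ty.
(* Applied to a variable, the equality of composites becomes the pointwise law after β. *)
apply: d_eq_conv (d_eq_appl _ hx hE).
- by apply: (typing_app hh2); apply: typing_app hx.
- exact: (comp_beta (fG Gam2) wsm (hi Gam2) hh2 hx).
- exact: (comp_beta (fG Gam2) wsm hF2 hf2 hx).
- exact: (comp_typing (fG Gam2) wsm (hi Gam2) hh2).
Qed.

(** By extensionality it is enough to compare values, where the composites β-reduce to the two sides
    of [fold_algebra]. Existence is computational; parametricity enters in uniqueness. *)
Lemma fold_algebra_map n t f :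
  is_algebra n s t f -> algebra_map A n s (mu s) (in_ s) t f (fold_at s t f).
Proof.
case=> wt hf; have wm := wf_mu ws n; have wsm := wf_tapp ws wm.
have hi := in_typing_free ws occ n (lin_free_Int [::]).
have hfold : typing n (map Int [::]) (fold_at s t f) (mu s --o t) by apply: fold_at_typing.
have hF : typing n (map Int [::]) (fmap s (mu s) t (fold_at s t f)) (tapp s (mu s) --o tapp s t).
  exact: fmap_typing.
split=> //; rewrite /eq_morphism /provable.
have c1 := comp_typing (lin_free_Int [::]) wsm hi hfold.
have c2 := comp_typing (lin_free_Int [::]) wsm hF hf.
apply: d_impE; first exact: d_extensionality c1 c2.
apply: d_allI => //; set Gam1 := [:: _].
have hx : typing n (map Int Gam1) (tmVar 0) (tapp s (mu s)) by apply: (@typing_int _ Gam1).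
have hi1 := in_typing_free ws occ n (lin_free_Int Gam1).
have hf1 : typing n (map Int Gam1) (shift_tm 1 f) (tapp s t --o t) by apply: (@typing_shift1 _ _ [::]).
have hfold1 : typing n (map Int Gam1) (fold_at s t (shift_tm 1 f)) (mu s --o t).
  exact: fold_at_typing.
apply: d_ext; rewrite /shift_tm !ren_comp ren_in // ren_fmap // ren_fold_at // !ren_id_ty.
apply: eqt_trans; first exact: comp_beta hi1 hfold1 hx.
apply: eqt_trans; first exact: fold_algebra.
apply: eqt_sym; exact: (comp_beta (lin_free_Int Gam1) wsm (fmap_typing ws occ (lin_free_Int Gam1) wm wt hfold1) hf1 hx).
Qed.

End Uniqueness.

Theorem theorem2p24 (A : adm_pred) (hA : adm_class A) (n : nat) (sigma : ty)
    (hwf : wf_ty 1 sigma) (hind : ind_constructed sigma)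
    (hpos : occurs_only true 0 sigma) :
  (forall (tau : ty) (f h : tm),
     is_algebra n sigma tau f ->
     algebra_map A n sigma (mu sigma) (in_ sigma) tau f h ->
     eq_morphism A n (mu sigma) tau h (fold_at sigma tau f)) /\
  initial_algebra A n sigma (mu sigma) (in_ sigma).
Proof.
have uniq_fold := algebra_map_unique hA hwf hpos (n := n).
split=> //; split.
  by split; [apply: wf_mu | apply: in_typing_free].
move=> t f alg; split; first by exists (fold_at sigma t f); apply: fold_algebra_map.
move=> h h' hh hh'.
have [wt hf] := alg.
apply: (@d_eq_trans A n [::] [::] [::] _ h (fold_at sigma t f) h'); first by case: hh.
  exact: uniq_fold.
by apply: d_eq_sym; [case: hh' | apply: uniq_fold].
Qed.
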